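(* Let $m\geq1$. The space $\mathcal Ov^1(m)$ of normalized overlapping intervals admits the structure of a finite regular CW complex such that the map $p_m:\mathcal Ov^1(m)\to\mathcal Cact^1(m)$ is cellular, where $\mathcal Cact^1(m)$ carries Kaufmann's regular CW structure.
   Context: $\mathbb I=[-1,1]$. A little interval is an orientation-preserving affine-linear embedding $\mathbb I\to\mathbb I$, identified with its image $[x,y]$. $\mathcal Ov(m)$ is the quotient of $\{\text{little intervals}\}^m\times\mathfrak S_m$ by $((L_i),\sigma)\sim((J_i),\tau)$ iff $L_i=J_i$ for all $i$ and, for all $i,j$ with $\mathring L_i\cap\mathring L_j\ne\emptyset$, $\sigma^{-1}(i)<\sigma^{-1}(j)\iff\tau^{-1}(i)<\tau^{-1}(j)$ ($\sigma^{-1}(i)$ is the $\sigma$-height of $i$). b/w trees: a planted tree is a finite rooted tree, edges directed away from the root, with a linear order on outgoing edges at each vertex; $u$ is above $v$ if $u\ne v$ and the root-to-$u$ path passes through $v$, directly above if there is an edge $v\to u$; if $v$ has outgoing edges to $u_1,u_2$ with that to $u_1$ first, $u_1$ is left of $u_2$, $u_2$ right of $u_1$. A b/w tree ($\in\mathcal T_m$) is a planted tree with vertices colored black/white, edges joining different colors, black root, all non-root univalent vertices white, white vertices labelled bijectively by $1,\dots,m$; $|w|$ denotes the number of outgoing edges of a vertex $w$. $T$ is compatible with $\sigma\in\mathfrak S_m$ if along each directed path from the root the white labels form a subsequence of $(\sigma(1),\dots,\sigma(m))$. $\alpha(v)$ = number of white vertices above $v$ for black $v$, plus one for white $v$. For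 white $i$: $\lambda(i),\rho(i)$ the white vertices to the left/right of $i$; $\lambda^+(i)$ the $w\in\lambda(i)$ with $\sigma^{-1}(w)>\sigma^{-1}(i)$ such that every $w'$ right of $w$ and left of $i$ has $\sigma^{-1}(w')>\sigma^{-1}(i)$; $\rho^+(i)$ symmetric. $\mathcal Ov^1(m,\sigma,T)\subseteq\mathcal Ov(m)$ ($T$ compatible with $\sigma$) is the set of $[(L_i=[x_i,y_i]),\sigma]$ for which there exist intervals $[x_v,y_v]$ for black $v$ with: $[x_v,y_v]=\mathbb I$ at the root; for white $i$ directly above black $v$, with $a_i=x_v+\frac2m\sum_{\lambda(i)\setminus\lambda^+(i)}\alpha(j)$, $b_i=x_v+\frac2m\sum_{\lambda(i)}\alpha(j)$, $c_i=y_v-\frac2m\sum_{\rho(i)}\alpha(j)$, $d_i=y_v-\frac2m\sum_{\rho(i)\setminus\rho^+(i)}\alpha(j)$: $a_i\le x_i\le b_i$, $c_i\le y_i\le d_i$; for the black vertices $v_1,\dots,v_k$ directly above a white $i$ in left-to-right order, each $[x_{v_j},y_{v_j}]$ has length $2\alpha(v_j)/m$, lies in $[b_i,c_i]$, and lies left of $[x_{v_{j+1}},y_{v_{j+1}}]$ meeting it in at most one point. $\mathcal Ov^1(m)=\bigcup_{\sigma,T}\mathcal Ov^1(m,\sigma,T)$ with the subspace topology. Normalized cacti: $\mathcal Cact^1(m)$ is the space of $m$-tuples $(P_1,\dots,P_m)$ of finite unions of closed arcs of $S^1=\mathbb R/\mathbb Z$ (basepoint $0$), each of total length $1/m$, with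 pairwise disjoint interiors, covering $S^1$, such that the sequence of labels of arcs met traversing $S^1$ from $0$ contains no sublist $(i,j,i,j)$, $i\ne j$; it is topologized as the subspace of based maps $g:S^1\to(S^1)^m$, $\pi_i g(s)=m\cdot\mathrm{length}(P_i\cap[0,s])$ mod $1$. The cactus is $g(S^1)$, its lobe $i$ is $g(P_i)$; its underlying b/w tree has a white vertex per lobe, black vertices the global root $g(0)$ and the points lying on at least two lobes, and an edge between a black $v$ and white $i$ iff $v\in g(P_i)$, rooted at $g(0)$, planar order from the traversal. Kaufmann's CW structure: the open cells are indexed by $T\in\mathcal T_m$, the open cell of $T$ being the cacti with underlying tree $T$, identified with the interior of $\Delta^{|w_1|}\times\dots\times\Delta^{|w_m|}$ via $m$ times the lengths of the arcs of each lobe between consecutive black vertices starting from its local root; closed cells are the corresponding products of simplices, faces given by arc lengths becoming $0$. The map $p_m$: for $[(L_i),\sigma]\in\mathcal Ov^1(m)$, $p_m[(L_i),\sigma]$ is the normalized cactus whose $P_i$ is the image under $\mathbb I\to S^1$, $s\mapsto(s+1)/2$ mod $1$, of the closure of the set of $s\in\mathbb I$ such that, among all $j$ with $s\in L_j$, $i$ has the largest $\sigma$-height $\sigma^{-1}(j)$. This is a well-defined continuous surjection. *)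

(* Defs.v *)
From HB Require Import structures.
From mathcomp Require Import all_boot all_order all_algebra all_fingroup.
From mathcomp Require Import all_classical all_reals all_analysis.
Set Implicit Arguments. Unset Strict Implicit. Unset Printing Implicit Defensive.
Import Order.TTheory GRing.Theory Num.Theory.
Import numFieldNormedType.Exports.
Local Open Scope classical_set_scope.
Local Open Scope ring_scope.

Section Defs.
Variable R : realType.
Variable m : nat.

(* A little interval is identified with its image [x,y], -1 <= x < y <= 1. *)
Definition little (I : R * R) : Prop := -1 <= I.1 /\ I.1 < I.2 /\ I.2 <= 1.

Definition ovraw := (('I_m -> R * R) * 'S_m)%type.

Definition ov_valid (y : ovraw) : Prop := forall i, little (y.1 i).

Definition height (s : 'S_m) (i : 'I_m) : nat := nat_of_ord ((s^-1)%g i).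

Definition int_meet (I J : R * R) : Prop := I.1 < J.2 /\ J.1 < I.2.

Definition ov_rel (y z : ovraw) : Prop :=
  y.1 = z.1 /\
  forall i j, int_meet (y.1 i) (y.1 j) ->
    ((height y.2 i < height y.2 j)%N <-> (height z.2 i < height z.2 j)%N).

(* points of Ov(m) are equivalence classes of valid raw data *)
Definition ovpt := set ovraw.
Definition cls (y : ovraw) : ovpt := [set z | ov_valid z /\ ov_rel y z].

(* quotient topology: the space of little intervals carries the subspace
   topology of R^2, S_m is discrete; U is open iff its preimage is open *)
Definition ov_open (U : set ovpt) : Prop :=
  forall y, ov_valid y -> U (cls y) ->
    exists2 e : R, 0 < e & forall L' : 'I_m -> R * R,
      ov_valid (L', y.2) ->
      (forall i, `|(L' i).1 - (y.1 i).1| < e /\ `|(L' i).2 - (y.1 i).2| < e) ->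
      U (cls (L', y.2)).

(* White vertices are the labels 'I_m (inl), black vertices are 'I_nb
   (inr); par is the parent map (par root = root), pos orders siblings. *)
Record bwtree := BWTree {
  nb : nat;
  broot : 'I_nb;
  par : ('I_m + 'I_nb)%type -> ('I_m + 'I_nb)%type;
  pos : ('I_m + 'I_nb)%type -> nat }.
Arguments par : clear implicits.
Arguments pos : clear implicits.
Arguments broot : clear implicits.

Definition vtx (T : bwtree) := ('I_m + 'I_(nb T))%type.
Definition vroot (T : bwtree) : vtx T := inr (broot T).
Definition is_white (T : bwtree) (v : vtx T) : Prop := exists i, v = inl i.

Definition is_bwtree (T : bwtree) : Prop :=
  [/\ par T (vroot T) = vroot T,
      (forall v : vtx T, exists n, iter n (par T) v = vroot T),
      (forall i : 'I_m, exists b, par T (inl i : vtx T) = inr b),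
      (forall b : 'I_(nb T), b <> broot T -> exists i, par T (inr b) = inl i)
    & (* non-root univalent vertices are white *)
      (forall b : 'I_(nb T), b <> broot T -> exists u, par T u = inr b /\ u <> inr b) /\
      (forall u v : vtx T, u <> v -> u <> vroot T -> v <> vroot T ->
         par T u = par T v -> pos T u <> pos T v)].

Definition above (T : bwtree) (u v : vtx T) : Prop :=
  u <> v /\ exists n, iter n (par T) u = v.

Definition dabove (T : bwtree) (u v : vtx T) : Prop :=
  u <> vroot T /\ par T u = v.

Definition leftof (T : bwtree) (u1 u2 : vtx T) : Prop :=
  u1 <> vroot T /\ u2 <> vroot T /\ par T u1 = par T u2 /\ (pos T u1 < pos T u2)%N.

(* compatibility with sigma: white labels along directed paths from the root
   form a subsequence of (sigma(1),...,sigma(m)) *)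
Definition compatible (T : bwtree) (s : 'S_m) : Prop :=
  forall i j : 'I_m, above (inl j : vtx T) (inl i : vtx T) -> (height s i < height s j)%N.

Definition alpha (T : bwtree) (v : vtx T) : nat :=
  #|[set u : vtx T | `[< is_white u /\ above u v >]]| + `[< is_white v >].

Definition asum (T : bwtree) (S : vtx T -> Prop) : nat :=
  (\sum_(w : vtx T | `[< S w >]) alpha w)%N.

Definition lam (T : bwtree) (i : vtx T) (w : vtx T) : Prop := is_white w /\ leftof w i.
Definition rho (T : bwtree) (i : vtx T) (w : vtx T) : Prop := is_white w /\ leftof i w.

Definition vheight (T : bwtree) (s : 'S_m) (v : vtx T) : nat :=
  match v with inl i => height s i | inr _ => 0%N end.

Definition lamplus (T : bwtree) (s : 'S_m) (i w : vtx T) : Prop :=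
  lam i w /\ (vheight s w > vheight s i)%N /\
  forall w', leftof w w' -> leftof w' i -> (vheight s w' > vheight s i)%N.

Definition rhoplus (T : bwtree) (s : 'S_m) (i w : vtx T) : Prop :=
  rho i w /\ (vheight s w > vheight s i)%N /\
  forall w', leftof i w' -> leftof w' w -> (vheight s w' > vheight s i)%N.

Definition tm : R := 2 / m%:R.

Definition ov1_cond (T : bwtree) (s : 'S_m) (L : 'I_m -> R * R) : Prop :=
  exists xb yb : 'I_(nb T) -> R,
  [/\ xb (broot T) = -1 /\ yb (broot T) = 1,
      (forall (i : 'I_m) (v : 'I_(nb T)), par T (inl i : vtx T) = inr v ->
        let a := xb v + tm * (asum (fun w => lam (inl i : vtx T) w /\ ~ lamplus s (inl i : vtx T) w))%:R in
        let b := xb v + tm * (asum (lam (inl i : vtx T)))%:R in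
        let c := yb v - tm * (asum (rho (inl i : vtx T)))%:R in
        let d := yb v - tm * (asum (fun w => rho (inl i : vtx T) w /\ ~ rhoplus s (inl i : vtx T) w))%:R in
        [/\ a <= (L i).1, (L i).1 <= b, c <= (L i).2 & (L i).2 <= d])
    &
      (forall (i : 'I_m) (v : 'I_(nb T)) (u : 'I_(nb T)),
        par T (inl i : vtx T) = inr v -> dabove (inr u) (inl i : vtx T) ->
        let b := xb v + tm * (asum (lam (inl i : vtx T)))%:R in
        let c := yb v - tm * (asum (rho (inl i : vtx T)))%:R in
        [/\ yb u - xb u = tm * (alpha (inr u : vtx T))%:R,
            b <= xb u, yb u <= c &
            forall u' : 'I_(nb T), leftof (inr u : vtx T) (inr u') ->
              (~ exists w, leftof (inr u : vtx T) w /\ leftof w (inr u')) ->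
              yb u <= xb u'])].

Definition Ov1 : set ovpt :=
  [set c | exists (T : bwtree) (s : 'S_m) (L : 'I_m -> R * R),
     [/\ is_bwtree T, compatible T s, ov_valid (L, s), ov1_cond T s L
       & c = cls (L, s)]].

(* S^1 = R/Z is parametrized by [0,1); basepoint 0. *)
Definition to_circle (s : R) : R := if s == 1 then 0 else (s + 1) / 2.

Definition pm (y : ovraw) (i : 'I_m) : set R :=
  to_circle @` @closure R [set s : R | -1 <= s <= 1 /\ (y.1 i).1 <= s <= (y.1 i).2 /\
     forall j, (y.1 j).1 <= s <= (y.1 j).2 -> (height y.2 j <= height y.2 i)%N].

Definition frac (x : R) : R := x - (Num.floor x)%:~R.

Definition gmap (P : 'I_m -> set R) (t : R) : 'I_m -> R :=
  fun i => frac (m%:R * fine (lebesgue_measure (P i `&` `[0, t]%classic))).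

Definition lobe (P : 'I_m -> set R) (i : 'I_m) : set ('I_m -> R) := gmap P @` P i.

(* black vertices of the underlying b/w tree: g(0) and the points lying
   on at least two lobes *)
Definition blackpts (P : 'I_m -> set R) : set ('I_m -> R) :=
  [set gmap P 0] `|` [set q | exists i j, i <> j /\ lobe P i q /\ lobe P j q].

Definition has_size (T : Type) (A : set T) (n : nat) : Prop :=
  exists f : 'I_n -> T, injective f /\ range f = A.

(* The cactus lies in the n-skeleton of Kaufmann's CW structure, i.e. the
   dimension sum_i |w_i| of the cell of its underlying tree is <= n;
   |w_i| = (number of black vertices on lobe i) - 1 (all but the local root). *)
Definition kaufmann_skel (P : 'I_m -> set R) (n : nat) : Prop :=
  exists ns : 'I_m -> nat,
    (forall i, has_size (blackpts P `&` lobe P i) (ns i)) /\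
    (\sum_(i < m) (ns i).-1 <= n)%N.

Definition sqn (d : nat) (p : 'I_d -> R) : R := \sum_(k < d) p k ^+ 2.
Definition cball (d : nat) : set ('I_d -> R) := [set p | sqn p <= 1].
Definition oball (d : nat) : set ('I_d -> R) := [set p | sqn p < 1].
Definition sphere (d : nat) : set ('I_d -> R) := [set p | sqn p = 1].
Arguments cball : clear implicits.
Arguments oball : clear implicits.
Arguments sphere : clear implicits.

Definition rel_open_ball (d : nat) (O : set ('I_d -> R)) : Prop :=
  O `<=` cball d /\
  forall p, O p -> exists2 e : R, 0 < e &
     forall q, cball d q -> (forall k, `|q k - p k| < e) -> O q.

Record cell := Cell { cdim : nat; cmap : ('I_cdim -> R) -> ovpt }.
Arguments cmap : clear implicits.

Definition closed_cell (c : cell) : set ovpt := cmap c @` cball (cdim c).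
Definition open_cell (c : cell) : set ovpt := cmap c @` oball (cdim c).

Definition char_homeo (c : cell) : Prop :=
  [/\
      (forall U, ov_open U -> forall p, cball (cdim c) p -> U (cmap c p) ->
        exists2 e : R, 0 < e & forall q, cball (cdim c) q ->
          (forall k, `|q k - p k| < e) -> U (cmap c q)),
      {in cball (cdim c) &, injective (cmap c)}
    &
      (forall O, rel_open_ball (d := cdim c) O ->
        exists2 U, ov_open U & cmap c @` O = U `&` closed_cell c)].

Definition hausdorff_sub (A : set ovpt) : Prop :=
  forall x y, A x -> A y -> x <> y ->
    exists U V, [/\ ov_open U, ov_open V, U x, V y & U `&` V `&` A = set0].

(* a finite regular CW structure on A (finite: closure finiteness and the
   weak topology are automatic) *)
Definition regular_cw (A : set ovpt) (I : finType) (cs : I -> cell) : Prop :=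
  [/\ hausdorff_sub A,
      (forall k, char_homeo (cs k)),
      (forall x, A x <-> exists k, open_cell (cs k) x),
      (forall k l : I, k <> l -> open_cell (cs k) `&` open_cell (cs l) = set0)
    &
      (forall k p, sphere (cdim (cs k)) p ->
         exists l, (cdim (cs l) < cdim (cs k))%N /\ open_cell (cs l) (cmap (cs k) p))].

Definition pm_cellular (I : finType) (cs : I -> cell) : Prop :=
  forall n (x : ovpt), (exists k, (cdim (cs k) <= n)%N /\ closed_cell (cs k) x) ->
    forall y, ov_valid y -> cls y = x -> kaufmann_skel (pm y) n.

End Defs.

(* Main.v *)
(** Scale [-1,1] to [0,m]. In a point of Ov^1(m) every interval L_i contains a
    core K_i, the hull of its lobe. The cores form a laminar family, the length
    of K_i is the number of cores nested in it, and the family is determined by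
    the point as soon as no core shares an endpoint with one nested in it; at a
    generic position the highest interval is the one with the smallest core.
    Cores linked end to end form the frames, that is, the black vertices of the
    tree of the cactus. All conditions defining Ov^1(m) are comparisons of
    differences of endpoints with integers within one frame, or comparisons of
    core endpoints. A cell consists of the points with the same outcome of all
    these comparisons: it is a relatively open convex polytope in the space of
    endpoints, hence a ball. On its boundary frames merge and further equalities
    hold, so the dimension drops. Since every frame but the root frame can be
    translated inside a cell, the dimension of a cell is at least the number of
    non-root black vertices, which is the dimension of the Kaufmann cell. *)

Require Import Defs.
From HB Require Import structures.
From mathcomp Require Import all_boot all_order all_algebra all_fingroup.
From mathcomp Require Import all_classical all_reals all_analysis.
From mathcomp Require Import ring lra zify.
Set Implicit Arguments. Unset Strict Implicit. Unset Printing Implicit Defensive.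
Import Order.TTheory GRing.Theory Num.Theory.
Import numFieldNormedType.Exports.
Local Open Scope ring_scope.

(** * Laminar families of cores *)

(** The obstacle is that one point of Ov^1(m) has many descriptions: different trees, permutations
    and black intervals can give the same class, so cells cannot be indexed by pairs (T, sigma).
    Trimming shared endpoints turns any description into a [strict] one, whose cores depend only on
    the intervals and on the height comparisons of overlapping ones. Trees serve only to find one
    such family and to show that the whole closed polytope around it stays in Ov^1(m). A limit of
    strict families need not be strict, so the normal form has to be taken again there. It moves
    core endpoints by integers, within frames that only grow; hence every equation valid at the
    limit still constrains the tangent directions afterwards. This gives the drop in dimension
    without describing the boundary cell explicitly. Regularity needs the intervals to determine the
    cores on closed cells too: every frame has an interval that begins with its core, and the other
    core endpoints of the frame lie at fixed integer distances from it. *)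

Section Flat.
Variables (R : realType) (m : nat).
Implicit Types (X Y b g : 'I_m -> R) (h : 'I_m -> nat).

Definition inside b g (i j : 'I_m) := (b j <= b i) && (g i <= g j).
Definition disj b g (i j : 'I_m) := (g i <= b j) || (g j <= b i).
Definition touch b g (i j : 'I_m) := (g i == b j) || (g j == b i).
(* The classes of [conn] are the sets of white vertices directly above one black vertex. *)
Definition conn b g := connect (touch b g).

(* [lam_cover]: outside its core, an interval only runs underneath higher cores
   that are not nested with its own. *)
Record laminar b g X Y h : Prop := Laminar {
  lam_len : forall i, g i = b i + #|[set j | inside b g j i]|%:R;
  lam_tri : forall i j, i != j -> [|| disj b g i j, inside b g i j | inside b g j i];
  lam_lo : forall i, 0 <= b i;
  lam_hi : forall i, g i <= m%:R;
  lam_height : forall i j, i != j -> inside b g j i -> (h i < h j)%N;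
  lam_left : forall i, X i <= b i;
  lam_right : forall i, g i <= Y i;
  lam_cover : forall i t, X i < t -> t < Y i -> ~~ (b i <= t <= g i) ->
    exists k, [/\ b k <= t <= g k, disj b g i k & (h i < h k)%N] }.

Definition strict b g := forall i j, i != j -> inside b g i j -> b j < b i /\ g i < g j.

(* [b', g'] arises from [b, g] by contracting gaps of length zero: every old
   endpoint survives as an endpoint in the same, possibly larger, frame. *)
Definition refines b g b' g' : Prop :=
  [/\ forall i, exists2 l, conn b' g' l i & b i = b' l,
      forall i, exists2 l, conn b' g' l i & g i = g' l,
      forall i, exists n : nat, b' i = b i + n%:R
    & forall i, exists n : nat, g i = g' i + n%:R].

Lemma conn_sym b g i j : conn b g i j = conn b g j i.
Proof.
rewrite /conn; apply: (@sym_connect_sym _ (touch b g)) => x y.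
by rewrite /touch orbC.
Qed.

Lemma conn_trans b g j i k : conn b g i j -> conn b g j k -> conn b g i k.
Proof. exact: connect_trans. Qed.

Lemma touch_conn b g i j : g i = b j -> conn b g i j.
Proof. by move=> e; apply: connect1; rewrite /touch e eqxx. Qed.

Lemma conn_refl b g i : conn b g i i.
Proof. exact: connect0. Qed.

Lemma conn_ind b g (P : 'I_m -> 'I_m -> Prop) :
  (forall i, P i i) ->
  (forall i j k, touch b g i j -> conn b g j k -> P j k -> P i k) ->
  forall i j, conn b g i j -> P i j.
Proof.
move=> P0 P1 i j /connectP[p]; elim: p i j => [|k p IH] i j /= pth ->.
  exact: P0.
have /andP[ik kp] := pth; apply: (P1 _ _ _ ik) => //.
  by apply/connectP; exists p.
exact: (IH k _ kp erefl).
Qed.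

Lemma refines_refl b g : refines b g b g.
Proof.
by split=> i; [exists i => // | exists i => // | exists 0%N | exists 0%N];
  rewrite ?addr0 // /conn connect0.
Qed.

(** A contact is a right end and a left end at one position; both survive as endpoints there, so the
    contact persists, possibly between other cores of the larger frames. *)
Lemma refines_conn b g b' g' i j : refines b g b' g' -> conn b g i j -> conn b' g' i j.
Proof.
move=> [rb rg _ _]; apply: (@conn_ind b g (fun i j => conn b' g' i j)) => [k|{}i {}j k tij
    _ cjk]; first exact: conn_refl.
have tc p q : g p = b q -> conn b' g' p q.
  have [l cl el] := rg p; have [l' cl' el'] := rb q; rewrite el el' => e.
  by rewrite conn_sym in cl; apply: conn_trans cl (conn_trans (touch_conn e) cl').
apply: conn_trans cjk; case/orP: tij => /eqP /tc //; by rewrite conn_sym.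
Qed.

Lemma refines_trans b g b' g' b'' g'' :
  refines b g b' g' -> refines b' g' b'' g'' -> refines b g b'' g''.
Proof.
move=> r1 r2; have rc := refines_conn r2; move: r1 r2 => [b1 g1 n1 k1] [b2 g2 n2 k2].
split=> i.
- have [l cl ->] := b1 i; have [l' cl' ->] := b2 l; exists l' => //.
  by apply: conn_trans cl' _; apply: rc.
- have [l cl ->] := g1 i; have [l' cl' ->] := g2 l; exists l' => //.
  by apply: conn_trans cl' _; apply: rc.
- have [p ep] := n1 i; have [q eq] := n2 i; exists (p + q)%N.
  by rewrite eq ep natrD addrA.
- have [p ep] := k1 i; have [q eq] := k2 i; exists (q + p)%N.
  by rewrite ep eq natrD addrA.
Qed.

Section Laminar.
Variables (b g X Y : 'I_m -> R) (h : 'I_m -> nat).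
Hypothesis W : laminar b g X Y h.

Lemma inside_refl i : inside b g i i.
Proof. by rewrite /inside !lexx. Qed.

Lemma inside_trans j i k : inside b g i j -> inside b g j k -> inside b g i k.
Proof.
by move=> /andP[a1 a2] /andP[b1 b2]; rewrite /inside (le_trans b1 a1) (le_trans a2 b2).
Qed.

Lemma lam_card_gt0 i : (0 < #|[set j | inside b g j i]|)%N.
Proof. by apply/card_gt0P; exists i; rewrite inE inside_refl. Qed.

Lemma lam_len1 i : b i + 1 <= g i.
Proof. by rewrite (lam_len W) lerD2l ler1n lam_card_gt0. Qed.

Lemma lam_lt i : b i < g i.
Proof. have := lam_len1 i; lra. Qed.

(** Distinct cores never coincide, since [lam_height] would order their heights both ways. *)
Lemma inside_anti i j : inside b g i j -> inside b g j i -> i = j.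
Proof.
move=> sij sji; apply/eqP; apply/negPn/negP => nij.
have h1 := lam_height W nij sji.
have nji : j != i by rewrite eq_sym.
by have := ltn_trans h1 (lam_height W nji sij); rewrite ltnn.
Qed.

Lemma inside_ndisj i j : inside b g i j -> ~~ disj b g i j.
Proof.
move=> /andP[s1 s2]; rewrite /disj negb_or -!ltNge.
by have := lam_lt i; have := lam_lt j; lra.
Qed.

(** [lam_lo] bounds only the cores, but an interval sticking out beyond 0 would have to run
    underneath a core there. *)
Lemma lam_X0 i : 0 <= X i.
Proof.
rewrite leNgt; apply/negP => x0.
have bi := lam_lo W i; have gi := lam_right W i; have := lam_lt i => lt.
have [||| k [/andP[k1 _] _ _]] := lam_cover W (i := i) (t := X i / 2); try lra.
by have := lam_lo W k; lra.
Qed.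

Lemma lam_Ym i : Y i <= m%:R.
Proof.
rewrite leNgt; apply/negP => x0.
have bi := lam_hi W i; have gi := lam_left W i; have := lam_lt i => lt.
have [||| k [/andP[_ k1] _ _]] := lam_cover W (i := i) (t := (Y i + m%:R)/ 2); try lra.
by have := lam_hi W k; lra.
Qed.

End Laminar.

(** The reflection of [0,m]. Used with [b] and [g], and [X] and [Y], exchanged, it reduces
    statements about right ends to statements about left ends. *)
Definition mirror (f : 'I_m -> R) : 'I_m -> R := fun i => m%:R - f i.

Lemma mirrorK f : mirror (mirror f) = f.
Proof. by apply/funext => i; rewrite /mirror; lra. Qed.

Lemma inside_mirror b g i j : inside (mirror g) (mirror b) i j = inside b g i j.
Proof. by rewrite /inside /mirror !lerD2l !lerN2 andbC. Qed.

Lemma disj_mirror b g i j : disj (mirror g) (mirror b) i j = disj b g i j.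
Proof. by rewrite /disj /mirror !lerD2l !lerN2 orbC. Qed.

Lemma conn_mirror b g : conn (mirror g) (mirror b) = conn b g.
Proof.
rewrite /conn; apply/funext => i; apply/funext => j; apply: eq_connect => k l.
by rewrite /touch /mirror !(inj_eq (addrI _)) !(inj_eq oppr_inj) orbC eq_sym [g l ==
    _]eq_sym.
Qed.

Lemma laminar_mirror b g X Y h : laminar b g X Y h ->
  laminar (mirror g) (mirror b) (mirror Y) (mirror X) h.
Proof.
move=> W; split.
- move=> i; rewrite /mirror {1}(lam_len W i).
  rewrite (eq_card (B := [set j | inside b g j i])); first by lra.
  by move=> j; rewrite !inE inside_mirror.
- by move=> i j nij; rewrite disj_mirror !inside_mirror; apply: (lam_tri W).
- by move=> i; rewrite /mirror; have := lam_hi W i; lra.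
- by move=> i; rewrite /mirror; have := lam_lo W i; lra.
- by move=> i j nij; rewrite inside_mirror; apply: (lam_height W).
- by move=> i; rewrite /mirror; have := lam_right W i; lra.
- by move=> i; rewrite /mirror; have := lam_left W i; lra.
- move=> i t; rewrite /mirror => t1 t2 nt.
  have [||| k [/andP[k1 k2] dk hk]] := lam_cover W (i := i) (t := m%:R - t); try lra.
  exists k; split => //; first by apply/andP; split; lra.
  by rewrite disj_mirror.
Qed.

Lemma refines_mirror b g b' g' : refines b g b' g' ->
  refines (mirror g) (mirror b) (mirror g') (mirror b').
Proof.
move=> [rb rg nb ng]; split=> i.
- by have [l cl e] := rg i; exists l; rewrite ?conn_mirror // /mirror e.
- by have [l cl e] := rb i; exists l; rewrite ?conn_mirror // /mirror e.
- by have [n e] := ng i; exists n; rewrite /mirror e; lra.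
- by have [n e] := nb i; exists n; rewrite /mirror e; lra.
Qed.

End Flat.

(** * Cutting a core off from a larger one with the same left end *)

Section Trim.
Variables (R : realType) (m : nat).
Variables (b g X Y : 'I_m -> R) (h : 'I_m -> nat).
Hypothesis W : laminar b g X Y h.
Variables (i j : 'I_m).
Hypotheses (nij : i != j) (sji : inside b g j i) (bji : b j = b i).
Hypothesis jmax : forall k, k != i -> inside b g k i -> b k = b i -> g k <= g j.

(* A core nested at the left end of [K_i] is cut off from [K_i], which puts the
   two on the same frame; this is the contraction of an edge of the tree. *)
Definition trim k := if k == i then g j else b k.

Let lt k : b k < g k := lam_lt W k.

Let gji : g j < g i.
Proof.
have /andP[_ le] := sji; rewrite lt_neqAle le andbT; apply/negP => /eqP e.
have sij : inside b g i j by rewrite /inside bji e !lexx.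
by move: nij; rewrite (inside_anti W sij sji) eqxx.
Qed.

Local Ltac tlra := have := gji; have := bji; lra.

(** The cut at [g j] goes through no core: a core nested in [K_i] and containing [K_j] has the same
    left end, so by the choice of [j] it does not reach beyond [g j]. *)
Lemma trim_dich k : k != i -> inside b g k i -> inside b g k j || (g j <= b k).
Proof.
move=> nki ski; have [->|nkj] := eqVneq k j; first by rewrite inside_refl.
have /or3P[|->//|sjk] := lam_tri W nkj.
- case/orP; last by move=> ->; rewrite orbT.
  by move=> le; exfalso; have /andP[] := ski; have := lt k; have := bji; tlra.
- have /andP[k1 k2] := ski; have /andP[j1 j2] := sjk.
  have e : b k = b i by apply/eqP; rewrite eq_le k1 andbT -bji.
  by have gk := jmax nki ski e; rewrite /inside gk e bji lexx.
Qed.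

Lemma trim_card : g i - g j = #|[set k | inside b g k i && ~~ inside b g k j]|%:R.
Proof.
have -> : [set k | inside b g k i && ~~ inside b g k j]%SET =
   ([set k | inside b g k i] :\: [set k | inside b g k j])%SET.
  by apply/setP => k; rewrite !inE andbC.
have s : ([set k | inside b g k j] \subset [set k | inside b g k i])%SET.
  by apply/fintype.subsetP => k; rewrite !inE => /inside_trans; apply.
rewrite cardsD (finset.setIidPr s) natrB ?subset_leq_card //.
by have := lam_len W i; have := lam_len W j; have := bji; tlra.
Qed.

(** The trimmed core acquires no new cores around it. The critical case is a core [K_l] nested in
    [K_i] that fills [g j, g i] exactly: by [trim_card] the length of that segment counts [K_i]
    itself besides all cores nested in [K_l], so it exceeds the length of [K_l]. *)
Lemma trim_above l : l != i -> b l <= g j -> g i <= g l -> inside b g i l.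
Proof.
move=> nli bl gl; have nil : i != l by rewrite eq_sym.
have /or3P[dil|//|sli] := lam_tri W nil.
  by case/orP: dil => ?; have := lt l; have := lt i; tlra.
have /andP[l1 l2] := sli.
have gle : g l = g i by tlra.
have /orP[/andP[_]|bl'] := trim_dich nli sli; first tlra.
have ble : b l = g j by tlra.
have : (#|[set k | inside b g k l]|.+1 <= #|[set k | inside b g k i && ~~ inside b g k
    j]|)%N.
  have ni : (i \notin [set k | inside b g k l])%SET.
    by rewrite inE; apply/negP => s; move: nil; rewrite (inside_anti W s sli) eqxx.
  have <- : #|i |: [set k | inside b g k l]| = #|[set k | inside b g k l]|.+1.
    by rewrite cardsU1 ni.
  apply: subset_leq_card; apply/fintype.subsetP => k; rewrite !inE.
  case/orP => [/eqP ->|skl].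
    by rewrite inside_refl /=; apply/negP => /andP[_]; tlra.
  rewrite (inside_trans skl sli) /=; apply/negP => /andP[_ gk].
  by have /andP[bk _] := skl; have := lt k; tlra.
have := trim_card; rewrite -(ler_nat R) => <-; have := lam_len W l.
by rewrite -addn1 natrD; tlra.
Qed.

Lemma inside_trim k l : inside trim g k l =
  if l == i then (k == i) || inside b g k i && ~~ inside b g k j else inside b g k l.
Proof.
rewrite {1}/inside /trim; case: (eqVneq l i) => [->|nli];
    case: (eqVneq k i) => [->|nki] //=.
- by rewrite !lexx.
- apply/andP/andP => [[k1 k2]|[ski nskj]].
    split; first by rewrite /inside k2 andbT; have := lt j; tlra.
    by apply/negP => /andP[_]; have := lt k; tlra.
  by have := trim_dich nki ski; rewrite (negbTE nskj) /=; case/andP: ski.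
- apply/andP/idP => [[l1 l2]|/andP[l1 l2]]; first exact: trim_above.
  by split=> //; have := lt j; tlra.
Qed.

Lemma laminar_trim : laminar trim g X Y h.
Proof.
have tge k : b k <= trim k.
  by rewrite /trim; case: eqP => // ->; have := lt j; tlra.
have dis k l : disj b g k l -> disj trim g k l.
  rewrite /disj; case/orP => hh; apply/orP; [left|right].
    exact: le_trans hh (tge _).
  exact: le_trans hh (tge _).
split.
- move=> k; rewrite (eq_card (B := [set l | if k == i then (l == i) || inside b g l i && ~~
    inside b g l j else inside b g l k])); last first.
    by move=> l; rewrite !inE inside_trim.
  rewrite {1}/trim; case: eqP => [->|nki]; last exact: lam_len W k.
  have -> : [set l | (l == i) || inside b g l i && ~~ inside b g l j]%SET = [set k | inside
      b g k i && ~~ inside b g k j]%SET.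
    apply/setP => l; rewrite !inE; case: eqP => //= ->; rewrite inside_refl /=.
    by apply/esym/negP => /andP[_]; tlra.
  by rewrite -trim_card; tlra.
- move=> k l nkl; have nlk : l != k by rewrite eq_sym.
  rewrite !inside_trim; have := lam_tri W nkl.
  case: (eqVneq l i) => [e|nli]; case: (eqVneq k i) => [e'|nki].
  + by move: nkl; rewrite e e' eqxx.
  + subst l => /or3P[/dis->//|/[dup] ski ->|->]; last by rewrite !orbT.
    rewrite /=; have := trim_dich nki ski;
        case: (boolP (inside b g k j)) => [/andP[_ s]|] /= _.
      by rewrite /disj {1}/trim eqxx s.
    by rewrite orbT.
  + subst k => /or3P[/dis->//|->|/[dup] ski ->]; first by rewrite !orbT.
    rewrite /=; have := trim_dich nli ski;
        case: (boolP (inside b g l j)) => [/andP[_ s]|] /= _.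
      by rewrite /disj {2}/trim eqxx s orbT.
    by rewrite !orbT.
  + by case/or3P => [/dis->//|->|->]; rewrite !orbT.
- by move=> k; have := lam_lo W k; have := tge k; tlra.
- exact: lam_hi W.
- move=> k l nkl; rewrite inside_trim; case: (eqVneq k i) => [e|nki];
    last exact: (lam_height W).
  subst k; rewrite eq_sym (negbTE nkl) /= => /andP[s _]; exact: (lam_height W).
- move=> k; rewrite /trim; case: eqP => [->|_]; last exact: lam_left W k.
  by have := lam_left W i; have := lt j; tlra.
- exact: lam_right W.
- move=> k t t1 t2 nt.
  have dji l : disj b g l i -> disj b g l j.
    have /andP[s1 s2] := sji; case/orP => s; rewrite /disj; apply/orP; [left|right]; tlra.
  (* If [t] lies in the old core of [k] but not in the new one, then [k] is [i] and [t] was cut off;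
     there [K_j] covers it, and [j] is higher because it was nested. *)
  have [/andP[tk1 tk2]|nt'] := boolP (b k <= t <= g k).
    have ki : k = i.
      apply/eqP/negPn/negP => nki; move: nt; rewrite /trim (negbTE nki) tk1 tk2 //.
    subst k; exists j; split.
    + rewrite /trim eq_sym (negbTE nij); move: nt; rewrite /trim eqxx; have := bji.
      by move=> e nt; apply/andP; split; tlra.
    + by rewrite /disj {2}/trim eqxx lexx orbT.
    + exact: (lam_height W).
  have [l [/andP[l1 l2] dkl hkl]] := lam_cover W t1 t2 nt'.
  (* If the covering core is [K_i] and [t] was cut off from it, [K_j] takes over. *)
  have [lt_|ge_] := ltP t (trim l).
    have li : l = i.
      by apply/eqP/negPn/negP => nli; move: lt_; rewrite /trim (negbTE nli); tlra.
    subst l; exists j; split.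
    + rewrite {1}/trim eq_sym (negbTE nij); move: lt_; rewrite /trim eqxx; have := bji.
      by move=> e nt2; apply/andP; split; tlra.
    + exact/dis/dji.
    + exact: leq_trans hkl (ltnW (lam_height W nij sji)).
  by exists l; split; rewrite ?ge_ ?l2 //; exact: dis.
Qed.

(** The left end given up by [K_i] is still that of [K_j], which now touches [K_i]; the shift is the
    length of [K_j], an integer. *)
Lemma refines_trim : refines b g trim g.
Proof.
have cij : conn trim g j i by apply: touch_conn; rewrite /trim eqxx.
split=> k.
- have [->|nki] := eqVneq k i; first by exists j => //; rewrite /trim eq_sym (negbTE nij).
  by exists k; rewrite ?conn_refl // /trim (negbTE nki).
- by exists k; rewrite ?conn_refl.
- rewrite /trim; case: eqP => [->|]; last by exists 0%N; rewrite addr0.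
  by exists #|[set k | inside b g k j]|; rewrite (lam_len W) bji.
- by exists 0%N; rewrite addr0.
Qed.

Lemma trim_measure : (\sum_k #|[set l | inside trim g l k]| < \sum_k #|[set l | inside b g
    l k]|)%N.
Proof.
rewrite (bigD1 i) //= [X in (_ < X)%N](bigD1 i) //= -addSn.
apply: leq_add; last first.
  rewrite leq_eqVlt; apply/orP; left; apply/eqP; apply: eq_bigr => k nki.
  by apply: eq_card => l; rewrite !inE inside_trim (negbTE nki).
have jj : (j \notin [set l | inside trim g l i]%SET).
  by rewrite inE inside_trim eqxx eq_sym (negbTE nij) inside_refl andbF.
have <- : #|j |: [set l | inside trim g l i]| = #|[set l | inside trim g l i]|.+1.
  by rewrite cardsU1 jj.
apply: subset_leq_card; apply/fintype.subsetP => k.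
rewrite !inE inside_trim eqxx.
by case/orP => [/eqP ->//|/orP[/eqP ->|/andP[]//]]; rewrite inside_refl.
Qed.

End Trim.

(** * Removing all shared endpoints of nested cores *)

Section Normalize.
Variables (R : realType) (m : nat).
Implicit Types (b g X Y : 'I_m -> R) (h : 'I_m -> nat).

Lemma trim_step b g X Y h i j : laminar b g X Y h -> i != j -> inside b g j i -> b j = b i
    ->
  exists b', [/\ laminar b' g X Y h, refines b g b' g &
   (\sum_k #|[set l | inside b' g l k]| < \sum_k #|[set l | inside b g l k]|)%N].
Proof.
move=> W nij sji bji.
pose P := [pred k | [&& k != i, inside b g k i & b k == b i]].
have Pj : P j by rewrite /= eq_sym nij sji bji eqxx.
have [k /and3P[nki ski /eqP bki] kmax] := Order.TotalTheory.arg_maxP g Pj.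
rewrite eq_sym in nki.
have mx l : l != i -> inside b g l i -> b l = b i -> g l <= g k.
  by move=> l1 l2 l3; apply: kmax; rewrite /= l1 l2 l3 eqxx.
exists (trim b g i k); split.
- exact: laminar_trim.
- exact: (refines_trim W).
- exact: (trim_measure W).
Qed.

(** Induction on the number of nested pairs, which every trimming lowers; shared right ends are
    trimmed after a reflection. *)
Lemma normal_form b g X Y h : laminar b g X Y h ->
  exists b' g', [/\ laminar b' g' X Y h, strict b' g' & refines b g b' g'].
Proof.
have [n] := ubnP (\sum_k #|[set l | inside b g l k]|)%N.
elim: n b g X Y h => // n IH b g X Y h; rewrite ltnS => le W.
have [[i [j [nij sji]]]|ns] := pselect (exists i j, [/\ i != j, inside b g j i & b j = b i
    \/ g j = g i]).
  case=> e.
    have [b' [W' r lt]] := trim_step W nij sji e.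
    have [b2 [g2 [W2 s2 r2]]] := IH _ _ _ _ _ (leq_trans lt le) W'.
    by exists b2, g2; split=> //; apply: refines_trans r r2.
  have [|g' [W' r lt]] := trim_step (laminar_mirror W) nij (eq_trans (inside_mirror _ _ _
      _) sji).
    by rewrite /mirror e.
  have [||b2 [g2 [W2 s2 r2]]] := IH b (mirror g') X Y h.
  - have e1 : (\sum_k #|[set l | inside (mirror g) (mirror b) l k]| = \sum_k #|[set l |
      inside b g l k]|)%N.
      by apply: eq_bigr => k _; apply: eq_card => l; rewrite !inE inside_mirror.
    have e2 : (\sum_k #|[set l | inside b (mirror g') l k]| = \sum_k #|[set l | inside g'
        (mirror b) l k]|)%N.
      by apply: eq_bigr => k _; apply: eq_card => l;
          rewrite !inE -[b in LHS]mirrorK inside_mirror.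
    by rewrite e2; apply: leq_trans lt _; rewrite e1.
  - by have := laminar_mirror W'; rewrite !mirrorK.
  - exists b2, g2; split=> //; apply: refines_trans r2.
    by have := refines_mirror r; rewrite !mirrorK.
exists b, g; split=> //; last exact: refines_refl.
move=> i j nij /[dup] s /andP[s1 s2]; rewrite !lt_neqAle s1 s2 !andbT.
by split; apply/eqP => e; apply: ns; exists j, i; rewrite eq_sym nij; split=> //;
    [left|right].
Qed.

End Normalize.

(** * Strict families: uniqueness of cores and forced heights *)

Section Normal.
Variables (R : realType) (m : nat).
Implicit Types (b g X Y : 'I_m -> R) (h : 'I_m -> nat).

(** Supplies test points so close to [y] that none of finitely many given positions comes in
    between. *)
Lemma gap_below (I : finType) (v : I -> R) x y : x < y ->
  exists t, [/\ x < t, t < y & forall k, v k < y -> v k < t].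
Proof.
move=> xy.
suff [t [t1 t2 t3]] : exists t, [/\ x < t, t < y & forall k, k \in enum I -> v k < y -> v k
    < t].
  by exists t; split=> // k; apply: t3; rewrite mem_enum.
elim: (enum I) => [|a s [t [t1 t2 t3]]].
  by exists ((x + y) / 2); split; [lra|lra|].
have [va|va] := ltP (v a) y; last first.
  exists t; split=> // k; rewrite inE => /predU1P[->|]; last exact: t3.
  by move=> ?; lra.
exists ((Num.max t (v a) + y) / 2).
have m1 : Num.max t (v a) < y by rewrite gt_max t2.
have m2 : t <= Num.max t (v a) by rewrite le_max lexx.
have m3 : v a <= Num.max t (v a) by rewrite le_max lexx orbT.
split; [lra|lra|] => k; rewrite inE => /predU1P[->|ks vk]; first lra.
by have := t3 _ ks vk; lra.
Qed.

Lemma gap_above (I : finType) (v : I -> R) x y : x < y ->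
  exists t, [/\ x < t, t < y & forall k, x < v k -> t < v k].
Proof.
move=> xy; have yx : - y < - x by lra.
have [t [t1 t2 t3]] := gap_below (fun k => - v k) yx.
exists (- t); split; [lra|lra|] => k vk.
by have := t3 k; lra.
Qed.

Definition tight b g X Y h := laminar b g X Y h /\ strict b g.

Lemma tight_mirror b g X Y h : tight b g X Y h ->
  tight (mirror g) (mirror b) (mirror Y) (mirror X) h.
Proof.
move=> [W s]; split; first exact: laminar_mirror.
move=> i j nij; rewrite inside_mirror => /(s _ _ nij) [s1 s2].
by rewrite /mirror; split; lra.
Qed.

Section N.
Variables (b g X Y : 'I_m -> R) (h : 'I_m -> nat).
Hypothesis N : tight b g X Y h.
Let W := N.1.
Let S := N.2.
Local Notation inside := (inside b g).
Local Notation disj := (disj b g).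
Local Notation conn := (conn b g).

(** Consecutive cores on a path of contacts share an endpoint, so no gap arises. *)
Lemma chain_cover f i t : conn f i -> b f <= t -> t <= g i ->
  exists2 l, conn l i & b l <= t <= g l.
Proof.
apply: (@conn_ind _ _ b g (fun f i => b f <= t -> t <= g i ->
  exists2 l, conn l i & b l <= t <= g l)) => {f i}.
  by move=> i t1 t2; exists i; rewrite ?conn_refl ?t1.
move=> f f' i tf cf IH t1 t2.
have [t3|t3] := leP t (g f).
  by exists f; [exact: conn_trans (connect1 tf) cf | rewrite t1 t3].
have := lam_lt W f; have := lam_lt W f'.
case/orP: tf => /eqP e l1 l2; first by apply: IH => //; lra.
by apply: IH => //; lra.
Qed.

(** Strictness enters here: a core nested in [K_p] stops short of both ends of [K_p], so whatever
    touches it meets the interior of [K_p] and, by laminarity, is nested too. *)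
Lemma conn_inside i j p : conn i j -> i != p -> inside i p -> inside j p /\ j != p.
Proof.
apply: (@conn_ind _ _ b g (fun i j => i != p -> inside i p -> inside j p /\ j != p)) => {i
    j}.
  by [].
move=> i k j tik _ IH nip ip; have [b1 g1] := S nip ip.
have li := lam_lt W i; have lk := lam_lt W k.
have nkp : k != p.
  apply/eqP => e; subst k.
  by case/orP: tik => /eqP e; lra.
apply: IH => //.
have /or3P[/orP[d|d]|//|/andP[d1 d2]] := lam_tri W nkp; case/orP: tik => /eqP e; exfalso;
    lra.
Qed.

Lemma conn_disj i j : conn i j -> i != j -> disj i j.
Proof.
move=> c nij; have /or3P[//|s|s] := lam_tri W nij.
  by have [_ /eqP] := conn_inside c nij s.
rewrite eq_sym in nij; rewrite conn_sym in c.
by have [_ /eqP] := conn_inside c nij s.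
Qed.

(** The witness is the leftmost core of the frame. If some interval of the frame reached further
    left, a core disjoint from its own would cover a point just left of [b f], chosen so that this
    core extends at least to [b f]. It would then either touch [K_f], against the choice of [f], or
    contain [K_f] and hence the whole frame. *)
Lemma frame_first i : exists f, [/\ conn f i, b f <= X i & X f = b f].
Proof.
have cii : [pred f | conn f i] i by exact: conn_refl.
have [f /= cf fmin] := Order.TotalTheory.arg_minP b cii.
suff P k : conn k i -> b f <= X k.
  exists f; split=> //; first exact: P (conn_refl _ _ _).
  by apply/eqP; rewrite eq_le P // (lam_left W).
move=> ck; rewrite leNgt; apply/negP => lt.
have [t [t1 t2 t3]] := gap_below g lt.
have bk := fmin _ ck; have lk := lam_lt W k; have := lam_right W k => gY.
have [||| l [/andP[l1 l2] dkl _]] := lam_cover W (i := k) (t := t); try lra.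
have gl : b f <= g l by rewrite leNgt; apply/negP => /t3; lra.
have nlf : f != l by apply/eqP => e; subst l; lra.
have /or3P[/orP[d|d]|s|/andP[s1 s2]] := lam_tri W nlf.
- by have := lam_lt W f; lra.
- have cl : conn l i.
    by apply: conn_trans cf; apply: touch_conn; apply/eqP; rewrite eq_le d gl.
  by have := fmin _ cl; lra.
- have cfk : conn f k by apply: conn_trans cf _; rewrite conn_sym.
  have [sk _] := conn_inside cfk nlf s.
  by have := inside_ndisj W sk; rewrite dkl.
- lra.
Qed.

(** Just left of [g j] the interval [i] runs outside its core, so some higher core covers that
    point. It is not nested properly in [K_j], since such cores end earlier, nor does it contain the
    frame, since it is disjoint from [K_i]; so it is [K_j]. *)
Lemma sibling_height_left i j : conn i j -> i != j -> g j <= b i -> X i < g j -> (h i < h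
    j)%N.
Proof.
move=> c nij d lt.
have mlt : Num.max (X i) (b j) < g j by rewrite gt_max lt (lam_lt W).
have [t [t1 t2 t3]] := gap_below g mlt; move: t1; rewrite gt_max => /andP[t1 t1'].
have li := lam_lt W i; have gY := lam_right W i.
have [||| k [/andP[k1 k2] dik hk]] := lam_cover W (i := i) (t := t); try lra.
have [->//|nkj] := eqVneq j k.
have /or3P[/orP[e|e]|s|s] := lam_tri W nkj; try lra.
- have cji : conn j i by rewrite conn_sym.
  have [si _] := conn_inside cji nkj s.
  by have := inside_ndisj W si; rewrite dik.
- rewrite eq_sym in nkj; have [_ lt'] := S nkj s.
  by have := t3 _ lt'; lra.
Qed.

End N.

Lemma sibling_height b g X Y h i j : tight b g X Y h -> conn b g i j -> i != j ->
  X i < g j -> b j < Y i -> (h i < h j)%N.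
Proof.
move=> N c nij l1 l2; have /orP[d|d] := conn_disj N c nij;
    last exact: (sibling_height_left N).
apply: (sibling_height_left (tight_mirror N)) => //; first by rewrite conn_mirror.
  by rewrite /mirror; lra.
by rewrite /mirror; lra.
Qed.

Lemma frame_last b g X Y h i : tight b g X Y h ->
  exists f, [/\ conn b g f i, Y i <= g f & Y f = g f].
Proof.
move=> /tight_mirror N; have [f [c l e]] := frame_first N i.
by exists f; rewrite -conn_mirror; split=> //; move: l e; rewrite /mirror; lra.
Qed.

(* Off the endpoints, the part of the circle belonging to the lobe [i]. *)
Definition core b g i t := (b i < t < g i) /\ forall k, inside b g k i -> b k < t < g k ->
    k = i.

Definition generic b g X Y (t : R) := forall k : 'I_m, [/\ b k != t, g k != t, X k != t & Y
    k != t].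

Lemma generic_icc b g X Y t k : generic b g X Y t -> b k <= t <= g k -> b k < t < g k.
Proof. by move=> /(_ k)[n1 n2 _ _]; rewrite !lt_neqAle n1 (eq_sym t) n2. Qed.

(** Cores containing [t] form a chain along which heights increase inwards, and by [lam_cover] an
    interval whose core misses [t] is lower than one whose core contains [t]. *)
Lemma core_highest b g X Y h i t : laminar b g X Y h -> generic b g X Y t ->
  core b g i t <-> (X i < t < Y i /\ forall j, X j < t < Y j -> (h j <= h i)%N).
Proof.
move=> W gt; split=> [[/andP[t1 t2] small]|[/andP[t1 t2] high]].
- split; first by have := lam_left W i; have := lam_right W i; move=> *; apply/andP; split;
    lra.
  move=> j /andP[j1 j2]; have [->//|nji] := eqVneq j i.
  have nij : i != j by rewrite eq_sym.
  have [tj|tj] := boolP (b j <= t <= g j).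
    have tj' := generic_icc gt tj.
    have /or3P[/orP[]|s|s] := lam_tri W nji; try by move/andP: tj => [? ?]; lra.
      by move: nji; rewrite (small _ s tj') eqxx.
    exact: ltnW (lam_height W nji s).
  have [k [tk djk hk]] := lam_cover W j1 j2 tj.
  have tk' := generic_icc gt tk; move/andP: (tk) => [? ?].
  have [<-|nki] := eqVneq k i; first exact: ltnW.
  have /or3P[/orP[]|s|s] := lam_tri W nki; try lra.
    by move: nki; rewrite (small _ s tk') eqxx.
  exact: ltnW (ltn_trans hk (lam_height W nki s)).
- have ti : b i <= t <= g i.
    apply/negPn/negP => ti; have [k [tk dk hk]] := lam_cover W t1 t2 ti.
    have /andP[? ?] := generic_icc gt tk.
    have := high k; rewrite leqNgt hk; have := lam_left W k; have := lam_right W k.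
    by move=> ? ? /(_ _)/negP; apply=> //; apply/andP; split; lra.
  split; first exact: generic_icc gt ti.
  move=> k ski /andP[k1 k2]; apply/eqP/negPn/negP => nki.
  have nik : i != k by rewrite eq_sym.
  have := high k; rewrite leqNgt (lam_height W nik ski).
  have := lam_left W k; have := lam_right W k.
  by move=> ? ? /(_ _)/negP; apply=> //; apply/andP; split; lra.
Qed.

(** Just right of [b i] no smaller core is present, by strictness, so [i] is the highest interval
    there. By [core_highest] this depends only on the intervals and their order on overlaps, so the
    core of [i] in the other family contains such points as well. *)
Lemma tight_le b g b' g' X Y h h' :
  tight b g X Y h -> tight b' g' X Y h' ->
  (forall i j, X i < Y j -> X j < Y i -> (h i < h j)%N = (h' i < h' j)%N) ->
  forall i, b' i <= b i.
Proof.
move=> [W s] [W' s'] hh i; rewrite leNgt; apply/negP => lt.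
(* All endpoints of both families, so that a single [t] is generic for both. *)
pose v (p : 'I_m * 'I_6) := nth 0 [:: b p.1; g p.1; b' p.1; g' p.1; X p.1; Y p.1] p.2.
have [t [t1 t2 t3]] := gap_above v (lam_lt W i).
have V k (n : 'I_6) : let x := v (k, n) in (x != t) /\ (x < t -> x <= b i).
  have := t3 (k, n); split; last by move=> ?; rewrite leNgt; apply/negP => ?; lra.
  by apply/eqP => e; move: (t3 (k, n)); rewrite e => ?; lra.
have g1 : generic b g X Y t.
  move=> k; have := V k (inord 0); have := V k (inord 1); have := V k (inord 4);
      have := V k (inord 5).
  by rewrite /v !inordK //= => -[? _] [? _] [? _] [? _].
have g2 : generic b' g' X Y t.
  move=> k; have := V k (inord 2); have := V k (inord 3); have := V k (inord 4);
      have := V k (inord 5).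
  by rewrite /v !inordK //= => -[? _] [? _] [? _] [? _].
have ci : core b g i t.
  split; first by rewrite t1 t2.
  move=> k ski /andP[k1 _]; apply/eqP/negPn/negP => nki.
  have [lb _] := s _ _ nki ski.
  by have [_] := V k (inord 0); rewrite /v inordK //= => /(_ k1); lra.
have /(core_highest i W g1)[/andP[x1 x2] high] := ci.
have [/andP[c1 _] _] : core b' g' i t.
  apply/(core_highest i W' g2); split; first by rewrite x1 x2.
  move=> j /[dup] tj /andP[j1 j2]; rewrite leqNgt -hh; [|lra|lra].
  by rewrite -leqNgt high.
by have [_] := V i (inord 2); rewrite /v inordK //= => /(_ c1); lra.
Qed.

Lemma tight_unique b g b' g' X Y h h' :
  tight b g X Y h -> tight b' g' X Y h' ->
  (forall i j, X i < Y j -> X j < Y i -> (h i < h j)%N = (h' i < h' j)%N) ->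
  b = b' /\ g = g'.
Proof.
move=> N N' hh; have hh' i j : X i < Y j -> X j < Y i -> (h' i < h' j)%N = (h i < h j)%N.
  by move=> l1 l2; rewrite hh.
split; apply/funext => i; apply/eqP; rewrite eq_le.
  by rewrite (tight_le N N' hh) (tight_le N' N hh').
have := tight_le (tight_mirror N) (tight_mirror N') _ i.
have := tight_le (tight_mirror N') (tight_mirror N) _ i.
rewrite /mirror => P1 P2; apply/andP; split.
  by have : m%:R - g' i <= m%:R - g i; [apply: P2 => p q ? ?; apply: hh; lra|lra].
by have : m%:R - g i <= m%:R - g' i; [apply: P1 => p q ? ?; apply: hh'; lra|lra].
Qed.

Lemma frame_cover b g X Y h i t : tight b g X Y h -> X i <= t <= Y i ->
  exists2 l, conn b g l i & b l <= t <= g l.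
Proof.
move=> N /andP[t1 t2].
have [f [cf lf _]] := frame_first N i; have [l [cl ll _]] := frame_last i N.
have cfl : conn b g f l by apply: conn_trans cf _; rewrite conn_sym.
have [||k ck tk] := chain_cover N cfl (t := t); try lra.
by exists k => //; apply: conn_trans ck cl.
Qed.

(** This is why height orders need recording only within frames. If intervals of different frames
    overlap, cores of the two frames meet, so one frame is nested in a core of the other, and
    nesting fixes the order. *)
Lemma tight_order_forced b g X Y i j : ~~ conn b g i j -> X i < Y j -> X j < Y i ->
  (forall h, tight b g X Y h -> (h i < h j)%N) \/
  (forall h, tight b g X Y h -> (h j < h i)%N) \/ (forall h, ~ tight b g X Y h).
Proof.
move=> nc l1 l2; have [[h0 N]|noN] := pselect (exists h, tight b g X Y h); last first.
  by right; right=> h Nh; apply: noN; exists h.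
have xi : X i < Y i by have := lam_left N.1 i; have := lam_right N.1 i;
    have := lam_lt N.1 i; lra.
have xj : X j < Y j by have := lam_left N.1 j; have := lam_right N.1 j;
    have := lam_lt N.1 j; lra.
have mx : Num.max (X i) (X j) < Num.min (Y i) (Y j).
  by rewrite gt_max !lt_min; apply/andP; split; apply/andP; split; lra.
pose v (p : 'I_m * 'I_2) := nth 0 [:: b p.1; g p.1] p.2.
have [t [t1 t2 t3]] := gap_above v mx.
move: t1 t2; rewrite gt_max lt_min => /andP[ti1 tj1] /andP[ti2 tj2].
have S l : b l <= t <= g l -> b l < t < g l.
  move=> /andP[k1 k2]; rewrite !lt_neqAle k1 k2 !andbT; apply/andP; split; apply/eqP => e.
    have := t3 (l, inord 0); rewrite /v /= inordK //= e.
    by rewrite gt_max ti1 tj1 ltxx => /(_ isT).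
  have := t3 (l, inord 1); rewrite /v /= inordK //= -e.
  by rewrite gt_max ti1 tj1 ltxx => /(_ isT).
have [|i' ci' /S /andP[ti1' ti2']] := frame_cover (i := i) (t := t) N; first by apply/andP;
    split; lra.
have [|j' cj' /S /andP[tj1' tj2']] := frame_cover (i := j) (t := t) N; first by apply/andP;
    split; lra.
have nij' : i' != j'.
  apply: contra nc => /eqP e; apply: conn_trans (cj'); rewrite conn_sym -e //.
(* The interval [p] runs over the core of [p'] in its own frame, so it is at most as high as [p'],
   which is lower than everything nested in that core. *)
have key p q p' q' : conn b g p' p -> conn b g q' q -> p' != q' -> inside b g q' p' ->
    b p' < t < g p' -> X p < t < Y p -> forall h, tight b g X Y h -> (h p < h q)%N.
  move=> cp cq npq s /andP[? ?] /andP[? ?] h Nh; rewrite eq_sym in npq.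
  have [sq nq] := conn_inside Nh cq npq s; rewrite eq_sym in nq.
  have lpq := lam_height Nh.1 nq sq.
  have [->//|npp] := eqVneq p p'; apply: ltn_trans lpq.
  by apply: (sibling_height Nh) => //; [rewrite conn_sym|lra|lra].
have /or3P[/orP[]|s|s] := lam_tri N.1 nij'; try lra.
- right; left; apply: (key _ _ _ _ cj' ci' _ s); rewrite 1?eq_sym //; apply/andP; split;
    lra.
- left; apply: (key _ _ _ _ ci' cj' _ s) => //; apply/andP; split; lra.
Qed.

Lemma tight_order b g X Y h h' : tight b g X Y h -> tight b g X Y h' ->
  (forall i j, conn b g i j -> X i < Y j -> X j < Y i -> (h i < h j)%N = (h' i < h' j)%N) ->
  forall i j, X i < Y j -> X j < Y i -> (h i < h j)%N = (h' i < h' j)%N.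
Proof.
move=> N N' hh i j l1 l2; have [c|c] := boolP (conn b g i j); first exact: hh.
have [F|[F|F]] := tight_order_forced c l1 l2.
- by rewrite !F.
- have l := ltnW (F _ N); have l' := ltnW (F _ N').
  by rewrite (ltnNge (h i)) (ltnNge (h' i)) l l'.
- by case: (F _ N).
Qed.

End Normal.

(** * Combinatorial types and tangent directions *)

Section Types.
Variables (R : realType) (m : nat).
Implicit Types (b g X Y : 'I_m -> R) (h : 'I_m -> nat).

(* First boolean: endpoint of the core (true) or of the interval itself (false);
   second boolean: right (true) or left (false) endpoint. *)
Definition slot := ((bool * bool) * 'I_m)%type.
Definition config := slot -> R.
Implicit Types z w : config.

Definition cX z (i : 'I_m) := z ((false, false), i).
Definition cY z (i : 'I_m) := z ((false, true), i).
Definition cb z (i : 'I_m) := z ((true, false), i).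
Definition cg z (i : 'I_m) := z ((true, true), i).

(* [None] stands for the left end 0 of the scaled interval [0,m]. *)
Definition val0 z (a : option slot) : R := oapp z 0 a.
Definition delta z (a c : option slot) : R := val0 z a - val0 z c.

Definition cconn z := conn (cb z) (cg z).

(* The tests [z_a - z_c] versus [k] defining the cells. Distances between
   different frames are only compared with 0, and only for core endpoints:
   cutting at other integers would subdivide the products of simplices of
   Kaufmann's structure and destroy cellularity. *)
Definition relevant z (a c : option slot) (k : nat) : bool :=
  match a, c with
  | Some a, Some c => cconn z a.2 c.2 || [&& a.1.1, c.1.1 & k == 0%N]
  | Some a, None => a.1.1 && ((k == 0%N) || (k == m))
  | None, _ => false
  end.

(** Describes the closure of the cell of [z]: weak inequalities persist, and new equalities may
    appear. Relevance is judged at [z]. *)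
Definition closed_type z z' := forall a c k, (k <= m)%N -> relevant z a c k ->
  (k%:R <= delta z a c -> k%:R <= delta z' a c) /\
  (delta z a c <= k%:R -> delta z' a c <= k%:R).

Definition open_type z z' := forall a c k, (k <= m)%N -> relevant z a c k ->
  (k%:R <= delta z a c) = (k%:R <= delta z' a c) /\
  (delta z a c <= k%:R) = (delta z' a c <= k%:R).

(** The directions of the affine hull of the cell of [z]: all equalities among the tests are
    preserved. *)
Definition tangent z w := forall a c k, (k <= m)%N -> relevant z a c k ->
  delta z a c = k%:R -> val0 w a = val0 w c.

Definition ctight z h := tight (cb z) (cg z) (cX z) (cY z) h.
Definition claminar z h := laminar (cb z) (cg z) (cX z) (cY z) h.

Lemma open_closed z z' : open_type z z' -> closed_type z z'.
Proof. by move=> o a c k km r; have [-> ->] := o a c k km r. Qed.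

Lemma closed_refl z : closed_type z z.
Proof. by []. Qed.

Lemma closed_conn_le z z' (p q : slot) : closed_type z z' -> cconn z p.2 q.2 ->
  z p <= z q -> z' p <= z' q.
Proof.
move=> cl c le; have r : relevant z (Some p) (Some q) 0 by rewrite /= c.
by have [_] := cl _ _ _ (leq0n m) r; rewrite /delta /= !subr_le0; apply.
Qed.

Lemma closed_end_le z z' (p q : slot) : closed_type z z' -> p.1.1 -> q.1.1 ->
  z p <= z q -> z' p <= z' q.
Proof.
move=> cl p1 q1 le; have r : relevant z (Some p) (Some q) 0 by rewrite /= p1 q1 orbT.
by have [_] := cl _ _ _ (leq0n m) r; rewrite /delta /= !subr_le0; apply.
Qed.

Lemma closed_conn_eq z z' (p q : slot) (k : nat) : closed_type z z' -> (k <= m)%N ->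
  cconn z p.2 q.2 -> z p = z q + k%:R -> z' p = z' q + k%:R.
Proof.
move=> cl km c e; have r : relevant z (Some p) (Some q) k by rewrite /= c.
have [] := cl _ _ _ km r;
    rewrite /delta /= e addrAC subrr add0r lexx => /(_ isT) l1 /(_ isT).
lra.
Qed.

Lemma closed_touch z z' i j : closed_type z z' -> cg z i = cb z j -> cg z' i = cb z' j.
Proof.
move=> cl e; apply/eqP; rewrite eq_le.
by apply/andP; split; apply: (closed_end_le cl) => //; move: e; rewrite /cg /cb => ->.
Qed.

Lemma closed_conn z z' i j : closed_type z z' -> cconn z i j -> cconn z' i j.
Proof.
move=> cl; apply: (@conn_ind _ _ _ _ (fun i j => cconn z' i j)) => {i j}.
  by move=> i; apply: conn_refl.
move=> i j k t _; apply: conn_trans; case/orP: t => /eqP /(closed_touch cl) e.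
  exact: touch_conn.
by rewrite conn_sym; apply: touch_conn.
Qed.

(** Contacts of [z] persist at [z'], so a frame of [z] has no gaps there either, although the frames
    of [z'] may be larger. *)
Lemma chain_cover_closed z z' f i t : closed_type z z' -> (forall k, cb z' k < cg z' k) ->
  cconn z f i -> cb z' f <= t -> t <= cg z' i ->
  exists2 l, cconn z l i & cb z' l <= t <= cg z' l.
Proof.
move=> cl lt; apply: (@conn_ind _ _ _ _ (fun f i => cb z' f <= t -> t <= cg z' i ->
  exists2 l, cconn z l i & cb z' l <= t <= cg z' l)) => {f i}.
  by move=> i t1 t2; exists i; rewrite ?t1 //; apply: conn_refl.
move=> f f' i tf cf IH t1 t2.
have [t3|t3] := leP t (cg z' f).
  by exists f; [exact: conn_trans (connect1 tf) cf | rewrite t1 t3].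
have := lt f; have := lt f'.
by case/orP: tf => /eqP/(closed_touch cl) e l1 l2; apply: IH => //; lra.
Qed.

Section Closed.
Variables (z z' : config) (h : 'I_m -> nat).
Hypothesis N : ctight z h.
Hypothesis cl : closed_type z z'.

Definition csize (i : 'I_m) := #|[set j | inside (cb z) (cg z) j i]|.

Lemma csize_le i : (csize i <= m)%N.
Proof. by rewrite -[X in (_ <= X)%N](card_ord m); apply: max_card. Qed.

Lemma closed_len i : cg z' i = cb z' i + (csize i)%:R.
Proof.
apply: (@closed_conn_eq z z' (_, i) (_, i)) => //; first exact: csize_le.
  exact: conn_refl.
exact: (lam_len N.1).
Qed.

Lemma closed_lt i : cb z' i < cg z' i.
Proof. by rewrite closed_len ltrDl ltr0n lam_card_gt0. Qed.

Lemma closed_inside i j : inside (cb z) (cg z) i j -> inside (cb z') (cg z') i j.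
Proof. by move=> /andP[? ?]; apply/andP; split; apply: (closed_end_le cl). Qed.

Lemma closed_disj i j : disj (cb z) (cg z) i j -> disj (cb z') (cg z') i j.
Proof.
by move=> /orP[?|?]; apply/orP; [left|right]; apply: (closed_end_le cl).
Qed.

(** No nesting arises on the boundary. Disjointness persists and lengths stay positive; a reversed
    nesting would make the two lengths equal, but lengths are constant on the closed cell and
    different at [z] by strictness. *)
Lemma closed_insideE i j : inside (cb z') (cg z') i j = inside (cb z) (cg z) i j.
Proof.
apply/idP/idP; last exact: closed_inside.
have [<-|nij] := eqVneq i j; first by rewrite !inside_refl.
move=> s'; have := closed_lt i; have := closed_lt j.
have /or3P[d|//|s] := lam_tri N.1 nij.
  have := closed_disj d; move: s' => /andP[? ?] /orP[]; lra.
have /andP[? ?] := closed_inside s; move: s' => /andP[? ?] _ _; exfalso.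
rewrite eq_sym in nij; have [? ?] := N.2 _ _ nij s.
have := closed_len i; have := closed_len j; have := lam_len N.1 i; have := lam_len N.1 j.
rewrite -/(csize i) -/(csize j); lra.
Qed.

(** For [lam_cover]: the frame of [i] at [z] still spans the interval of [i] at [z'], so one of its
    cores covers [t]. The overlap that makes this core higher was already there at [z], since
    non-overlap within a frame is a weak inequality and would persist. *)
Lemma closed_laminar : claminar z' h.
Proof.
split.
- move=> i; rewrite closed_len; congr (_ + _%:R); apply: eq_card => j.
  by rewrite !inE closed_insideE.
- move=> i j nij; rewrite !closed_insideE;
    have /or3P[/closed_disj->//|->|->] := lam_tri N.1 nij.
    by rewrite !orbT.
  by rewrite !orbT.
- move=> i; have r : relevant z (Some (true, false, i)) None 0 by [].
  have [+ _] := @cl _ _ _ (leq0n m) r.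
  by rewrite /delta /= !subr0 => /(_ (lam_lo N.1 i)).
- move=> i; have r : relevant z (Some (true, true, i)) None m by rewrite /= eqxx orbT.
  have [_] := @cl _ _ _ (leqnn m) r.
  by rewrite /delta /= !subr0 => /(_ (lam_hi N.1 i)).
- by move=> i j nij; rewrite closed_insideE; apply: (lam_height N.1).
- by move=> i; apply: (closed_conn_le cl); [apply: conn_refl|exact: (lam_left N.1)].
- by move=> i; apply: (closed_conn_le cl); [apply: conn_refl|exact: (lam_right N.1)].
- move=> i t t1 t2 nt.
  have [f [cf lf _]] := frame_first N i; have [l [c_l ll _]] := frame_last i N.
  have cfl : cconn z f l by apply: conn_trans cf _; rewrite conn_sym.
  have f1 : cb z' f <= cX z' i by apply: (closed_conn_le cl).
  have l1 : cY z' i <= cg z' l by apply: (closed_conn_le cl) ll; rewrite /= /cconn conn_sym.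
  have [||k ck tk] := chain_cover_closed cl closed_lt cfl (t := t); try lra.
  have cki : cconn z k i by apply: conn_trans ck c_l.
  have cik : cconn z i k by rewrite /cconn conn_sym.
  have nik : i != k by apply: contra nt => /eqP ->.
  exists k; split=> //; first exact/closed_disj/(conn_disj N).
  apply: (sibling_height N) => //; rewrite ltNge; apply/negP => le.
    have : cg z' k <= cX z' i by apply: (closed_conn_le cl) le.
    by move/andP: tk; lra.
  have : cY z' i <= cb z' k by apply: (closed_conn_le cl) le.
  by move/andP: tk; lra.
Qed.

Lemma closed_bounds p : 0 <= z' p <= m%:R.
Proof.
have W := closed_laminar; case: p => [[[] []] i]; apply/andP; split;
  have := lam_lo W i; have := lam_hi W i; have := lam_lt W i; have := lam_left W i;
  have := lam_right W i; have := lam_X0 W i; have := lam_Ym W i; rewrite /cX /cY /cb /cg;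
      lra.
Qed.

End Closed.

Lemma open_tight z z' h : ctight z h -> open_type z z' -> ctight z' h.
Proof.
move=> N o; have cl := open_closed o; split; first exact: closed_laminar N cl.
move=> i j nij; rewrite (closed_insideE N cl) => s; have [s1 s2] := N.2 _ _ nij s.
have lt (p q : slot) : p.1.1 -> q.1.1 -> z p < z q -> z' p < z' q.
  move=> p1 q1; have r : relevant z (Some q) (Some p) 0 by rewrite /= p1 q1 orbT.
  have [_] := o _ _ _ (leq0n m) r.
  by rewrite /delta /= !subr_le0 !ltNge => ->.
by split; apply: lt.
Qed.

(** Contacts are themselves tests, of core endpoints against 0. Hence relevance agrees on a cell and
    [open_type] is symmetric. *)
Lemma open_conn z z' : open_type z z' -> cconn z = cconn z'.
Proof.
move=> o; rewrite /cconn /conn; apply/funext => i; apply/funext => j;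
    apply: eq_connect => {}i {}j.
have eqE k l : (cg z k == cb z l) = (cg z' k == cb z' l).
  have r : relevant z (Some (true, true, k)) (Some (true, false, l)) 0 by rewrite /= orbT.
  have [e1 e2] := o _ _ _ (leq0n m) r.
  rewrite /delta /= !subr_ge0 !subr_le0 in e1 e2.
  by rewrite !eq_le /cg /cb e1 e2.
by rewrite /touch !eqE.
Qed.

Lemma open_relevant z z' : open_type z z' -> relevant z = relevant z'.
Proof. by move=> o; rewrite /relevant (open_conn o). Qed.

Lemma tangent_open z z' w : open_type z z' -> tangent z w -> tangent z' w.
Proof.
move=> o t a c k km; rewrite -(open_relevant o) => r e; apply: (t _ _ _ km r).
have [] := o a c k km r; rewrite e lexx => l1 l2.
by apply/eqP; rewrite eq_le l1 l2.
Qed.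

Lemma open_sym z z' : open_type z z' -> open_type z' z.
Proof.
by move=> o a c k km; rewrite -(open_relevant o) => r; have [-> ->] := o a c k km r.
Qed.

Definition test := (option slot * option slot * 'I_m.+1)%type.

(** The outcome of all tests as an element of a finite type, which makes the set of cells finite. *)
Definition ckey z : {set test} * {set test} :=
  ([set s : test | relevant z s.1.1 s.1.2 s.2 && (s.2%:R <= delta z s.1.1 s.1.2)],
   [set s : test | relevant z s.1.1 s.1.2 s.2 && (delta z s.1.1 s.1.2 <= s.2%:R)]).

Lemma open_ckey z z' : open_type z z' -> ckey z = ckey z'.
Proof.
move=> o; rewrite /ckey -(open_relevant o); congr (_, _); apply/setP => s; rewrite !inE;
  case: (boolP (relevant _ _ _ _)) => //= r;
  by have [e1 e2] := o _ _ _ (leq_ord s.2) r; rewrite ?e1 ?e2.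
Qed.

Lemma ckey_open z z' : ckey z = ckey z' -> open_type z z'.
Proof.
move=> [] /setP A /setP B a c k km r.
have := A (a, c, Ordinal (n := m.+1) km); have := B (a, c, Ordinal (n := m.+1) km).
rewrite !inE /= r /=.
case: (boolP (relevant z' a c k)) => //= _.
by case: (lerP k%:R (delta z a c)) => //= lt; rewrite (ltW lt).
Qed.

End Types.

(** * Tangent directions at the boundary of a cell *)

Section Tangent.
Variables (R : realType) (m : nat).
Implicit Types (b g X Y : 'I_m -> R) (h : 'I_m -> nat).
Implicit Types z w : config R m.

Lemma tight_bounds z h p : ctight z h -> 0 <= z p <= m%:R.
Proof. by move=> N; apply: closed_bounds N (@closed_refl _ _ z) p. Qed.

(** By strictness two coinciding left ends, or right ends, belong to the same core, and a right end
    at a left end is a contact. So equalities between core endpoints never link different frames. *)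
Lemma tight_end_conn z h (p q : slot m) : ctight z h -> p.1.1 -> q.1.1 -> z p = z q ->
  cconn z p.2 q.2.
Proof.
move=> N; case: p q => [[[] e] i] [[[] e'] j] //= _ _.
have li := lam_lt N.1 i; have lj := lam_lt N.1 j.
have P : cb z i = cb z j \/ cg z i = cg z j -> i = j.
  move=> E; apply/eqP/negPn/negP => nij; have nji : j != i by rewrite eq_sym.
  have /or3P[/orP[]|/(N.2 _ _ nij)[]|/(N.2 _ _ nji)[]] := lam_tri N.1 nij; case: E => E;
      lra.
case: e e' => [] [] e.
- by rewrite (P (or_intror e)); apply: conn_refl.
- exact: touch_conn.
- by rewrite /cconn conn_sym; apply: touch_conn.
- by rewrite (P (or_introl e)); apply: conn_refl.
Qed.

(** All coordinates lie in [0,m], so an integer difference within a frame is at most [m] and occurs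
    among the tests. *)
Lemma tangent_int z h w (p q : slot m) : ctight z h -> tangent z w -> cconn z p.2 q.2 ->
  z p - z q \is a Num.int -> w p = w q.
Proof.
move=> N T; wlog le : p q / z q <= z p.
  move=> H c zi; have [|/ltW] := leP (z q) (z p); first by move=> le; apply: H.
  move=> le; apply/esym/H => //; first by rewrite /cconn conn_sym.
  by rewrite -opprB rpredN.
move=> c; rewrite intrEge0 ?subr_ge0 // => /natrP[n e].
have nm : (n <= m)%N.
  have /andP[_ ?] := tight_bounds p N; have /andP[? _] := tight_bounds q N.
  by rewrite -(ler_nat R) -e; lra.
by apply: (T (Some p) (Some q) n nm) => //; rewrite /= c.
Qed.

Definition renorm z b g : config R m := fun p =>
  match p.1 with (false, _) => z p | (true, false) => b p.2 | (true, true) => g p.2 end.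

Section Boundary.
Variables (z z' : config R m) (h : 'I_m -> nat) (b g : 'I_m -> R).
Hypotheses (N : ctight z h) (cl : closed_type z z').
Let z2 := renorm z' b g.
Hypotheses (N2 : ctight z2 h) (rf : refines (cb z') (cg z') b g).

Let c2 i j : cconn z i j -> cconn z2 i j.
Proof. by move=> /(closed_conn cl); apply: (refines_conn rf). Qed.

Let shift (p : slot m) : z2 p - z' p \is a Num.int.
Proof.
case: rf => _ _ nb ng; case: p => [[[] []] i]; rewrite /z2 /renorm /=; last 2 first.
- by rewrite subrr rpred0.
- by rewrite subrr rpred0.
- by have [n] := ng i; rewrite /cg => ->; rewrite opprD addrA subrr sub0r rpredN natr_int.
- by have [n ->] := nb i; rewrite /cb addrAC subrr add0r natr_int.
Qed.

Let ends_at (p : slot m) : p.1.1 -> exists q : slot m, [/\ q.1.1, q.1.2 = p.1.2, cconn z2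
    q.2 p.2 & z' p = z2 q].
Proof.
case: rf => rb rg _ _; case: p => [[[] []] i] // _.
  by have [l cl' e] := rg i; exists (true, true, l).
by have [l cl' e] := rb i; exists (true, false, l).
Qed.

(* Passing to the boundary of a cell can only enlarge frames and shift core
   endpoints by integers, so no linear equation is lost. *)
Lemma boundary_tangent w a c k : tangent z2 w -> (k <= m)%N -> relevant z a c k ->
  delta z' a c = k%:R -> val0 w a = val0 w c.
Proof.
move=> T km.
have I p q : cconn z2 p.2 q.2 -> z' p - z' q \is a Num.int -> w p = w q.
  move=> cpq zi; apply: (tangent_int N2 T cpq).
  have -> : z2 p - z2 q = (z2 p - z' p) - (z2 q - z' q) + (z' p - z' q) by lra.
  by apply: rpredD => //; apply: rpredB.
case: a c => [p|//] [q|] /=; rewrite /delta /=.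
  case/orP => [/c2 cpq e|/and3P[p1 q1 /eqP k0]]; first by apply: I => //;
      rewrite e natr_int.
  rewrite k0 => /eqP; rewrite subr_eq0 => /eqP e; apply: I; last by rewrite e subrr rpred0.
  have [p' [p1' _ cp ep]] := ends_at p1; have [q' [q1' _ cq eq]] := ends_at q1.
  have := tight_end_conn N2 p1' q1'; rewrite -ep -eq => /(_ e) cpq.
  apply: conn_trans cq; apply: conn_trans cpq; by rewrite conn_sym.
case/andP => p1 k0m; rewrite subr0 => e.
have [p' [p1' _ cp ep]] := ends_at p1.
have -> : w p = w p'.
  apply: I; first by rewrite /cconn conn_sym.
  have -> : z' p - z' p' = z2 p' - z' p' by rewrite ep.
  exact: shift.
apply: (T (Some p') None k km); first by rewrite /= p1'.
by rewrite /delta /= subr0 -ep.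
Qed.

Lemma tangent_boundary w : tangent z2 w -> tangent z w.
Proof.
move=> T a c k km r e; apply: (boundary_tangent T km r).
have [] := @cl a c k km r; rewrite e lexx => /(_ isT) l1 /(_ isT) l2.
by apply/eqP; rewrite eq_le l1 l2.
Qed.

Lemma tangent_closed_sub : tangent z (fun p => z' p - z p).
Proof.
move=> a c k km r e; have [] := @cl a c k km r; rewrite e lexx => /(_ isT) + /(_ isT).
by move: e; rewrite /delta; case: a c {r} => [p|] [q|] //=; lra.
Qed.

(** The direction from [z] to [z'] is lost: were it tangent at [z2], every equality valid at [z']
    would already hold at [z], and [z'] would be in the open cell. *)
Lemma tangent_boundary_lt : ~ open_type z z' ->
  exists2 w, tangent z w & ~ tangent z2 w.
Proof.
move=> no; exists (fun p => z' p - z p); first exact: tangent_closed_sub.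
move=> T; apply: no => a c k km r.
have B := boundary_tangent T km r; have [d1 d2] := @cl a c k km r.
have E : delta z' a c = k%:R -> delta z a c = k%:R.
  by move=> e; have := B e; move: e; rewrite /delta;
      case: a c {r B d1 d2} => [p|] [q|] //=; lra.
split; apply/idP/idP => //.
  move=> le; rewrite leNgt; apply/negP => lt.
  by have := E; have := d2 (ltW lt) => l1 /(_ _) l2; have := l2 _; lra.
move=> le; rewrite leNgt; apply/negP => lt.
by have := E; have := d1 (ltW lt) => l1 /(_ _) l2; have := l2 _; lra.
Qed.

End Boundary.

Lemma tight_conn_int z h i j : ctight z h -> cconn z i j -> cb z i - cb z j \is a Num.int.
Proof.
move=> N; apply: (@conn_ind _ _ _ _ (fun i j => cb z i - cb z j \is a Num.int)) => {i j}.
  by move=> i; rewrite subrr rpred0.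
move=> i j k t _ zi.
have -> : cb z i - cb z k = (cb z i - cb z j) + (cb z j - cb z k) by lra.
apply: rpredD => //; case/orP: t => /eqP; rewrite (lam_len N.1) => e.
  by rewrite -e opprD addrA subrr sub0r rpredN natr_int.
by rewrite -e addrAC subrr add0r natr_int.
Qed.

(** This gives injectivity on the closed ball. By [frame_first] the frame of [i] has an interval [f]
    that begins with its core; the distance from there to [cb z i] is an integer, hence constant on
    the closed cell. *)
Lemma closed_inj z h z1 z2 : ctight z h -> closed_type z z1 -> closed_type z z2 ->
  (forall i, cX z1 i = cX z2 i) -> (forall i, cY z1 i = cY z2 i) -> z1 = z2.
Proof.
move=> N c1 c2 eX eY.
have eb i : cb z1 i = cb z2 i.
  have [f [cf lf ef]] := frame_first N i.
  have cif : cconn z i f by rewrite /cconn conn_sym.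
  have := tight_conn_int N cif; rewrite -ef intrEge0; last first.
    by rewrite ef; have := lam_left N.1 i; lra.
  move=> /natrP[n e].
  have nm : (n <= m)%N.
    have /andP[_ ?] := tight_bounds (true, false, i) N;
        have /andP[? _] := tight_bounds (false, false, f) N.
    by rewrite -(ler_nat R) -e /cb /cX; lra.
  have e' : z (true, false, i) = z (false, false, f) + n%:R by rewrite -e /cb /cX; lra.
  have E1 := closed_conn_eq c1 nm (p := (true, false, i)) (q := (false, false, f)) cif e'.
  have E2 := closed_conn_eq c2 nm (p := (true, false, i)) (q := (false, false, f)) cif e'.
  by rewrite /cb E1 E2; congr (_ + _); apply: eX.
apply/funext => [[[[] []] i]]; [|exact: eb|exact: eY|exact: eX].
by have := closed_len N c1 i; have := closed_len N c2 i; have := eb i;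
    rewrite /cg /cb => -> -> ->.
Qed.

Definition frame_ind z (r : 'I_m) : config R m := fun p => (cconn z r p.2)%:R.

(** Equalities link a frame only with itself or with the ends 0 and [m], and a frame nested in [K_p]
    stays away from both ends. *)
Lemma tangent_frame z h r p : ctight z h -> r != p -> inside (cb z) (cg z) r p ->
  tangent z (frame_ind z r).
Proof.
move=> N nrp s a c k km; case: a c => [a|//] [c|] /=; rewrite /frame_ind /delta /= => rel e.
  suff cac : cconn z a.2 c.2.
    congr (nat_of_bool _)%:R; apply/idP/idP => cr; first exact: conn_trans cr cac.
    by apply: conn_trans cr _; rewrite conn_sym.
  case/orP: rel => // /and3P[a1 c1 /eqP k0]; apply: (tight_end_conn N) => //.
  by apply/eqP; rewrite -subr_eq0 e k0.
have [cr|//] := boolP (cconn z r a.2).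
have [sa na] := conn_inside N cr nrp s; have [s1 s2] := N.2 _ _ na sa.
have := lam_lo N.1 p; have := lam_hi N.1 p; have := lam_lt N.1 a.2.
move: rel e s1 s2; case: a {cr sa na} => [[[] []] i] //=; rewrite subr0 /cb /cg /=;
  by case/orP => /eqP -> ->; lra.
Qed.

End Tangent.

(** * Black-white trees *)

Section Siblings.
Variables (I : finType) (C : pred I) (lt : rel I) (alpha : I -> nat).
Hypothesis lt_irr : forall i, lt i i = false.
Hypothesis lt_trans : forall j i k, lt i j -> lt j k -> lt i k.
Hypothesis lt_tot : forall i j, C i -> C j -> i != j -> lt i j || lt j i.
Hypothesis alpha_gt0 : forall i, (0 < alpha i)%N.

(** With siblings of length [alpha] laid end to end in the order [lt], this is where [i] begins. It
    is used for both reading directions. *)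
Definition presum (i : I) := (\sum_(j | C j && lt j i) alpha j)%N.

Lemma presum_le i j : C i -> lt i j -> (presum i + alpha i <= presum j)%N.
Proof.
move=> Ci ij; rewrite [presum j](bigD1 i) ?Ci //= addnC leq_add2l.
rewrite /presum [leqRHS](bigID (fun k => lt k i)) /=.
apply: leq_trans (leq_addr _ _); rewrite leq_eqVlt; apply/orP; left; apply/eqP.
apply: eq_bigl => k; case: (C k) => //=; case: (boolP (lt k i)) => [ki|];
    last by rewrite andbF.
rewrite (lt_trans ki ij) andbT /=; apply/esym/eqP => e; by rewrite e lt_irr in ki.
Qed.

Lemma presum_pred i : C i -> presum i = 0%N \/
  exists p, [/\ C p, lt p i & (presum p + alpha p = presum i)%N].
Proof.
move=> Ci; have [p0 /andP[Cp0 lp0]|none] := pickP (fun p => C p && lt p i); last first.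
  by left; rewrite /presum big_pred0.
right; have P0 : [pred p | C p && lt p i] p0 by rewrite /= Cp0.
have [p /= /andP[Cp pi] pmax] := arg_maxnP presum P0.
exists p; split=> //; rewrite [presum i](bigD1 p) ?Cp //= addnC; congr (_ + _)%N.
apply: eq_bigl => q; case: (boolP (C q)) => //= Cq.
apply/idP/andP => [qp|[qi npq]].
  by split; [exact: lt_trans qp pi | apply/eqP => e; rewrite e lt_irr in qp].
case/orP: (lt_tot Cq Cp npq) => // pq.
have := pmax q; rewrite Cq qi => /(_ isT); have := presum_le Cp pq; have := alpha_gt0 p;
    lia.
Qed.

Lemma presum_total i : C i -> (presum i + alpha i + \sum_(j | C j && lt i j) alpha j =
    \sum_(j | C j) alpha j)%N.
Proof.
move=> Ci; rewrite [RHS](bigD1 i) //= [X in (_ = _ + X)%N](bigID (fun k => lt k i)) /=.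
rewrite addnA [(alpha i + _)%N]addnC; congr (_ + _ + _)%N.
  apply: eq_bigl => j; case: (C j) => //=; case: (boolP (lt j i)) => [ki|];
      last by rewrite andbF.
  by rewrite andbT; apply/esym/eqP => e; rewrite e lt_irr in ki.
apply: eq_bigl => j; case: (boolP (C j)) => //= Cj; apply/idP/andP => [ij|[nij nji]].
  split; first by apply/eqP => e; rewrite e lt_irr in ij.
  by apply/negP => ji; have := lt_trans ij ji; rewrite lt_irr.
by case/orP: (lt_tot Cj Ci nij) => // ji; rewrite ji in nji.
Qed.

(** Prepares [lam_cover], with [P] membership in [lamplus] or [rhoplus]. Among the siblings before
    [i] those failing [P] form an initial segment, so a position beyond their total length falls on
    a sibling satisfying [P]. *)
Lemma presum_cover (R : realType) (i : I) (P : pred I) (t : R) : C i ->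
  (forall w w', C w -> C w' -> lt w w' -> lt w' i -> P w -> P w') ->
  (\sum_(j | C j && (lt j i && ~~ P j)) alpha j)%:R < t -> t <= (presum i)%:R ->
  exists w, [/\ C w, lt w i, P w, (presum w)%:R <= t & t <= (presum w + alpha w)%:R].
Proof.
move=> Ci Pup lo hi; have t0 : 0 < t by apply: le_lt_trans lo.
have {hi} [w [Cw wi w1 w2]] : exists w, [/\ C w, lt w i, (presum w)%:R <= t & t <= (presum
    w + alpha w)%:R].
  (* Walk back from [i] through immediate predecessors until one begins at or before [t]. *)
  have K : forall n j, (presum j < n)%N -> C j -> lt j i || (j == i) -> t <= (presum j)%:R
      ->
      exists w, [/\ C w, lt w i, (presum w)%:R <= t & t <= (presum w + alpha w)%:R].
    elim=> // n IH j; rewrite ltnS => jn Cj ji tj.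
    have [e|[p [Cp pj e]]] := presum_pred Cj; first by move: tj; rewrite e; lra.
    have pi : lt p i by case/orP: ji => [/(lt_trans pj)//|/eqP <-].
    have [le|/ltW le] := leP (presum p)%:R t; first by exists p; split=> //; rewrite e.
    by apply: (IH p) => //; [have := alpha_gt0 p; lia|rewrite pi].
  by apply: (K _ _ (ltnSn _) Ci) => //; rewrite eqxx orbT.
exists w; split=> //; apply/negPn/negP => nP.
suff : (presum w + alpha w <= \sum_(j | C j && (lt j i && ~~ P j)) alpha j)%N.
  by rewrite -(ler_nat R); lra.
rewrite [leqRHS](bigD1 w) ?Cw ?wi //= addnC leq_add2l.
rewrite /presum [leqRHS](bigID (fun k => lt k w)) /=.
apply: leq_trans (leq_addr _ _); rewrite leq_eqVlt; apply/orP; left; apply/eqP.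
apply: eq_bigl => k; case: (boolP (C k)) => //= Ck; case: (boolP (lt k w)) => [kw|];
    last by rewrite andbF.
rewrite (lt_trans kw wi) andbT /=; apply/esym/andP; split; first by apply: contra nP;
    exact: Pup.
by apply/eqP => e; rewrite e lt_irr in kw.
Qed.

End Siblings.

(** * Ancestors and descendant counts in a tree given by its parent map *)

Section Tree.
Variables (m : nat) (T : bwtree m).
Hypothesis TT : is_bwtree T.
Local Notation V := (vtx T).
Local Notation root := (vroot T).
Local Notation par := (@par m T).
Local Notation pos := (@pos m T).

Definition anc (u v : V) := exists n, iter n par u = v.

Lemma par_root : par root = root. Proof. by case: TT. Qed.

Lemma anc_root v : anc v root. Proof. by case: TT => _ h _ _ _; apply: h. Qed.

Lemma anc_refl v : anc v v. Proof. by exists 0%N. Qed.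

Lemma anc_trans u v w : anc u v -> anc v w -> anc u w.
Proof. by move=> [n <-] [k <-]; exists (k + n)%N; rewrite iterD. Qed.

Lemma anc_par v : anc v (par v). Proof. by exists 1%N. Qed.

Lemma iter_root n : iter n par root = root.
Proof. by elim: n => //= n ->; rewrite par_root. Qed.

(** A cycle through [u] can be run often enough to pass the number of steps leading to the root, so
    [u] is the root, which is its own parent. *)
Lemma anc_anti u v : anc u v -> anc v u -> u = v.
Proof.
move=> [n <-] [k e].
have [/eqP|nz] := eqVneq (k + n)%N 0%N; first by rewrite addn_eq0 => /andP[_ /eqP ->].
have P j : iter (j * (k + n)) par u = u.
  by elim: j => // j IH; rewrite mulSn iterD IH iterD.
have [N eN] := anc_root u.
have le : (N <= N * (k + n))%N by rewrite leq_pmulr // lt0n.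
have ur : u = root.
  by rewrite -(P N) -(subnK le) iterD eN iter_root.
by rewrite ur iter_root.
Qed.

Lemma anc_total u v w : anc u v -> anc u w -> anc v w \/ anc w v.
Proof.
move=> [n <-] [k <-]; have [le|/ltnW le] := leqP n k.
  by left; exists (k - n)%N; rewrite -iterD subnK.
by right; exists (n - k)%N; rewrite -iterD subnK.
Qed.

Lemma anc_step u v : anc u v -> u = v \/ (u <> root /\ anc (par u) v).
Proof.
move=> [[|n]] e; first by left.
have [ur|ur] := pselect (u = root); last by right; split=> //; exists n; rewrite -iterSr.
by left; rewrite -e ur iter_root.
Qed.

Lemma anc_child u v : anc u v -> u <> v -> exists c, [/\ anc u c, c <> root & par c = v].
Proof.
move=> [n]; elim: n u => [|n IH] u e nuv; first by case: nuv.
have [pv|pv] := pselect (par u = v).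
  exists u; split=> //; first exact: anc_refl.
  by move=> ur; apply: nuv; rewrite -pv ur par_root.
have [|c [c1 c2 c3]] := IH (par u) _ pv; first by rewrite -iterSr.
by exists c; split=> //; apply: anc_trans c1; apply: anc_par.
Qed.

Lemma anc_meet u v : ~ anc u v -> ~ anc v u ->
  exists u' v', [/\ anc u u', anc v v', u' <> v', u' <> root & v' <> root] /\ par u' = par
      v'.
Proof.
have [n e] := anc_root u; elim: n u e => [|n IH] u e nuv nvu.
  by case: nvu; rewrite [u]e; exact: anc_root.
have ur : u <> root by move=> ur; apply: nvu; rewrite ur; exact: anc_root.
have [vp|vp] := pselect (anc v (par u)).
  have [|c [c1 c2 c3]] := anc_child vp.
    by move=> ev; apply: nuv; rewrite ev; exact: anc_par.
  exists u, c; split=> //; split=> //; first exact: anc_refl.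
  by move=> euc; apply: nvu; rewrite euc.
have [||u' [v' [[a1 a2 a3 a4 a5] a6]]] := IH (par u) _ _ vp.
- by rewrite -iterSr.
- by move=> pv; apply: nuv; apply: anc_trans pv; exact: anc_par.
- exists u', v'; split=> //; split=> //.
  by apply: anc_trans a1; exact: anc_par.
Qed.

Lemma white_par (i : 'I_m) : exists b, par (inl i) = inr b.
Proof. by case: TT => _ _ h _ _; apply: h. Qed.

Lemma black_par (b : 'I_(nb T)) : inr b <> root -> exists i, par (inr b) = inl i.
Proof. by case: TT => _ _ _ h _ br; apply: h => e; apply: br; rewrite e. Qed.

Lemma black_child (b : 'I_(nb T)) : (0 < m)%N -> exists i : 'I_m, par (inl i) = inr b.
Proof.
move=> m0; have [br|br] := pselect (b = broot T).
  have [|c [_ c2 c3]] := anc_child (anc_root (inl (Ordinal m0))); first by [].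
  case: c c2 c3 => [i|b'] c2 c3; first by exists i; rewrite br.
  by have [i e] := black_par c2; rewrite e in c3.
case: TT => _ _ _ _ [h _]; have [u [e nu]] := h _ br.
case: u e nu => [i|b'] e nu; first by exists i.
have [b'r|b'r] := pselect (inr b' = root).
  by case: nu; rewrite b'r -par_root -b'r.
by have [i e'] := black_par b'r; rewrite e' in e.
Qed.

Lemma pos_inj u v : u <> v -> u <> root -> v <> root -> par u = par v -> pos u != pos v.
Proof. by case: TT => _ _ _ _ [_ h] ? ? ? ?; apply/eqP/h. Qed.

Definition wdesc (v : V) : {set 'I_m} := [set i | `[< anc (inl i) v >]].

Lemma mem_wdesc i v : (i \in wdesc v) = `[< anc (inl i) v >].
Proof. by rewrite inE. Qed.

(** The extra 1 for white vertices counts the vertex itself, so a single formula serves both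
    colours. *)
Lemma alphaE v : Defs.alpha v = #|wdesc v|.
Proof.
have inlI : injective (inl : 'I_m -> V) by move=> x y [].
rewrite /Defs.alpha -(card_imset (wdesc v) inlI).
case: v => [i|b].
  have -> : `[< is_white (inl i : V) >] = true by apply/asboolP; exists i.
  rewrite (cardsD1 (inl i)) addnC; congr (_ + _)%N.
    by rewrite mem_imset // inE; congr (nat_of_bool _); apply/esym/asboolP; exact: anc_refl.
  apply: eq_card => u; rewrite !inE; apply/asboolP/andP.
    move=> /asboolP[[j ->] [nji an]]; split; first by apply/eqP.
    by rewrite mem_imset // inE; apply/asboolP.
  by case=> /eqP nu /imsetP[j]; rewrite inE => /asboolP an ej; apply/asboolP; split;
      [exists j|split=> //; rewrite ej].
have -> : `[< is_white (inr b : V) >] = false by apply/asboolP => -[].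
rewrite addn0; apply: eq_card => u; apply/asboolP/imsetP.
  by move=> /asboolP[[j ->] [_ an]]; exists j => //; rewrite inE; apply/asboolP.
by case=> j; rewrite inE => /asboolP an ->; apply/asboolP; split; [exists j|].
Qed.

Lemma alpha_gt0 (i : 'I_m) : (0 < Defs.alpha (inl i : V))%N.
Proof. by rewrite alphaE; apply/card_gt0P; exists i; rewrite inE;
    apply/asboolP/anc_refl. Qed.

Lemma alpha_root : @Defs.alpha m T root = m.
Proof.
rewrite alphaE -[RHS]card_ord; apply: eq_card => i; rewrite !inE.
by apply/asboolP/anc_root.
Qed.

Lemma alpha_le v : (@Defs.alpha m T v <= m)%N.
Proof. by rewrite alphaE -[X in (_ <= X)%N]card_ord; apply: max_card. Qed.

Definition white_child (b : 'I_(nb T)) (i : 'I_m) : bool := par (inl i) == inr b.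

Lemma alpha_black (b : 'I_(nb T)) :
  Defs.alpha (inr b : V) = (\sum_(i | white_child b i) Defs.alpha (inl i : V))%N.
Proof.
rewrite alphaE.
pose F i := if white_child b i then wdesc (inl i) else finset.set0.
have -> : wdesc (inr b) = (\bigcup_i F i)%SET.
  apply/setP => j; rewrite inE; apply/asboolP/bigcupP.
    move=> an; have [|c [c1 c2 c3]] := anc_child an; first by [].
    case: c c1 c2 c3 => [i|b'] c1 c2 c3; last by have [i e] := black_par c2;
        rewrite e in c3.
    by exists i => //; rewrite /F /white_child c3 eqxx inE; apply/asboolP.
  case=> i _; rewrite /F; case: ifP => [/eqP pi|_]; rewrite inE // => /asboolP an.
  by apply: anc_trans an _; rewrite -pi; exact: anc_par.
have dj i k : i != k -> [disjoint F i & F k].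
  move=> nik; rewrite -setI_eq0; apply/eqP/setP => j; rewrite !inE /F.
  case: ifP => [/eqP pi|_]; case: ifP => [/eqP pk|_]; rewrite !inE ?andbF //.
  apply/negP => /andP[/asboolP a1 /asboolP a2].
  have K (p q : 'I_m) : par (inl p) = inr b -> par (inl q) = inr b -> anc (inl p) (inl q)
      -> p = q.
    move=> ep eq /anc_step[[//]|[_]]; rewrite ep => a.
    have : anc (inl q) (inr b) by rewrite -eq; exact: anc_par.
    by move/(anc_anti a).
  have [a|a] := anc_total a1 a2; move: nik.
    by rewrite (K _ _ pi pk a) eqxx.
  by rewrite (K _ _ pk pi a) eqxx.
rewrite -sum1_card partition_disjoint_bigcup // [RHS]big_mkcond /=.
apply: eq_bigr => i _; rewrite /F; case: ifP => _; last by rewrite big_set0.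
by rewrite alphaE sum1_card.
Qed.

End Tree.

(** * Rescaling [-1,1] to [0,m] *)

Section Scale.
Variables (R : realType) (m : nat).
Definition scale (u : R) : R := (u + 1) * (m%:R / 2).
Definition unscale (u : R) : R := -1 + tm R m * u.

Lemma scaleK (m0 : (0 < m)%N) : cancel scale unscale.
Proof.
move=> u; rewrite /scale /unscale /tm; have : m%:R != 0 :> R by rewrite pnatr_eq0 -lt0n.
by move=> ?; field.
Qed.

Lemma unscaleK (m0 : (0 < m)%N) : cancel unscale scale.
Proof.
move=> u; rewrite /scale /unscale /tm; have : m%:R != 0 :> R by rewrite pnatr_eq0 -lt0n.
by move=> ?; field.
Qed.

Lemma ler_scale (m0 : (0 < m)%N) x y : (scale x <= scale y) = (x <= y).
Proof. by rewrite /scale ler_pM2r ?lerD2r // divr_gt0 ?ltr0n. Qed.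

Lemma scaleD (m0 : (0 < m)%N) x n : scale (x + tm R m * n) = scale x + n.
Proof.
rewrite /scale /tm; have : m%:R != 0 :> R by rewrite pnatr_eq0 -lt0n.
by move=> ?; field.
Qed.

Lemma scaleB (m0 : (0 < m)%N) x n : scale (x - tm R m * n) = scale x - n.
Proof. by rewrite -mulrN scaleD. Qed.

Lemma scale_lo : scale (-1) = 0. Proof. by rewrite /scale addNr mul0r. Qed.
Lemma scale_hi : scale 1 = m%:R. Proof. by rewrite /scale; field. Qed.

Lemma scale_len (m0 : (0 < m)%N) x y n : y - x = tm R m * n -> scale y - scale x = n.
Proof.
move=> e; have m1 : m%:R != 0 :> R by rewrite pnatr_eq0 -lt0n.
have -> : scale y - scale x = (y - x) * (m%:R / 2) by rewrite /scale; ring.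
by rewrite e /tm; field.
Qed.

End Scale.

(** * The conditions of Ov^1 in scaled form *)

Section Witness.
Variables (R : realType) (m : nat) (T : bwtree m).
Hypothesis m0 : (0 < m)%N.
Hypothesis TT : is_bwtree T.
Local Notation V := (vtx T).
Local Notation root := (vroot T).
Local Notation par := (@Defs.par m T).
Local Notation pos := (@Defs.pos m T).
Local Notation alpha := (@Defs.alpha m T).
Local Notation anc := (@anc m T).
Local Notation wchild := (@white_child m T).

(** The default is never taken, since parents of white vertices are black. *)
Definition wparent (i : 'I_m) : 'I_(nb T) := if par (inl i) is inr b then b else broot T.

Lemma wparentE i : par (inl i) = inr (wparent i).
Proof. by rewrite /wparent; have [b ->] := white_par TT i. Qed.

Lemma wchild_pb i : wchild (wparent i) i. Proof. by rewrite /white_child wparentE. Qed.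

Lemma wchildE v i : wchild v i = (wparent i == v).
Proof. by rewrite /white_child wparentE; apply/eqP/eqP => [[]|->]. Qed.

Definition ltL (i j : 'I_m) := (pos (inl i) < pos (inl j))%N.
Definition ltR (i j : 'I_m) := (pos (inl j) < pos (inl i))%N.

Lemma ltL_irr i : ltL i i = false. Proof. exact: ltnn. Qed.
Lemma ltR_irr i : ltR i i = false. Proof. exact: ltnn. Qed.
Lemma ltL_trans j i k : ltL i j -> ltL j k -> ltL i k. Proof. exact: ltn_trans. Qed.
Lemma ltR_trans j i k : ltR i j -> ltR j k -> ltR i k.
Proof. by move=> ij jk; apply: ltn_trans jk ij. Qed.

Lemma ltL_tot v i j : wchild v i -> wchild v j -> i != j -> ltL i j || ltL j i.
Proof.
move=> /eqP ci /eqP cj nij; rewrite /ltL -neq_ltn.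
apply: (pos_inj TT) => //; last by rewrite ci cj.
by case=> e; rewrite e eqxx in nij.
Qed.

Lemma ltR_tot v i j : wchild v i -> wchild v j -> i != j -> ltR i j || ltR j i.
Proof. by move=> ci cj nij; rewrite /ltR orbC; apply: ltL_tot ci cj nij. Qed.

Lemma asum_white (S : V -> Prop) : (forall u, S u -> is_white u) ->
  asum S = (\sum_(j : 'I_m | `[< S (inl j) >]) alpha (inl j))%N.
Proof.
move=> sw; rewrite /asum big_sumType /= [X in (_ + X)%N]big1 ?addn0 // => b /asboolP /sw
    [i].
by [].
Qed.

Definition sum_left (i : 'I_m) := presum (wchild (wparent i)) ltL (fun j => alpha (inl j))
    i.
Definition sum_right (i : 'I_m) := presum (wchild (wparent i)) ltR (fun j => alpha (inl j))
    i.

Lemma leftofE (i j : 'I_m) : leftof (inl j : V) (inl i) <-> wchild (wparent i) j && ltL j i.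
Proof.
rewrite /leftof (wparentE i); split=> [[_ [_ [/eqP e lt]]]|/andP[/eqP e lt]];
    first by apply/andP; split.
by do !split.
Qed.

Lemma leftofE' (i j : 'I_m) : leftof (inl i : V) (inl j) <-> wchild (wparent i) j && ltR j
    i.
Proof.
rewrite /leftof (wparentE i); split=> [[_ [_ [/esym/eqP e lt]]]|/andP[/eqP e lt]];
    first by apply/andP; split.
by do !split.
Qed.

Lemma asum_lam i : asum (lam (inl i : V)) = sum_left i.
Proof.
rewrite asum_white; last by move=> u [].
apply: eq_bigl => j; apply/asboolP/idP => [[_ /leftofE]|/leftofE] // l.
by split=> //; exists j.
Qed.

Lemma asum_rho i : asum (rho (inl i : V)) = sum_right i.
Proof.
rewrite asum_white; last by move=> u [].
apply: eq_bigl => j; apply/asboolP/idP => [[_ /leftofE']|/leftofE'] // l.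
by split=> //; exists j.
Qed.

Lemma asum_lamp s i : asum (fun w => lam (inl i : V) w /\ ~ lamplus s (inl i) w) =
  (\sum_(j | wchild (wparent i) j && (ltL j i && ~~ `[< lamplus s (inl i : V) (inl j) >]))
      alpha (inl j))%N.
Proof.
rewrite asum_white; last by move=> u [[]].
apply: eq_bigl => j; rewrite andbA;
    apply/asboolP/andP => [[[_ /leftofE l] n]|[/leftofE l /asboolP n]].
  by split=> //; apply/asboolP.
by split=> //; split=> //; exists j.
Qed.

Lemma asum_rhop s i : asum (fun w => rho (inl i : V) w /\ ~ rhoplus s (inl i) w) =
  (\sum_(j | wchild (wparent i) j && (ltR j i && ~~ `[< rhoplus s (inl i : V) (inl j) >]))
      alpha (inl j))%N.
Proof.
rewrite asum_white; last by move=> u [[]].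
apply: eq_bigl => j; rewrite andbA;
    apply/asboolP/andP => [[[_ /leftofE' l] n]|[/leftofE' l /asboolP n]].
  by split=> //; apply/asboolP.
by split=> //; split=> //; exists j.
Qed.

Lemma prefLR i : (sum_left i + alpha (inl i) + sum_right i = alpha (inr (wparent i)))%N.
Proof.
rewrite (alpha_black TT) /sum_right.
exact: (presum_total (fun j => alpha (inl j)) ltL_irr ltL_trans (@ltL_tot (wparent i))
    (wchild_pb i)).
Qed.

Lemma sum_le_alpha (v : 'I_(nb T)) (P : pred 'I_m) :
  (\sum_(j | wchild v j && P j) alpha (inl j) <= m)%N.
Proof.
apply: leq_trans (alpha_le (inr v)); rewrite (alpha_black TT).
by rewrite [leqRHS](bigID P) /= leq_addr.
Qed.

Variables (s : 'S_m) (L : 'I_m -> R * R) (xb yb : 'I_(nb T) -> R).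
Hypothesis CO : compatible T s.
Local Notation sc := (@scale R m).
Local Notation X := (fun i => sc (L i).1).
Local Notation Y := (fun i => sc (L i).2).
Local Notation h := (height s).

(* The numbers [b_i] and [c_i] of the definition of Ov^1, scaled. *)
Definition core_lo (i : 'I_m) : R := sc (xb (wparent i)) + (sum_left i)%:R.
Definition core_hi (i : 'I_m) : R := sc (yb (wparent i)) - (sum_right i)%:R.
Definition vtx_lo (v : V) : R := match v with inl i => core_lo i | inr b => sc (xb b) end.
Definition vtx_hi (v : V) : R := match v with inl i => core_hi i | inr b => sc (yb b) end.

(** [extL] and [extR] are the scaled offsets of [a_i] from [x_v] and of [d_i] from [y_v]. *)
Definition extL (i : 'I_m) := (\sum_(j | wchild (wparent i) j && (ltL j i && ~~ `[< lamplus
    s (inl i : V) (inl j) >])) alpha (inl j))%N.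
Definition extR (i : 'I_m) := (\sum_(j | wchild (wparent i) j && (ltR j i && ~~ `[< rhoplus
    s (inl i : V) (inl j) >])) alpha (inl j))%N.

Record witness : Prop := Witness {
  wit_root0 : xb (broot T) = -1;
  wit_root1 : yb (broot T) = 1;
  wit_a : forall i, sc (xb (wparent i)) + (extL i)%:R <= X i;
  wit_b : forall i, X i <= core_lo i;
  wit_c : forall i, core_hi i <= Y i;
  wit_d : forall i, Y i <= sc (yb (wparent i)) - (extR i)%:R;
  wit_len : forall u : 'I_(nb T), sc (yb u) - sc (xb u) = (alpha (inr u))%:R;
  wit_lo : forall (u : 'I_(nb T)) i, par (inr u) = inl i -> core_lo i <= sc (xb u);
  wit_hi : forall (u : 'I_(nb T)) i, par (inr u) = inl i -> sc (yb u) <= core_hi i;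
  wit_next : forall u u' : 'I_(nb T), leftof (inr u : V) (inr u') ->
     ~ (exists w, leftof (inr u : V) w /\ leftof w (inr u')) -> sc (yb u) <= sc (xb u') }.

End Witness.

(** Besides rescaling, [wit_len] is extended to the root, whose interval [0,m] has length [m], the
    value of [alpha] there. *)
Lemma ov1_condP (R : realType) (m : nat) (T : bwtree m) (s : 'S_m) (L : 'I_m -> R * R) :
  (0 < m)%N -> is_bwtree T -> ov1_cond T s L <->
  exists xb yb : 'I_(nb T) -> R, witness s L xb yb.
Proof.
move=> m0 TT.
have bE xb i : scale m (xb (wparent T i) + tm R m * (asum (lam (inl i : vtx T)))%:R) =
    core_lo xb i.
  by rewrite scaleD // asum_lam.
have gE yb i : scale m (yb (wparent T i) - tm R m * (asum (rho (inl i : vtx T)))%:R) =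
    core_hi yb i.
  by rewrite scaleB // asum_rho.
have nroot u i : par (inr u) = inl i -> inr u <> vroot T.
  by move=> e ur; move: e; rewrite ur (par_root TT).
split=> [[xb [yb [[r0 r1] h1 h3]]]|[xb [yb [r0 r1 a b c d len l h n]]]]; exists xb, yb.
- have K u i : par (inr u) = inl i -> _ :=
    fun e => h3 i (wparent T i) u (wparentE TT i) (conj (nroot u i e) e).
  split=> //.
  + by move=> i; have [H _ _ _] := h1 i (wparent T i) (wparentE TT i);
      rewrite -scaleD // (ler_scale m0) /extL -(asum_lamp TT).
  + by move=> i; have [_ H _ _] := h1 i (wparent T i) (wparentE TT i);
      rewrite -bE (ler_scale m0).
  + by move=> i; have [_ _ H _] := h1 i (wparent T i) (wparentE TT i);
      rewrite -gE (ler_scale m0).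
  + by move=> i; have [_ _ _ H] := h1 i (wparent T i) (wparentE TT i);
      rewrite -scaleB // (ler_scale m0) /extR -(asum_rhop TT).
  + move=> u; have [ur|ur] := pselect (inr u = vroot T).
      case: (ur) => ->; rewrite r0 r1 scale_lo scale_hi subr0.
      by rewrite -[inr (broot T)]/(vroot T) (alpha_root TT).
    by have [i e] := black_par TT ur; have [/(scale_len m0) -> //] := K u i e.
  + by move=> u i e; have [_ H _ _] := K u i e; rewrite -bE (ler_scale m0).
  + by move=> u i e; have [_ _ H _] := K u i e; rewrite -gE (ler_scale m0).
  + move=> u u' lu nu; rewrite (ler_scale m0); have [ur [_ _]] := lu.
    by have [i e] := black_par TT ur; have [_ _ _ H] := K u i e; apply: H.
- split=> // [i v|i v u].
    rewrite (wparentE TT) => -[<-]; split.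
    + by rewrite -(ler_scale m0) scaleD // (asum_lamp TT); apply: a.
    + by rewrite -(ler_scale m0) bE; apply: b.
    + by rewrite -(ler_scale m0) gE; apply: c.
    + by rewrite -(ler_scale m0) scaleB // (asum_rhop TT); apply: d.
  rewrite (wparentE TT) => -[<-] [ur pu]; split.
  + have := len u; rewrite /scale /tm => e;
      have : m%:R != 0 :> R by rewrite pnatr_eq0 -lt0n.
    by move=> ?; rewrite -e; field.
  + by rewrite -(ler_scale m0) bE; apply: l.
  + by rewrite -(ler_scale m0) gE; apply: h.
  + by move=> u' lu nu; rewrite -(ler_scale m0); apply: n.
Qed.

(** * From trees to laminar families, and back along a closed cell *)

Section WitnessLaminar.
Variables (R : realType) (m : nat) (T : bwtree m).
Hypothesis m0 : (0 < m)%N.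
Hypothesis TT : is_bwtree T.
Local Notation V := (vtx T).
Local Notation root := (vroot T).
Local Notation par := (@Defs.par m T).
Local Notation pos := (@Defs.pos m T).
Local Notation alpha := (@Defs.alpha m T).
Local Notation anc := (@anc m T).
Local Notation wchild := (@white_child m T).
Local Notation pb := (@wparent m T).
Local Notation ltL := (@ltL m T).
Local Notation ltR := (@ltR m T).
Local Notation prefL := (@sum_left m T).
Local Notation prefR := (@sum_right m T).
Variables (s : 'S_m) (L : 'I_m -> R * R) (xb yb : 'I_(nb T) -> R).
Hypothesis CO : compatible T s.
Hypothesis W : witness s L xb yb.
Local Notation sc := (@scale R m).
Local Notation X := (fun i => sc (L i).1).
Local Notation Y := (fun i => sc (L i).2).
Local Notation h := (height s).
Local Notation bT := (core_lo xb).
Local Notation gT := (core_hi yb).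
Local Notation lo := (vtx_lo xb).
Local Notation hi := (vtx_hi yb).

Lemma wit_lenw i : gT i = bT i + (alpha (inl i))%:R.
Proof.
have := wit_len W (pb i); rewrite -(prefLR TT) !natrD /core_hi /core_lo; lra.
Qed.

Lemma hi_lo v : hi v = lo v + (alpha v)%:R.
Proof. by case: v => [i|u] /=; [exact: wit_lenw|have := wit_len W u; lra]. Qed.

Lemma lo_lt i : bT i < gT i.
Proof. by rewrite wit_lenw ltrDl ltr0n alpha_gt0. Qed.

Lemma lo_hi v : lo v <= hi v.
Proof. by rewrite hi_lo lerDl. Qed.

Lemma par_geom v : lo (par v) <= lo v /\ hi v <= hi (par v).
Proof.
have [->|vr] := pselect (v = root); first by rewrite (par_root TT).
case: v vr => [i|u] ur; first by rewrite wparentE //= /core_hi /core_lo lerDl gerBl !ler0n.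
by have [i e] := black_par TT ur; rewrite e /=; split;
    [exact: (wit_lo W)|exact: (wit_hi W)].
Qed.

Lemma anc_geom u v : anc u v -> lo v <= lo u /\ hi u <= hi v.
Proof.
move=> [n <-]; elim: n => [|n [IH1 IH2]] //=.
by have [? ?] := par_geom (iter n par u); split; lra.
Qed.

Lemma presum_cross i j : wchild (pb i) j -> ltL i j ->
  (alpha (inr (pb i)) <= prefR i + prefL j)%N.
Proof.
move=> /[dup] cj /(introT eqP) /eqP; rewrite wchildE // => /eqP pj ij.
have := prefLR TT i.
have : (prefL i + alpha (inl i) <= prefL j)%N; last by lia.
rewrite /sum_left pj.
by apply: (@presum_le _ _ _ (fun j => alpha (inl j)) (@ltL_irr m T) (@ltL_trans m T)) =>
    //; exact: wchild_pb.
Qed.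

(** [wit_next] compares only neighbours; the induction is on the difference of positions, which any
    vertex in between splits. *)
Lemma black_order n (u u' : 'I_(nb T)) : (pos (inr u') - pos (inr u) <= n)%N ->
  leftof (inr u : V) (inr u') -> sc (yb u) <= sc (xb u').
Proof.
elim: n u u' => [|n IH] u u' le [ur [ur' [pu lu]]]; first by lia.
have [[w [[_ [wr [pw lw]]] [_ [_ [pw' lw']]]]]|nw] := pselect (exists w, leftof (inr u : V)
    w /\ leftof w (inr u')); last first.
  by apply: (wit_next W) nw; do !split.
case: w wr pw lw pw' lw' => [i|w] wr pw lw pw' lw'.
  by have [k e] := black_par TT ur; rewrite e wparentE in pw.
have l1 : sc (yb u) <= sc (xb w) by apply: IH; [lia|do !split].
have l2 : sc (yb w) <= sc (xb u') by apply: IH; [lia|do !split].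
by have := lo_hi (inr w) => /= l3; lra.
Qed.

Lemma leftof_geom (u v : V) : leftof u v -> hi u <= lo v.
Proof.
case: u v => [i|u] [j|v].
- move=> /(leftofE' TT) /andP[/[dup] cj]; rewrite wchildE // => /eqP pj ij /=.
  have := presum_cross cj ij; rewrite -(ler_nat R) natrD.
  by have := wit_len W (pb i); rewrite /core_hi /core_lo pj; lra.
- move=> [_ [vr [p _]]]; rewrite wparentE // in p.
  by have [k e] := black_par TT vr; rewrite e in p.
- move=> [ur [_ [p _]]]; rewrite wparentE // in p.
  by have [k e] := black_par TT ur; rewrite e in p.
- exact: (@black_order (pos (inr v) - pos (inr u))).
Qed.

Lemma anc_disj (u v : V) : ~ anc u v -> ~ anc v u -> hi u <= lo v \/ hi v <= lo u.
Proof.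
move=> nuv nvu; have [u' [v' [[a1 a2 n3 r4 r5] p6]]] := anc_meet TT nuv nvu.
have [? ?] := anc_geom a1; have [? ?] := anc_geom a2.
have := pos_inj TT n3 r4 r5 p6; rewrite neq_ltn => /orP[l|l].
  have : hi u' <= lo v' by apply: leftof_geom; do !split.
  by left; lra.
have : hi v' <= lo u' by apply: leftof_geom; do !split.
by right; lra.
Qed.

Lemma anc_alpha_lt (i j : 'I_m) : anc (inl i) (inl j) -> i != j -> (alpha (inl i) < alpha
    (inl j))%N.
Proof.
move=> a nij; rewrite !alphaE; apply: proper_card; apply/properP; split.
  apply/fintype.subsetP => k; rewrite !mem_wdesc => /asboolP ak; apply/asboolP.
  exact: anc_trans ak a.
exists j; first by rewrite mem_wdesc; apply/asboolP/anc_refl.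
rewrite mem_wdesc; apply/asboolP => a'; move: nij.
by have [->] := anc_anti TT a a'; rewrite eqxx.
Qed.

(** Incomparable vertices have non-overlapping intervals, and a proper descendant has a strictly
    shorter core, so nesting of cores is exactly the tree order. *)
Lemma insideT i j : inside bT gT i j <-> anc (inl i) (inl j).
Proof.
split=> [/andP[s1 s2]|/anc_geom[s1 s2]]; last by apply/andP.
have [//|na] := pselect (anc (inl i) (inl j)).
have [a|na'] := pselect (anc (inl j) (inl i)).
  have [e|nji] := eqVneq j i; first by rewrite e; exact: anc_refl.
  have := anc_alpha_lt a nji; rewrite -(ltr_nat R).
  by have := wit_lenw i; have := wit_lenw j; lra.
have li := lo_lt i; have lj := lo_lt j.
by have /= [] := anc_disj na na'; lra.
Qed.

Lemma compat_anc (i j : 'I_m) : anc (inl j) (inl i) -> i != j -> (h i < h j)%N.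
Proof.
move=> a nij; apply: CO; split=> //.
by case=> e; rewrite e eqxx in nij.
Qed.

(** The closure property that [presum_cover] asks of [P]: membership of [w] makes every sibling
    between [w] and [i] higher than [i]. *)
Lemma lamplus_up i w w' : wchild (pb i) w -> wchild (pb i) w' -> ltL w w' -> ltL w' i ->
  lamplus s (inl i : V) (inl w) -> lamplus s (inl i : V) (inl w').
Proof.
move=> cw cw' ww wi [l1 [l2 l3]].
have lw' : leftof (inl w' : V) (inl i) by apply/(leftofE TT); rewrite cw'.
have lww : leftof (inl w : V) (inl w').
  by apply/(leftofE TT); move: cw cw'; rewrite !wchildE // ww => /eqP -> /eqP ->;
      rewrite eqxx.
split; first by split=> //; exists w'.
split; first exact: l3.
move=> k [k1 [k2 [k3 k4]]]; apply: l3; split=> //; split=> //; split.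
  by rewrite -k3; have [_ [_ [-> _]]] := lww.
by apply: ltn_trans ww k4.
Qed.

Lemma rhoplus_up i w w' : wchild (pb i) w -> wchild (pb i) w' -> ltR w w' -> ltR w' i ->
  rhoplus s (inl i : V) (inl w) -> rhoplus s (inl i : V) (inl w').
Proof.
move=> cw cw' ww wi [l1 [l2 l3]].
have lw' : leftof (inl i : V) (inl w') by apply/(leftofE' TT); rewrite cw'.
have lww : leftof (inl w' : V) (inl w).
  by apply/(leftofE TT); move: cw cw'; rewrite !wchildE // => /eqP -> /eqP ->; rewrite eqxx.
split; first by split=> //; exists w'.
split; first exact: l3.
move=> k k1 [k2 [k3 [k4 k5]]]; apply: l3 => //; split=> //.
have [_ [k6 [k7 k8]]] := lww; split=> //; split; first by rewrite k4.
exact: ltn_trans k5 k8.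
Qed.

(** [lam_cover] is the meaning of the bounds [a_i] and [d_i]: outside its core an interval extends
    only over adjacent siblings in [lamplus] or [rhoplus], whose cores tile the frame. *)
Lemma wit_laminar : laminar bT gT X Y h.
Proof.
have rb (v : V) : 0 <= lo v /\ hi v <= m%:R.
  have [] := anc_geom (anc_root TT v) => /=.
  by rewrite (wit_root0 W) (wit_root1 W) scale_lo scale_hi.
split.
- move=> i; rewrite wit_lenw alphaE; congr (_ + _%:R); apply: eq_card => j;
    rewrite mem_wdesc inE.
  by apply/asboolP/idP => /insideT.
- move=> i j nij.
  have [/insideT ->|na] := pselect (anc (inl i) (inl j)); first by rewrite orbT.
  have [/insideT ->|na'] := pselect (anc (inl j) (inl i)); first by rewrite !orbT.
  by rewrite /disj; have /= [->|->] := anc_disj na na'; rewrite ?orbT.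
- by move=> i; have [] := rb (inl i).
- by move=> i; have [] := rb (inl i).
- by move=> i j nij /insideT a; exact: compat_anc.
- exact: (wit_b W).
- exact: (wit_c W).
- move=> i t t1 t2 nt; have gl := lo_lt i.
  have [lt|ge] := ltP t (bT i).
    have A1 : (@extL m T s i)%:R < t - sc (xb (pb i)) by have := wit_a W i; lra.
    have A2 : t - sc (xb (pb i)) <= (prefL i)%:R by move: lt; rewrite /core_lo; lra.
    have [w [cw wi /asboolP [_ [hw _]] w1 w2]] := presum_cover (@ltL_irr m T) (@ltL_trans m
        T)
      (@ltL_tot m T TT (pb i)) (@alpha_gt0 m T) (i := i)
      (P := fun j => `[< lamplus s (inl i : V) (inl j) >]) (t := t - sc (xb (pb i)))
          (wchild_pb TT i)
      (fun w w' a b c d e => introT (asboolP _) (lamplus_up a b c d (elimT (asboolP _) e)))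
          A1 A2.
    exists w; move: (cw); rewrite wchildE // => /eqP pw; split=> //.
      by apply/andP; split; [|rewrite wit_lenw natrD in w2 *]; rewrite /core_lo /prefL pw;
          lra.
    have lw : leftof (inl w : V) (inl i) by apply/(leftofE TT); rewrite cw.
    by rewrite /disj; have := leftof_geom lw => /= ->; rewrite orbT.
  have [|gt] := leP t (gT i); first by move=> le; move: nt; rewrite ge le.
  have A1 : (@extR m T s i)%:R < sc (yb (pb i)) - t by have := wit_d W i; lra.
  have A2 : sc (yb (pb i)) - t <= (prefR i)%:R by move: gt; rewrite /core_hi; lra.
  have [w [cw wi /asboolP [_ [hw _]] w1 w2]] := presum_cover (@ltR_irr m T) (@ltR_trans m T)
      (@ltR_tot m T TT (pb i)) (@alpha_gt0 m T) (i := i)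
      (P := fun j => `[< rhoplus s (inl i : V) (inl j) >]) (t := sc (yb (pb i)) - t)
          (wchild_pb TT i)
      (fun w w' a b c d e => introT (asboolP _) (rhoplus_up a b c d (elimT (asboolP _) e)))
          A1 A2.
  exists w; move: (cw); rewrite wchildE // => /eqP pw; split=> //.
    have := wit_lenw w; rewrite /core_hi /prefR pw natrD in w2 *.
    by move=> e; apply/andP; split; lra.
  have lw : leftof (inl i : V) (inl w) by apply/(leftofE' TT); rewrite cw.
  by rewrite /disj; have := leftof_geom lw => /= ->.
Qed.

(** Siblings touch in order, so the frame of [i] contains the first one, which begins where the
    black interval does. Ends of black intervals are thus core endpoints. *)
Lemma sib_first i : exists2 f, conn bT gT f i & bT f = sc (xb (pb i)).
Proof.
have [n] := ubnP (prefL i); elim: n i => // n IH i; rewrite ltnS => le.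
have [e|[p [cp _ e]]] := presum_pred (@ltL_irr m T) (@ltL_trans m T) (@ltL_tot m T TT (pb
    i))
  (@alpha_gt0 m T) (wchild_pb TT i).
  by exists i; rewrite ?conn_refl // /core_lo /sum_left e addr0.
have pp : pb p = pb i by move: cp; rewrite wchildE // => /eqP.
have e' : (prefL p + alpha (inl p) = prefL i)%N by rewrite /sum_left pp.
have [|f cf ef] := IH p; first by apply: leq_trans le; rewrite -e' -addn1 leq_add2l;
    exact: alpha_gt0.
exists f; last by rewrite ef pp.
apply: conn_trans cf _; apply: touch_conn.
by rewrite wit_lenw /core_lo pp -e' natrD addrA.
Qed.

Lemma sib_last i : exists2 f, conn bT gT f i & gT f = sc (yb (pb i)).
Proof.
have [n] := ubnP (prefR i); elim: n i => // n IH i; rewrite ltnS => le.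
have [e|[p [cp _ e]]] := presum_pred (@ltR_irr m T) (@ltR_trans m T) (@ltR_tot m T TT (pb
    i))
  (@alpha_gt0 m T) (wchild_pb TT i).
  by exists i; rewrite ?conn_refl // /core_hi /sum_right e subr0.
have pp : pb p = pb i by move: cp; rewrite wchildE // => /eqP.
have e' : (prefR p + alpha (inl p) = prefR i)%N by rewrite /sum_right pp.
have [|f cf ef] := IH p; first by apply: leq_trans le; rewrite -e' -addn1 leq_add2l;
    exact: alpha_gt0.
exists f; last by rewrite ef pp.
apply: conn_trans cf _; rewrite conn_sym; apply: touch_conn.
by have := wit_lenw p; rewrite /core_hi pp -e' natrD; lra.
Qed.

Section Transport.
Variables (z z' : config R m).
Hypotheses (zX : forall i, cX z i = X i) (zY : forall i, cY z i = Y i).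
Hypotheses (N : ctight z h) (rf : refines bT gT (cb z) (cg z)) (cl : closed_type z z').

Let w (p : slot m) := z' p - z p.
(** Any child will do: by [w_b] all cores of a frame have the same displacement, which [sh]
    records. *)
Let ch (v : 'I_(nb T)) : 'I_m := projT1 (cid (black_child TT v m0)).
Let chE v : wchild v (ch v). Proof. by apply/eqP;
    exact: (projT2 (cid (black_child TT v m0))). Qed.
Let pbch v : pb (ch v) = v. Proof. by apply/eqP; rewrite -wchildE // chE. Qed.
Let sh (v : 'I_(nb T)) : R := w (true, false, ch v).

Let w_int (p q : slot m) : cconn z p.2 q.2 -> z p - z q \is a Num.int -> w p = w q.
Proof. by move=> c zi; apply: (tangent_int N (tangent_closed_sub cl) c zi). Qed.

Let w_b i j : cconn z i j -> w (true, false, i) = w (true, false, j).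
Proof. by move=> c; apply: w_int => //; exact: (tight_conn_int N). Qed.

Let w_g i j : cconn z i j -> w (true, true, i) = w (true, false, j).
Proof.
move=> c; rewrite -(w_b c); apply: w_int; first exact: conn_refl.
have := lam_len N.1 i; rewrite /cb /cg => ->.
by rewrite addrAC subrr add0r natr_int.
Qed.

Let xbE i : exists2 l, cconn z l i & sc (xb (pb i)) = cb z l.
Proof.
have [f cf <-] := sib_first i; have [rb _ _ _] := rf; have [l c ->] := rb f; exists l => //.
by apply: conn_trans c _; apply: refines_conn rf cf.
Qed.

Let ybE i : exists2 l, cconn z l i & sc (yb (pb i)) = cg z l.
Proof.
have [f cf <-] := sib_last i; have [_ rg _ _] := rf; have [l c ->] := rg f; exists l => //.
by apply: conn_trans c _; apply: refines_conn rf cf.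
Qed.

Let sib_conn i : cconn z i (ch (pb i)).
Proof.
have [l c e] := xbE i; have [l' c' e'] := xbE (ch (pb i)); rewrite pbch e in e'.
have := @tight_end_conn _ _ z h (true, false, l) (true, false, l') N isT isT e' => cll.
by apply: conn_trans (conn_trans cll c'); rewrite conn_sym.
Qed.

(* Each black interval moves along with the frame of its children. *)
Let xb' v := unscale m (sc (xb v) + sh v).
Let yb' v := unscale m (sc (yb v) + sh v).

Let xb'E i : exists l, [/\ cconn z l i, sc (xb (pb i)) = cb z l & sc (xb' (pb i)) = cb z'
    l].
Proof.
have [l c e] := xbE i; exists l; split=> //.
rewrite /xb' unscaleK // e /sh -(w_b (sib_conn i)) -(w_b c) /w /cb; lra.
Qed.

Let yb'E i : exists l, [/\ cconn z l i, sc (yb (pb i)) = cg z l & sc (yb' (pb i)) = cg z'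
    l].
Proof.
have [l c e] := ybE i; exists l; split=> //.
rewrite /yb' unscaleK // e /sh -(w_b (sib_conn i)) -(w_g c) /w /cg; lra.
Qed.

Let bTE i : exists l, [/\ cconn z l i, bT i = cb z l & core_lo xb' i = cb z' l].
Proof.
have [rb _ _ _] := rf; have [l c e] := rb i; exists l; split=> //.
rewrite /core_lo /xb' unscaleK //.
have -> : sc (xb (pb i)) + sh (pb i) + (prefL i)%:R = bT i + sh (pb i) by rewrite /core_lo;
    lra.
rewrite e /sh -(w_b (sib_conn i)) -(w_b c) /w /cb; lra.
Qed.

Let gTE i : exists l, [/\ cconn z l i, gT i = cg z l & core_hi yb' i = cg z' l].
Proof.
have [_ rg _ _] := rf; have [l c e] := rg i; exists l; split=> //.
rewrite /core_hi /yb' unscaleK //.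
have -> : sc (yb (pb i)) + sh (pb i) - (prefR i)%:R = gT i + sh (pb i) by rewrite /core_hi;
    lra.
rewrite e /sh -(w_b (sib_conn i)) -(w_g c) /w /cg; lra.
Qed.

(** The same tree and permutation serve on the whole closed cell. Every condition, once black
    endpoints are expressed by core endpoints of [z], is an outcome of a relevant test and therefore
    persists. *)
Lemma transport : ov1_cond T s (fun i => (unscale m (cX z' i), unscale m (cY z' i))).
Proof.
apply/(ov1_condP _ _ m0 TT); exists xb', yb'.
have ext (P : pred 'I_m) i : (\sum_(j | wchild (pb i) j && P j) alpha (inl j) <= m)%N.
  exact: sum_le_alpha.
have root0 : sc (xb' (broot T)) = 0.
  have [l [_]] := xb'E (ch (broot T)); rewrite pbch (wit_root0 W) scale_lo => e ->.
  have r : relevant z (Some (true, false, l)) None 0 by [].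
  have [l1 l2] := cl (leq0n m) r.
  have : delta z (Some (true, false, l)) None = 0 by rewrite /delta /= subr0 -[LHS]/(cb z
      l) -e.
  move=> d; rewrite d lexx in l1 l2; move: (l1 isT) (l2 isT).
  by rewrite /delta /= subr0 /cb; lra.
have sh0 : sh (broot T) = 0.
  by move: root0; rewrite /xb' unscaleK // (wit_root0 W) scale_lo add0r.
have endle (v v' : 'I_(nb T)) : sc (yb v) <= sc (xb v') -> sc (yb' v) <= sc (xb' v').
  have [l [_ e1 e2]] := yb'E (ch v); have [l' [_ e1' e2']] := xb'E (ch v').
  rewrite !pbch in e1 e2 e1' e2'; rewrite e1 e2 e1' e2'; exact: (closed_end_le cl).
split.
- by rewrite -[LHS](scaleK m0) root0 /unscale mulr0 addr0.
- by rewrite /yb' sh0 addr0 scaleK // (wit_root1 W).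
- move=> i; rewrite /= (unscaleK m0 (cX z' i)); have [l [c e ->]] := xb'E i.
  have r : relevant z (Some (false, false, i)) (Some (true, false, l)) (@extL m T s i).
    have ci : cconn z i l by rewrite /cconn conn_sym.
    by rewrite /= ci.
  have [+ _] := cl (ext _ i) r; rewrite /delta /=.
  have := wit_a W i; rewrite e -zX /cb /cX => wa H.
  by have := H _; lra.
- move=> i; rewrite /= (unscaleK m0 (cX z' i)); have [l [c e ->]] := bTE i.
  apply: (closed_conn_le cl); first by rewrite /= /cconn conn_sym.
  by have := wit_b W i; rewrite e -zX.
- move=> i; rewrite /= (unscaleK m0 (cY z' i)); have [l [c e ->]] := gTE i.
  by apply: (closed_conn_le cl) => //; have := wit_c W i; rewrite e -zY.
- move=> i; rewrite /= (unscaleK m0 (cY z' i)); have [l [c e ->]] := yb'E i.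
  have r : relevant z (Some (true, true, l)) (Some (false, true, i)) (@extR m T s i).
    by rewrite /= c.
  have [+ _] := cl (ext _ i) r; rewrite /delta /=.
  have := wit_d W i; rewrite e -zY /cg /cY => wa H.
  by have := H _; lra.
- by move=> u; rewrite /xb' /yb' !unscaleK //; have := wit_len W u; lra.
- move=> u i pu; have [l [c e ->]] := bTE i; have [l' [_ e1 e2]] := xb'E (ch u).
  rewrite !pbch in e1 e2; rewrite e2; apply: (closed_end_le cl) => //.
  by have := wit_lo W pu; rewrite e e1.
- move=> u i pu; have [l [c e ->]] := gTE i; have [l' [_ e1 e2]] := yb'E (ch u).
  rewrite !pbch in e1 e2; rewrite e2; apply: (closed_end_le cl) => //.
  by have := wit_hi W pu; rewrite e e1.
- by move=> u u' l nu; apply: endle; apply: (wit_next W).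
Qed.

End Transport.

End WitnessLaminar.

(** * Polytopes and balls *)

Section Gauge.
Variable R : realType.

Lemma continuous_sum (T : topologicalType) (I : Type) (r : seq I) (F : I -> T -> R) :
  (forall i, continuous (F i)) -> continuous (fun x => \sum_(i <- r) F i x).
Proof.
move=> cF; elim: r => [|i r IH] x.
  by under eq_fun do rewrite big_nil; apply: cvg_cst.
by under eq_fun do rewrite big_cons; apply: continuousD; [exact: cF|exact: IH].
Qed.

Lemma continuous_bigmax0 (T : topologicalType) (I : Type) (r : seq I) (F : I -> T -> R) :
  (forall i, continuous (F i)) -> continuous (fun x => \big[Num.max/0]_(i <- r) F i x).
Proof.
move=> cF; elim: r => [|i r IH] x.
  by under eq_fun do rewrite big_nil; apply: cvg_cst.
by under eq_fun do rewrite big_cons; apply: continuous_max; [exact: cF|exact: IH].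
Qed.

Variables (d : nat) (I : finType) (A : 'M[R]_(d, #|I|)).
Implicit Types p q v : 'rV[R]_d.

Definition form_at p (i : I) := (p *m A) 0 (enum_rank i).

(** The Minkowski functional of the polytope where all forms are at most 1; the maximum starts at 0,
    so forms negative at [p] do not count. *)
Definition gauge p := \big[Num.max/0]_i form_at p i.

Definition enorm p := Num.sqrt (\sum_k p 0 k ^+ 2).

(* Maps the Euclidean unit ball onto the polytope [gauge <= 1]; its value at 0
   is 0 because of 0 / 0 = 0. *)
Definition radial p := (enorm p / gauge p) *: p.

Lemma form_atZ t p i : form_at (t *: p) i = t * form_at p i.
Proof. by rewrite /form_at -scalemxAl mxE. Qed.

Lemma gauge_ge0 p : 0 <= gauge p.
Proof. by rewrite /gauge; apply: bigmax_ge_id. Qed.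

Lemma gauge_le p t : 0 <= t -> gauge p <= t <-> forall i, form_at p i <= t.
Proof.
move=> t0; split=> [le i|le]; last by apply/bigmax_leP.
by apply: le_trans le; apply: le_bigmax.
Qed.

Lemma gauge_lt p t : 0 < t -> gauge p < t <-> forall i, form_at p i < t.
Proof.
move=> t0; split=> [le i|le]; last by apply/bigmax_ltP.
by apply: le_lt_trans le; apply: le_bigmax.
Qed.

Lemma gaugeZ t p : 0 <= t -> gauge (t *: p) = t * gauge p.
Proof.
move=> t0; have [->|nz] := eqVneq t 0.
  rewrite scale0r mul0r; apply/eqP; rewrite eq_le gauge_ge0 andbT.
  by apply/gauge_le => // i; rewrite /form_at mul0mx mxE.
have tp : 0 < t by rewrite lt_neqAle eq_sym nz t0.
apply/eqP; rewrite eq_le; apply/andP; split.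
  apply/gauge_le => [|i]; first by rewrite mulr_ge0 ?gauge_ge0.
  by rewrite form_atZ ler_pM2l //; move: i; apply/gauge_le; rewrite ?gauge_ge0.
rewrite -ler_pdivlMl //; apply/gauge_le => [|i].
  by rewrite mulr_ge0 ?invr_ge0 ?gauge_ge0.
by rewrite ler_pdivlMl // -form_atZ; move: i; apply/gauge_le; rewrite ?gauge_ge0.
Qed.

Lemma sumsq_ge0 p : 0 <= \sum_k p 0 k ^+ 2.
Proof. by apply: sumr_ge0 => k _; apply: sqr_ge0. Qed.

Lemma enorm_ge0 p : 0 <= enorm p. Proof. exact: sqrtr_ge0. Qed.

Lemma enormZ t p : 0 <= t -> enorm (t *: p) = t * enorm p.
Proof.
move=> t0; rewrite /enorm.
have -> : \sum_k (t *: p) 0 k ^+ 2 = t ^+ 2 * \sum_k p 0 k ^+ 2.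
  by rewrite mulr_sumr; apply: eq_bigr => k _; rewrite mxE exprMn.
by rewrite sqrtrM ?sqr_ge0 // sqrtr_sqr ger0_norm.
Qed.

Lemma enorm_coord p k : `|p 0 k| <= enorm p.
Proof.
rewrite -sqrtr_sqr; apply: ler_wsqrtr.
by rewrite (bigD1 k) //= lerDl; apply: sumr_ge0 => j _; apply: sqr_ge0.
Qed.

Lemma enorm_gt0 p : p != 0 -> 0 < enorm p.
Proof.
move=> nz; rewrite lt_neqAle enorm_ge0 andbT eq_sym; apply: contra nz => /eqP e0.
apply/eqP/rowP => k; rewrite mxE; apply/eqP; rewrite -normr_eq0.
by rewrite eq_le normr_ge0 andbT -e0 enorm_coord.
Qed.

Lemma continuous_gauge : continuous gauge.
Proof.
apply: continuous_bigmax0 => i; rewrite /form_at.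
under eq_fun do rewrite mxE; apply: continuous_sum => k x.
by apply: continuousM; [exact: coord_continuous|exact: cst_continuous].
Qed.

Lemma continuous_enorm : continuous enorm.
Proof.
move=> x; apply: (@continuous_comp _ _ _ (fun p => \sum_k p 0 k ^+ 2) Num.sqrt);
    last exact: sqrt_continuous.
apply: continuous_sum => k {}x; under eq_fun do rewrite expr2.
by apply: continuousM; exact: coord_continuous.
Qed.

Lemma gauge0 : gauge 0 = 0.
Proof. by rewrite -(scale0r (0 : 'rV[R]_d)) gaugeZ // mul0r. Qed.

Lemma enorm0 : enorm 0 = 0.
Proof. by rewrite -(scale0r (0 : 'rV[R]_d)) enormZ // mul0r. Qed.

Variable D : R.
Hypothesis bounded : forall p, (forall i, form_at p i <= 1) -> forall k, `|p 0 k| <= D.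

(** A nonzero point of gauge 0 would span a ray inside the polytope; the factor [t] takes its
    coordinate [k] to [D + 1]. *)
Lemma gauge_gt0 p : p != 0 -> 0 < gauge p.
Proof.
move=> nz; rewrite lt_neqAle gauge_ge0 andbT eq_sym; apply/eqP => g0.
have [k pk] : exists k, p 0 k != 0.
  apply/existsP; apply: contraNT nz; rewrite negb_exists => /forallP z.
  by apply/eqP/rowP => k; rewrite mxE; apply/eqP/negPn/z.
have pk0 : 0 < `|p 0 k| by rewrite normr_gt0.
have D0 : 0 <= D.
  apply: le_trans (normr_ge0 ((0 : 'rV[R]_d) 0 k)) _; apply: bounded => i.
  by rewrite /form_at mul0mx mxE ler01.
pose t := (D + 1) / `|p 0 k|.
have t0 : 0 <= t by rewrite divr_ge0 //; lra.
have := @bounded (t *: p); move=> /(_ _ k);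
    rewrite mxE normrM (ger0_norm t0) divfK ?gt_eqF //.
move=> H; have : D + 1 <= D; last by lra.
by apply: H; apply/gauge_le; rewrite ?gaugeZ ?g0 ?mulr0 ?ler01.
Qed.

Lemma coord_gauge p k : `|p 0 k| <= D * gauge p.
Proof.
have [->|nz] := eqVneq p 0.
  rewrite mxE normr0; apply: mulr_ge0 (gauge_ge0 _).
  apply: le_trans (normr_ge0 ((0 : 'rV[R]_d) 0 k)) _; apply: bounded => i.
  by rewrite /form_at mul0mx mxE ler01.
have g0 := gauge_gt0 nz; rewrite -ler_pdivrMr //.
have := @bounded ((gauge p)^-1 *: p).
rewrite -(gauge_le _ ler01) gaugeZ ?invr_ge0 ?gauge_ge0 // mulVf ?gt_eqF // lexx.
by move=> /(_ isT k); rewrite mxE normrM ger0_norm ?invr_ge0 ?gauge_ge0 // mulrC.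
Qed.

Lemma radial0 : radial 0 = 0.
Proof. by rewrite /radial scaler0. Qed.

Lemma gauge_radial p : gauge (radial p) = enorm p.
Proof.
have [->|nz] := eqVneq p 0.
  by rewrite radial0 gauge0 enorm0.
rewrite gaugeZ ?divr_ge0 ?gauge_ge0 ?enorm_ge0 // divfK //.
by rewrite gt_eqF ?gauge_gt0.
Qed.

Lemma radial_inj : injective radial.
Proof.
move=> p q e; have en : enorm p = enorm q by rewrite -!gauge_radial e.
have [p0|pz] := eqVneq p 0.
  have [->//|qz] := eqVneq q 0.
  by have := enorm_gt0 qz; rewrite -en -gauge_radial p0 radial0 gauge0 ltxx.
have ep := enorm_gt0 pz.
have qz : q != 0.
  by apply: contraTneq ep => q0; rewrite en q0 -gauge_radial radial0 gauge0 ltxx.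
have gp := gauge_gt0 pz; have gq := gauge_gt0 qz.
have {}e : (gauge p)^-1 *: p = (gauge q)^-1 *: q.
  have := congr1 (fun v => (enorm p)^-1 *: v) e;
      rewrite /radial -en !scalerA !mulrA mulVf ?gt_eqF //.
  by rewrite !mul1r.
have e1 : (gauge p)^-1 * enorm p = (gauge q)^-1 * enorm q.
  by rewrite -!enormZ ?invr_ge0 ?gauge_ge0 // e.
have e2 : (gauge p)^-1 = (gauge q)^-1.
  by apply: (mulIf (x := enorm p)); rewrite ?gt_eqF // e1 en.
move: e; rewrite e2 => /scalerI; apply; by rewrite invr_eq0 gt_eqF.
Qed.

Lemma radial_surj v : exists p, radial p = v.
Proof.
have [->|nz] := eqVneq v 0; first by exists 0; rewrite radial0.
have gv := gauge_gt0 nz; have ev := enorm_gt0 nz.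
exists ((gauge v / enorm v) *: v); rewrite /radial.
rewrite gaugeZ ?enormZ ?divr_ge0 ?gauge_ge0 ?enorm_ge0 // divfK ?gt_eqF // scalerA.
have -> : gauge v / (gauge v / enorm v * gauge v) * (gauge v / enorm v) = 1.
  by field; rewrite !gt_eqF.
by rewrite scale1r.
Qed.

(** Away from 0 this is a quotient of continuous functions. At 0 the bound [coord_gauge] yields
    |radial p| at most [D] times [enorm p] in each coordinate. *)
Lemma continuous_radial k : continuous (fun p => radial p 0 k).
Proof.
have E : (fun p => radial p 0 k) = (fun p => enorm p * (gauge p)^-1 * p 0 k).
  by apply/funext => p; rewrite mxE.
move=> p; have [->|nz] := eqVneq p 0.
  have D0 : 0 <= D.
    apply: le_trans (normr_ge0 ((0 : 'rV[R]_d) 0 k)) _; apply: bounded => i.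
    by rewrite /form_at mul0mx mxE ler01.
  apply: (iffRL (@cvgrPdist_lt _ _ _ _ (nbhs_filter (0 : 'rV[R]_d)) _ _)) => e e0.
  have r0 : radial 0 0 k = 0 by rewrite radial0 mxE.
  rewrite r0.
  (* [D + 1] in place of [D], which may be 0. *)
  have De : 0 < e / (D + 1) by rewrite divr_gt0 //; lra.
  have := iffLR (@cvgrPdist_lt _ _ _ _ (nbhs_filter (0 : 'rV[R]_d)) _ _) (@continuous_enorm
      0) _ De.
  apply: filterS => q.
  rewrite enorm0 !sub0r !normrN ger0_norm ?enorm_ge0 // ltr_pdivlMr; last by lra.
  move=> lt; rewrite mxE.
  have [->|qz] := eqVneq q 0; first by rewrite mxE mulr0 normr0.
  have gq := gauge_gt0 qz.
  rewrite normrM ger0_norm ?divr_ge0 ?enorm_ge0 ?gauge_ge0 //.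
  apply: le_lt_trans lt; apply: (@le_trans _ _ (enorm q * D)).
    rewrite -mulrA ler_wpM2l ?enorm_ge0 // mulrC ler_pdivrMr //; exact: coord_gauge.
  by rewrite ler_wpM2l ?enorm_ge0 //; lra.
rewrite E; apply: (@continuousM _ _ (fun p => enorm p * (gauge p)^-1));
    last exact: coord_continuous.
apply: continuousM; first exact: continuous_enorm.
apply: continuousV; first by rewrite gt_eqF ?gauge_gt0.
exact: continuous_gauge.
Qed.

End Gauge.

(** * Continuity of the inverse by compactness *)

Section CompactInverse.
Variable R : realType.

Lemma mx_norm_coord (d : nat) (p : 'rV[R]_d) (k : 'I_d) : `|p 0 k| <= `|p|.
Proof. by rewrite [leRHS]/Num.Def.normr /= mx_normrE; apply/bigmax_geP; right;
    exists (0, k). Qed.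

Lemma mx_norm_lt (d : nat) (p : 'rV[R]_d) (e : R) : 0 < e -> (forall k, `|p 0 k| < e) ->
    `|p| < e.
Proof.
move=> e0 H; rewrite [ltLHS]/Num.Def.normr /= mx_normrE; apply/bigmax_ltP; split=> //.
by move=> [i j] _ /=; rewrite (ord1 i).
Qed.

(** The sum of the [|f j q - f j p|] is positive on the compact set of [q] in the ball at distance
    at least [e] from [p]. Its minimum there, divided among the [f j], gives [del]. *)
Lemma compact_inverse (d : nat) (J : finType) (f : J -> 'rV[R]_d -> R) :
  (forall j, continuous (f j)) ->
  (forall p q, enorm p <= 1 -> enorm q <= 1 -> (forall j, f j p = f j q) -> p = q) ->
  forall p e, enorm p <= 1 -> 0 < e -> exists2 del, 0 < del & forall q, enorm q <= 1 ->
    (forall j, `|f j q - f j p| < del) -> forall k, `|q 0 k - p 0 k| < e.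
Proof.
move=> cf inj p e p1 e0.
pose C : set 'rV[R]_d := [set q | enorm q <= 1 /\ e <= `|q - p|]%classic.
pose F q := \sum_(j : J) `|f j q - f j p|.
have cF : continuous F.
  apply: continuous_sum => j x;
      apply: (@continuous_comp _ _ _ (fun q => f j q - f j p) Num.norm);
      last exact: norm_continuous.
  by apply: continuousB; [exact: cf|exact: cst_continuous].
have K q : enorm q <= 1 -> ~ C q -> forall k, `|q 0 k - p 0 k| < e.
  move=> q1 nC k; rewrite ltNge; apply/negP => le; apply: nC; split=> //.
  by apply: le_trans le _; have := mx_norm_coord (q - p) k; rewrite !mxE.
have [[q0 Cq0]|C0] := pselect (exists q, C q); last first.
  exists 1 => // q q1 _; apply: K => // Cq; apply: C0; by exists q.
have compC : compact C.
  apply: bounded_closed_compact.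
    exists 1; split=> // M M1 q [q1 _]; apply/ltW/mx_norm_lt; first by lra.
    by move=> k; have := enorm_coord q k; lra.
  have -> : C = ((@enorm R d) @^-1` [set x | x <= 1] `&` (fun q => `|q - p|) @^-1` [set x |
      e <= x])%classic by [].
  apply: closedI.
    by apply: preimage_closed => [x _|]; [exact: continuous_enorm|exact: closed_le].
  apply: preimage_closed => [x _|]; last exact: closed_ge.
  apply: (@continuous_comp _ _ _ (fun q : 'rV[R]_d => q - p) Num.norm);
      last exact: norm_continuous.
  by apply: continuousB; [exact: cvg_id|exact: cst_continuous].
have [|c cC cmin] := EVT_min_rV _ compC (continuous_subspaceT cF); first by exists q0.
have {cC} [c1 c2] : C c by move: cC; rewrite inE.
have Fc : 0 < F c.
  rewrite lt_neqAle eq_sym sumr_ge0 ?andbT //; apply/eqP => Fc0.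
  have ecp : c = p.
    apply: inj => // j; apply/eqP; rewrite -subr_eq0 -normr_eq0; apply/eqP.
    by apply/eqP; have := Fc0 => /eqP; rewrite psumr_eq0 // => /allP/(_ j);
        rewrite mem_index_enum => /(_ isT).
  by move: c2; rewrite ecp subrr normr0; lra.
(* The added 1 keeps the denominator positive for empty [J] and makes the final estimate strict. *)
exists (F c / (#|J|%:R + 1)).
  by rewrite divr_gt0 // ltr_wpDl.
move=> q q1 H; apply: K => // Cq.
have := cmin q; rewrite inE => /(_ Cq); rewrite leNgt => /negP; apply.
have J1 : 0 < #|J|%:R + 1 :> R by rewrite ltr_wpDl.
apply: (@le_lt_trans _ _ (\sum_(j : J) (F c / (#|J|%:R + 1)))).
  by apply: ler_sum => j _; apply: ltW.
rewrite sumr_const -[ltLHS]mulr_natr mulrAC ltr_pdivrMr // ltr_pM2l //.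
by rewrite ltrDl ltr01.
Qed.

End CompactInverse.

(** * Closed types as balls *)

Section TangentSpace.
Variables (R : realType) (m : nat).
Implicit Types z w : config R m.
Local Notation N := #|{: slot m}|.
Local Notation test := (test m).

Definition vec w : 'rV[R]_N := \row_j w (enum_val j).
Definition cfg (r : 'rV[R]_N) : config R m := fun v => r 0 (enum_rank v).

Lemma vecK w : cfg (vec w) = w.
Proof. by apply/funext => v; rewrite /cfg mxE enum_rankK. Qed.

Lemma cfgK r : vec (cfg r) = r.
Proof. by apply/rowP => j; rewrite mxE /cfg enum_valK. Qed.

(** Column [s] is the linear form [c s] times the [delta] of the test [s]. Since [None] equals no
    [Some], the fixed end 0 contributes nothing. *)
Definition pairing (c : test -> R) : 'M[R]_(N, #|{: test}|) :=
  \matrix_(v, j) (let s := enum_val j in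
    c s * ((Some (enum_val v) == s.1.1)%:R - (Some (enum_val v) == s.1.2)%:R)).

Lemma sum_val0 w a : \sum_(v : slot m) w v * (Some v == a)%:R = val0 w a.
Proof.
case: a => [u|] /=; last by rewrite big1 // => v _; rewrite mulr0.
rewrite (bigD1 u) //= eqxx mulr1 big1 ?addr0 // => v nv.
by rewrite (inj_eq (@Some_inj _)) (negbTE nv) mulr0.
Qed.

Lemma pairingE c r (s : test) :
  (r *m pairing c) 0 (enum_rank s) = c s * delta (cfg r) s.1.1 s.1.2.
Proof.
rewrite mxE /delta -!sum_val0 -sumrB mulr_sumr (reindex (@enum_rank (slot m))) /=;
    last first.
  by exists enum_val => v _; [exact: enum_rankK|exact: enum_valK].
by apply: eq_bigr => v _; rewrite mxE !enum_rankK /cfg; ring.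
Qed.

Definition tight_form z (s : test) : bool :=
  relevant z s.1.1 s.1.2 s.2 && (delta z s.1.1 s.1.2 == (s.2 : nat)%:R).

Definition tspace z := kermx (pairing (fun s => (tight_form z s)%:R)).

Lemma tangentP z w : tangent z w <-> (vec w <= tspace z)%MS.
Proof.
split=> [T|/sub_kermxP H a c k km r e].
  apply/sub_kermxP/rowP => j; rewrite -[j]enum_valK pairingE vecK mxE.
  case: (boolP (tight_form z _)) => [/andP[r /eqP e]|]; last by rewrite mul0r.
  by rewrite mul1r /delta (T _ _ _ (leq_ord _) r e) subrr.
pose s : test := (a, c, Ordinal (n := m.+1) km).
have := congr1 (fun M : 'rV[R]_#|{: test}| => M 0 (enum_rank s)) H.
have ts : tight_form z s by rewrite /tight_form /= r e eqxx.
by rewrite /= pairingE vecK mxE ts mul1r /delta => /eqP; rewrite subr_eq0 => /eqP.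
Qed.

Definition tdim z := \rank (tspace z).
Definition tbase z : 'M[R]_(tdim z, N) := row_base (tspace z).

(* The cell is cut out by the inequalities [form <= 1]; a test vanishing at [z]
   has denominator 0, hence contributes the harmless form 0. *)
Definition gauge_mx z : 'M[R]_(tdim z, #|{: test}|) := tbase z *m
  pairing (fun s => (relevant z s.1.1 s.1.2 s.2)%:R / ((s.2 : nat)%:R - delta z s.1.1
      s.1.2)).

Definition shiftc z (p : 'rV[R]_(tdim z)) : config R m := fun v => cfg (p *m tbase z) v.

Lemma shiftc_tangent z (p : 'rV_(tdim z)) : tangent z (shiftc p).
Proof.
apply/tangentP; rewrite -[shiftc p]/(cfg (p *m tbase z)) cfgK.
by rewrite (submx_trans (submxMl _ _)) // eq_row_base.
Qed.

Lemma shiftc_surj z w : tangent z w -> exists p : 'rV_(tdim z), shiftc p = w.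
Proof.
move=> /tangentP; rewrite -(eq_row_base (tspace z)) => /submxP[p e].
by exists p; rewrite /shiftc -e -[RHS]vecK.
Qed.

Lemma form_shiftc z (p : 'rV_(tdim z)) (s : test) : form_at (gauge_mx z) p s =
  (relevant z s.1.1 s.1.2 s.2)%:R / ((s.2 : nat)%:R - delta z s.1.1 s.1.2) * delta (shiftc
      p) s.1.1 s.1.2.
Proof. by rewrite /form_at /gauge_mx mulmxA pairingE. Qed.

Definition addc z w : config R m := fun v => z v + w v.

Lemma deltaD z w a c : delta (addc z w) a c = delta z a c + delta w a c.
Proof. by rewrite /delta; case: a c => [a|] [c|] /=; rewrite /addc; lra. Qed.

(** The sign of [k - x] selects which of the two weak inequalities is at stake, so one bound encodes
    both; for [x = k] the form is 0 and [y] vanishes. *)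
Lemma form_ratio_le (k x y : R) : (x = k -> y = 0) ->
  y / (k - x) <= 1 <-> (k <= x -> k <= x + y) /\ (x <= k -> x + y <= k).
Proof.
move=> H; have [lt|gt|e] := ltgtP x k; last first.
- by rewrite H // mul0r ler01; split=> // _; split; lra.
- rewrite -(opprB x k) invrN mulrN lerNl ler_pdivlMr ?subr_gt0 // mulN1r.
  by split=> [le|[l1 l2]]; [split; lra|have := l1 isT; lra].
- rewrite ler_pdivrMr ?subr_gt0 // mul1r.
  by split=> [le|[l1 l2]]; [split; lra|have := l2 isT; lra].
Qed.

Lemma form_ratio_lt (k x y : R) : (x = k -> y = 0) ->
  y / (k - x) < 1 <-> (k <= x) = (k <= x + y) /\ (x <= k) = (x + y <= k).
Proof.
move=> H; have [lt|gt|e] := ltgtP x k; last first.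
- by rewrite H // mul0r ltr01 e addr0 lexx.
- rewrite -(opprB x k) invrN mulrN ltrNl ltr_pdivlMr ?subr_gt0 // mulN1r.
  split=> [le|[/esym l1 /esym/negbT]]; last by rewrite -ltNge; lra.
  by split; apply/esym; [lra|apply/negbTE; rewrite -ltNge; lra].
- rewrite ltr_pdivrMr ?subr_gt0 // mul1r.
  split=> [le|[/esym/negbT + /esym l2]]; last by rewrite -ltNge; lra.
  by split; apply/esym; [apply/negbTE; rewrite -ltNge; lra|lra].
Qed.

Lemma closed_shiftc z (p : 'rV_(tdim z)) :
  closed_type z (addc z (shiftc p)) <-> forall s, form_at (gauge_mx z) p s <= 1.
Proof.
have T := shiftc_tangent p.
have E a c k : (k <= m)%N -> relevant z a c k -> delta z a c = k%:R -> delta (shiftc p) a c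
    = 0.
  by move=> km r e; rewrite /delta (T a c k) ?subrr.
split=> [cl s|H a c k km r].
  rewrite form_shiftc; case: (boolP (relevant _ _ _ _)) => [r|];
      last by rewrite !mul0r ler01.
  rewrite mul1r mulrC; apply/form_ratio_le; first exact: E (leq_ord _) r.
  by rewrite -deltaD; apply: cl (leq_ord _) r.
have := H (a, c, Ordinal (n := m.+1) km); rewrite form_shiftc /= r mul1r mulrC deltaD.
by move/form_ratio_le; apply; exact: E km r.
Qed.

Lemma open_shiftc z (p : 'rV_(tdim z)) :
  open_type z (addc z (shiftc p)) <-> forall s, form_at (gauge_mx z) p s < 1.
Proof.
have T := shiftc_tangent p.
have E a c k : (k <= m)%N -> relevant z a c k -> delta z a c = k%:R -> delta (shiftc p) a c
    = 0.
  by move=> km r e; rewrite /delta (T a c k) ?subrr.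
split=> [cl s|H a c k km r].
  rewrite form_shiftc; case: (boolP (relevant _ _ _ _)) => [r|];
      last by rewrite !mul0r ltr01.
  rewrite mul1r mulrC; apply/form_ratio_lt; first exact: E (leq_ord _) r.
  by rewrite -deltaD; apply: cl (leq_ord _) r.
have := H (a, c, Ordinal (n := m.+1) km); rewrite form_shiftc /= r mul1r mulrC deltaD.
by move/form_ratio_lt; apply; exact: E km r.
Qed.

Definition cell_point z (p : 'rV[R]_(tdim z)) : config R m := addc z (shiftc (radial
    (gauge_mx z) p)).

Lemma shiftc_inj z : injective (@shiftc z).
Proof.
move=> p q e; have : p *m tbase z = q *m tbase z.
  by rewrite -[LHS]cfgK -[RHS]cfgK; congr vec; exact: e.
by move/(row_free_inj (row_base_free _)).
Qed.

Section CellPoint.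
Variables (z : config R m) (h : 'I_m -> nat).
Hypothesis Nz : ctight z h.

(** Points of the closed cell have all coordinates in [0,m], so every slot moves by at most [m];
    [pinvmx] recovers the parameters linearly from these moves. *)
Lemma shiftc_bounded : exists D : R, forall p : 'rV_(tdim z),
  (forall s, form_at (gauge_mx z) p s <= 1) -> forall k, `|p 0 k| <= D.
Proof.
pose P := pinvmx (tbase z).
exists (\sum_k \sum_v m%:R * `|P v k|) => p /closed_shiftc cl k.
have -> : p = (p *m tbase z) *m P by rewrite mulmxKp // row_base_free.
have bd v : `|(p *m tbase z) 0 v| <= m%:R.
  have := closed_bounds Nz cl (enum_val v); have := tight_bounds (enum_val v) Nz.
  by rewrite /addc /shiftc /cfg enum_valK ler_norml => /andP[? ?] /andP[? ?]; apply/andP;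
      split; lra.
rewrite (bigD1 k) //= mxE; apply: le_trans (ler_norm_sum _ _ _) _.
rewrite -[leLHS]addr0; apply: lerD.
  by apply: ler_sum => v _; rewrite normrM; apply: ler_wpM2r.
by apply: sumr_ge0 => j _; apply: sumr_ge0 => v _; apply: mulr_ge0.
Qed.

Lemma continuous_cell_point v : continuous (fun p : 'rV_(tdim z) => cell_point p v).
Proof.
have [D bd] := shiftc_bounded.
have E : (fun p : 'rV_(tdim z) => cell_point p v) =
   (fun p => z v + \sum_k radial (gauge_mx z) p 0 k * tbase z k (enum_rank v)).
  by apply/funext => p; rewrite /cell_point /addc /shiftc /cfg mxE.
rewrite E => p; apply: continuousD; first exact: cst_continuous.
apply: continuous_sum => k {}p; apply: continuousM; last exact: cst_continuous.
exact: (continuous_radial bd).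
Qed.

Lemma cell_point_closed (p : 'rV_(tdim z)) : closed_type z (cell_point p) <-> enorm p <= 1.
Proof.
have [D bd] := shiftc_bounded.
by rewrite /cell_point closed_shiftc -(gauge_le _ _ ler01) (gauge_radial bd).
Qed.

Lemma cell_point_open (p : 'rV_(tdim z)) : open_type z (cell_point p) <-> enorm p < 1.
Proof.
have [D bd] := shiftc_bounded.
by rewrite /cell_point open_shiftc -(gauge_lt _ _ ltr01) (gauge_radial bd).
Qed.

Lemma cell_point_surj z' : closed_type z z' -> exists p : 'rV_(tdim z), cell_point p = z'.
Proof.
have [D bd] := shiftc_bounded.
move=> /tangent_closed_sub /shiftc_surj[q eq]; have [p ep] := radial_surj bd q.
exists p; rewrite /cell_point ep eq; apply/funext => v; rewrite /addc; lra.
Qed.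

Lemma cell_point_inj : injective (@cell_point z).
Proof.
have [D bd] := shiftc_bounded.
move=> p q e; apply: (radial_inj bd); apply: shiftc_inj; apply/funext => v.
by apply: (addrI (z v)); have := congr1 (fun f => f v) e.
Qed.

End CellPoint.
End TangentSpace.

(** * The space of overlapping intervals *)

Local Open Scope classical_set_scope.
Local Open Scope ring_scope.

Section Classes.
Variables (R : realType) (m : nat).
Implicit Types y : ovraw R m.

Lemma ov_rel_refl y : ov_rel y y. Proof. by []. Qed.

Lemma ov_rel_sym y y' : ov_rel y y' -> ov_rel y' y.
Proof.
by move=> [e H]; split=> // i j; rewrite -e => M; have := H _ _ M; tauto.
Qed.

Lemma ov_rel_trans y y' y'' : ov_rel y y' -> ov_rel y' y'' -> ov_rel y y''.
Proof.
move=> [e H] [e' H']; split; first by rewrite e.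
by move=> i j M; have := H _ _ M; rewrite e in M; have := H' _ _ M; tauto.
Qed.

Lemma cls_eq y y' : ov_rel y y' -> cls y = cls y'.
Proof.
move=> r; apply/seteqP; split=> u [v r']; split=> //.
  by apply: ov_rel_trans r'; apply: ov_rel_sym.
by apply: ov_rel_trans r'.
Qed.

Lemma cls_rel y y' : ov_valid y' -> cls y = cls y' -> ov_rel y y'.
Proof.
move=> v e; have : cls y y' by rewrite e; exact: (conj v (ov_rel_refl y')).
by case.
Qed.

Lemma ov_rel_heights y y' : ov_rel y y' -> forall i j, int_meet (y.1 i) (y.1 j) ->
  (height y.2 i < height y.2 j)%N = (height y'.2 i < height y'.2 j)%N.
Proof. by move=> [_ H] i j M; have := H _ _ M; case=> H1 H2; apply/idP/idP. Qed.

Lemma finite_margin (I : finType) (a : I -> R) (del : R) : (forall i, a i < del) ->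
  exists2 e, 0 < e & forall i, a i + e <= del.
Proof.
move=> H; have lt : del - 1 < del by lra.
have [t [t1 t2 t3]] := gap_below a lt.
by exists (del - t); [lra|move=> i; have := t3 i (H i); lra].
Qed.

Definition close (L L' : 'I_m -> R * R) (e : R) :=
  forall i, `|(L' i).1 - (L i).1| < e /\ `|(L' i).2 - (L i).2| < e.

Lemma close_margin L L' del : close L L' del -> exists2 e, 0 < e & forall L'', close L' L''
    e -> close L L'' del.
Proof.
move=> H; pose a (i : 'I_m) := Num.max `|(L' i).1 - (L i).1| `|(L' i).2 - (L i).2|.
have [|e e0 He] := @finite_margin _ a del.
  by move=> i; have [h1 h2] := H i; rewrite /a gt_max h1 h2.
exists e => // L'' C i; have [c1 c2] := C i; have := He i; rewrite /a => le.
have m1 : `|(L' i).1 - (L i).1| <= Num.max `|(L' i).1 - (L i).1| `|(L' i).2 - (L i).2| by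
    rewrite le_max lexx.
have m2 : `|(L' i).2 - (L i).2| <= Num.max `|(L' i).1 - (L i).1| `|(L' i).2 - (L i).2| by
    rewrite le_max lexx orbT.
split; [have := ler_distD (L' i).1 (L'' i).1 (L i).1|have := ler_distD (L' i).2 (L'' i).2
    (L i).2]; lra.
Qed.

Lemma close_refl L e : 0 < e -> close L L e.
Proof. by move=> e0 i; rewrite !subrr normr0. Qed.

Lemma meet_margin (L : 'I_m -> R * R) : exists2 e, 0 < e & forall L', close L L' e ->
  forall i j, int_meet (L i) (L j) -> int_meet (L' i) (L' j).
Proof.
(* Pairs that fail the strict inequality get -1, so that all values lie below 0 and a common margin
   exists. *)
pose a (p : 'I_m * 'I_m) := if `[< (L p.1).1 < (L p.2).2 >] then (L p.1).1 - (L p.2).2 else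
    -1.
have [|e e0 He] := @finite_margin _ a 0.
  by move=> p; rewrite /a; case: ifP => [/asboolP|_]; lra.
exists (e / 2) => [|L' C i j [l1 l2]]; first lra.
have [] := C i; have [] := C j;
    rewrite !ltr_norml => /andP[? ?] /andP[? ?] /andP[? ?] /andP[? ?].
have := He (i, j); have := He (j, i); rewrite /a /= !asboolT // => ? ?.
by split; lra.
Qed.

(** Different intervals are separated by distance. Equal intervals with different classes are
    separated by the order on overlaps, which survives small motions because overlaps do. *)
Lemma hausdorff_valid (A : set (ovpt R m)) :
  (forall x, A x -> exists2 y, ov_valid y & x = cls y) -> hausdorff_sub A.
Proof.
move=> HA x x' /HA[y vy ->] /HA[y' vy' ->] nxx.
(* Basic neighbourhoods: intervals near those of [u], with the order of [u] on the overlaps of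
   [u]. *)
pose U u e := [set c | exists u' : ovraw R m, [/\ ov_valid u', c = cls u', close u.1 u'.1 e
    &
  forall i j, int_meet (u.1 i) (u.1 j) -> (height u'.2 i < height u'.2 j)%N = (height u.2 i
      < height u.2 j)%N]].
have [e1 e10 M1] := meet_margin y.1; have [e2 e20 M2] := meet_margin y'.1.
have oU u e e' : (forall L', close u.1 L' e' -> forall i j, int_meet (u.1 i) (u.1 j) ->
    int_meet (L' i) (L' j)) ->
    e <= e' -> ov_open (U u e).
  move=> M le v vv [u' [vu' /(cls_rel vu') r C H]].
  have [ev _] := r; rewrite -ev in C.
  have [d d0 Hd] := close_margin C; exists d => // L' vL' CL'.
  exists (L', v.2); split=> //; first exact: Hd.
  move=> i j Mij; rewrite -H //; apply: (ov_rel_heights r); apply: M Mij.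
  by move=> k; have [? ?] := C k; split; lra.
have self u e : ov_valid u -> 0 < e -> U u e (cls u).
  by move=> vu e0; exists u; split=> //; apply: close_refl.
have [e3 e30 H3] : exists2 e, 0 < e & y.1 <> y'.1 -> forall L, close y.1 L e -> ~ close
    y'.1 L e.
  have [->|ne] := pselect (y.1 = y'.1); first by exists 1.
  have [i ni] : exists i, y.1 i <> y'.1 i.
    by apply/existsNP => H; apply: ne; apply/funext.
  pose t := Num.max `|(y.1 i).1 - (y'.1 i).1| `|(y.1 i).2 - (y'.1 i).2|.
  have t0 : 0 < t.
    rewrite /t lt_max !normr_gt0 !subr_eq0; apply/negPn/negP; rewrite negb_or !negbK.
    by case: (y.1 i) (y'.1 i) ni => [a b] [c d] /= ni /andP[/eqP ? /eqP ?]; apply: ni;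
        subst.
  exists (t / 2) => [|_ L C C']; first lra.
  have [c1 c2] := C i; have [c1' c2'] := C' i.
  have : t < t; last by rewrite ltxx.
  rewrite {1}/t gt_max; apply/andP; split.
    by have := ler_distD (L i).1 (y.1 i).1 (y'.1 i).1; rewrite (distrC (y.1 i).1 (L i).1);
        lra.
  by have := ler_distD (L i).2 (y.1 i).2 (y'.1 i).2; rewrite (distrC (y.1 i).2 (L i).2);
      lra.
pose e := Num.min e3 (Num.min e1 e2).
have e0 : 0 < e by rewrite /e !lt_min e30 e10.
have le1 : e <= e1 by rewrite /e !ge_min lexx !orbT.
have le2 : e <= e2 by rewrite /e !ge_min lexx !orbT.
have le3 : e <= e3 by rewrite /e !ge_min lexx.
exists (U y e), (U y' e); split.
- exact: oU M1 le1.
- exact: oU M2 le2.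
- exact: self.
- exact: self.
- apply/seteqP; split=> // c [[[u [vu -> C H]] [u' [vu' e' C' H']]] _].
  have r := cls_rel vu' e'; have eu := r.1.
  have [ey|ney] := pselect (y.1 = y'.1); last first.
    apply: (H3 ney u.1); first by move=> k; have [? ?] := C k; split; lra.
    by rewrite eu => k; have [? ?] := C' k; split; lra.
  apply: nxx; apply: cls_eq; split=> // i j Mij.
  have Mu : int_meet (u.1 i) (u.1 j).
    by apply: M1 Mij => k; have [? ?] := C k; split; lra.
  rewrite -H // (ov_rel_heights r Mu) H' //; by rewrite -ey.
Qed.

Lemma continuous_coord (d : nat) (f : 'rV[R]_d -> R) (p : 'rV[R]_d) (e : R) : continuous f
    -> 0 < e ->
  exists2 del, 0 < del & forall q : 'rV[R]_d, (forall k, `|q 0 k - p 0 k| < del) -> `|f q -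
      f p| < e.
Proof.
move=> cf e0; have := iffLR (@cvgrPdist_lt _ _ _ _ (nbhs_filter p) _ _) (cf p) _ e0.
move=> /nbhs_ballP[del /= del0 H]; exists del => // q Hq; rewrite distrC; apply: H.
by rewrite mx_norm_ball; apply: mx_norm_lt => // k; rewrite !mxE distrC.
Qed.

End Classes.

(** * Characteristic maps of the cells *)

Section Cells.
Variables (R : realType) (m : nat).
Hypothesis m0 : (0 < m)%N.
Implicit Types z w : config R m.

Definition lpair z : 'I_m -> R * R := fun i => (unscale m (cX z i), unscale m (cY z i)).

Lemma tm_gt0 : 0 < tm R m. Proof. by rewrite /tm divr_gt0 ?ltr0n. Qed.

Lemma unscale_lt x y : (unscale m x < unscale m y) = (x < y :> R).
Proof. by rewrite /unscale ltrD2l ltr_pM2l ?tm_gt0. Qed.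

Lemma unscale_dist x y : `|unscale m x - unscale m y| = tm R m * `|x - y|.
Proof. by rewrite /unscale opprD addrACA subrr add0r -mulrBr normrM gtr0_norm ?tm_gt0. Qed.

Lemma unscale0 : unscale m 0 = -1 :> R. Proof. by rewrite /unscale mulr0 addr0. Qed.
Lemma unscalem : unscale m m%:R = 1 :> R.
Proof.
rewrite /unscale /tm; have : m%:R != 0 :> R by rewrite pnatr_eq0 -lt0n.
by move=> ?; field.
Qed.

Lemma unscale_le x y : (unscale m x <= unscale m y) = (x <= y :> R).
Proof. by rewrite !leNgt unscale_lt. Qed.

Lemma lpair_meet z i j : int_meet (lpair z i) (lpair z j) <-> (cX z i < cY z j /\ cX z j <
    cY z i).
Proof. by rewrite /int_meet /= !unscale_lt. Qed.

Lemma lpair_valid z h (s : 'S_m) : claminar z h -> ov_valid (lpair z, s).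
Proof.
move=> W i; rewrite /little /= -unscale0 -unscalem !unscale_le unscale_lt.
have := lam_X0 W i; have := lam_Ym W i; have := lam_left W i; have := lam_right W i.
have := lam_lt W i; by split; [|split]; lra.
Qed.

Lemma lpair_inj z z' : lpair z = lpair z' -> (forall i, cX z i = cX z' i) /\ (forall i, cY
    z i = cY z' i).
Proof.
move=> e; split=> i; have := congr1 (fun f => f i) e; rewrite /lpair => -[e1 e2].
  by apply: (can_inj (unscaleK m0)).
by apply: (can_inj (unscaleK m0)).
Qed.

Definition cell_of z (s : 'S_m) : cell R m :=
  @Cell R m (tdim z) (fun p => cls (lpair (cell_point (\row_k p k : 'rV_(tdim z))), s)).

Section OneCell.
Variables (z : config R m) (s : 'S_m).
Hypothesis Nz : ctight z (height s).
Local Notation psi p := (cell_point (\row_k p k : 'rV_(tdim z))).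

Lemma enorm_le1 d (p : 'I_d -> R) : enorm (\row_k p k) <= 1 <-> sqn p <= 1.
Proof.
have -> : sqn p = enorm (\row_k p k) ^+ 2.
  rewrite /enorm sqr_sqrtr ?sumsq_ge0 //; by apply: eq_bigr => k _; rewrite mxE.
by rewrite -{2}(expr1n R 2) ler_sqr ?nnegrE ?enorm_ge0 ?ler01.
Qed.

Lemma enorm_lt1 d (p : 'I_d -> R) : enorm (\row_k p k) < 1 <-> sqn p < 1.
Proof.
have -> : sqn p = enorm (\row_k p k) ^+ 2.
  rewrite /enorm sqr_sqrtr ?sumsq_ge0 //; by apply: eq_bigr => k _; rewrite mxE.
by rewrite -{2}(expr1n R 2) ltr_sqr ?nnegrE ?enorm_ge0 ?ler01.
Qed.

Lemma row_fun d (v : 'rV[R]_d) : \row_k v 0 k = v.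
Proof. by apply/rowP => k; rewrite mxE. Qed.

Lemma cell_valid (p : 'I_(tdim z) -> R) (s' : 'S_m) : sqn p <= 1 -> ov_valid (lpair (psi
    p), s').
Proof.
move=> /enorm_le1 /(cell_point_closed Nz) cl; exact: (lpair_valid _ (closed_laminar Nz cl)).
Qed.

Lemma cell_lpair_inj (p q : 'rV_(tdim z)) : enorm p <= 1 -> enorm q <= 1 ->
  lpair (cell_point p) = lpair (cell_point q) -> p = q.
Proof.
move=> /(cell_point_closed Nz) c1 /(cell_point_closed Nz) c2 /lpair_inj[eX eY].
exact: (cell_point_inj Nz (closed_inj Nz c1 c2 eX eY)).
Qed.

Lemma cell_continuous (p : 'rV_(tdim z)) e : 0 < e ->
  exists2 del, 0 < del & forall q : 'rV_(tdim z), (forall k, `|q 0 k - p 0 k| < del) ->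
    close (lpair (cell_point p)) (lpair (cell_point q)) e.
Proof.
move=> e0; pose F (q : 'rV_(tdim z)) := \sum_(v : slot m) `|cell_point q v - cell_point p
    v|.
have cF : continuous F.
  apply: continuous_sum => v x.
  apply: (@continuous_comp _ _ _ (fun q => cell_point q v - cell_point p v) Num.norm);
      last exact: norm_continuous.
  by apply: continuousB; [exact: (continuous_cell_point Nz)|exact: cst_continuous].
have et : 0 < e / tm R m by rewrite divr_gt0 ?tm_gt0.
have [del del0 H] := continuous_coord p cF et; exists del => // q /H.
have -> : F p = 0 by rewrite /F big1 // => v _; rewrite subrr normr0.
rewrite subr0 ger0_norm ?sumr_ge0 // ltr_pdivlMr ?tm_gt0 // => lt.
have K v : tm R m * `|cell_point q v - cell_point p v| < e.
  apply: le_lt_trans lt; rewrite mulrC ler_pM2r ?tm_gt0 //.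
  by rewrite /F (bigD1 v) //= lerDl sumr_ge0.
move=> i; rewrite /lpair /= !unscale_dist; split; first exact: (K (false, false, i)).
exact: (K (false, true, i)).
Qed.

Lemma cell_char : char_homeo (cell_of z s).
Proof.
split=> /=.
- move=> U oU p bp Up; have [e e0 He] := oU _ (cell_valid s bp) Up.
  have [del del0 H] := cell_continuous (\row_k p k) e0.
  exists del => // q bq Hq; apply: He; first exact: cell_valid.
  by apply: H => k; rewrite !mxE.
- move=> p q; rewrite !inE => bp bq /(cls_rel (cell_valid s bq))[/= e _].
  have := cell_lpair_inj _ _ e; rewrite !enorm_le1 => /(_ bp bq) E.
  by apply/funext => k; have := congr1 (fun v : 'rV_(tdim z) => v 0 k) E; rewrite !mxE.
move=> O [Osub Oopen].
(* [del] is small enough at [p] if all points of the ball whose intervals are [del]-close to those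
   of [p] lie in [O]; the open set is then a union of such neighbourhoods. *)
pose near p del := 0 < del /\ forall q, sqn q <= 1 -> close (lpair (psi p)) (lpair (psi q))
    del -> O q.
exists [set c | exists u : ovraw R m, [/\ ov_valid u, c = cls u &
  exists p del, [/\ O p, near p del & close (lpair (psi p)) u.1 del]]].
  move=> v vv [u [vu /(cls_rel vu) [evu _] [p [del [Op np C]]]]].
  rewrite -evu in C; have [e e0 He] := close_margin C; exists e => // L' vL' CL'.
  exists (L', v.2); split=> //; exists p, del; split=> //; exact: He.
apply/seteqP; split=> [c [p Op <-]|c [[u [vu -> [p [del [Op np C]]]]] [q bq e]]].
  have bp := Osub _ Op; split; last by exists p.
  exists (lpair (psi p), s); split=> //; first exact: cell_valid.
  suff [del np] : exists del, near p del.
    by exists p, del; split=> //; apply: close_refl; case: np.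
  have [e e0 He] := Oopen _ Op.
  (* Only the slots of the intervals are used, since a class remembers its intervals and not its
     cores. *)
  pose f (j : bool * 'I_m) (q : 'rV_(tdim z)) := cell_point q (false, j.1, j.2).
  have cf j : continuous (f j) by exact: (continuous_cell_point Nz).
  have fi (p' q' : 'rV_(tdim z)) : enorm p' <= 1 -> enorm q' <= 1 -> (forall j, f j p' = f
      j q') -> p' = q'.
    move=> b1 b2 E; apply: cell_lpair_inj => //; apply/funext => i.
    by rewrite /lpair; congr (unscale _ _, unscale _ _);
        [exact: (E (false, i))|exact: (E (true, i))].
  have bp' : enorm (\row_k p k) <= 1 by apply/enorm_le1.
  have [del del0 H] := compact_inverse cf fi bp' e0.
  exists (tm R m * del); split; first by rewrite mulr_gt0 ?tm_gt0.
  move=> q bq C; apply: He => // k.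
  have := H (\row_k q k); rewrite enorm_le1 => /(_ bq) H'.
  have := H' _ k; rewrite !mxE; apply=> -[b i]; have [] := C i.
  rewrite /lpair /= !unscale_dist !ltr_pM2l ?tm_gt0 // => c1 c2.
  by case: b; [exact: c2|exact: c1].
have [E _] := cls_rel vu e; exists q => //; case: np => _; apply=> //.
by rewrite /= in E; rewrite E.
Qed.

Lemma open_cellE x : open_cell (cell_of z s) x <-> exists2 z', open_type z z' & x = cls
    (lpair z', s).
Proof.
split=> [[p bp <-]|[z' o ->]].
  by exists (psi p) => //; apply/(cell_point_open Nz)/enorm_lt1.
have [p ep] := cell_point_surj Nz (open_closed o).
exists (fun k => p 0 k) => /=; last by rewrite row_fun ep.
by apply/enorm_lt1; rewrite row_fun; apply/(cell_point_open Nz); rewrite ep.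
Qed.

Lemma sphere_cell p : sphere (R:=R) (d:=tdim z) p -> exists z',
  [/\ closed_type z z', ~ open_type z z' & cmap (c:=cell_of z s) p = cls (lpair z', s)].
Proof.
rewrite /sphere /= => e; exists (psi p); split=> //.
  by apply/(cell_point_closed Nz)/enorm_le1; rewrite e.
by move=> /(cell_point_open Nz)/enorm_lt1; rewrite e ltxx.
Qed.

Lemma closed_cellE x : closed_cell (cell_of z s) x -> open_cell (cell_of z s) x \/
  exists2 p, sphere (R:=R) (d:=tdim z) p & x = cmap (c:=cell_of z s) p.
Proof.
move=> [p bp <-]; have [lt|ge] := ltP (sqn p) 1; first by left; exists p.
by right; exists p => //; apply/eqP; rewrite eq_le ge andbT; exact: bp.
Qed.

End OneCell.
End Cells.

(** * The cell structure *)

Section Structure.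
Variables (R : realType) (m : nat).
Hypothesis m0 : (0 < m)%N.
Implicit Types (z w : config R m) (s : 'S_m).

(** The second clause keeps the whole closed cell inside [Ov1], so that no tree has to be carried
    along from here on. *)
Definition normal_point z s :=
  ctight z (height s) /\ forall z', closed_type z z' -> Ov1 (cls (lpair z', s)).

Lemma normal_point_ex x : Ov1 x -> exists z s, normal_point z s /\ x = cls (lpair z, s).
Proof.
move=> [T [s [L [TT CO vL /(ov1_condP _ _ m0 TT)[xb [yb W]] ->]]]].
have WL := wit_laminar m0 TT CO W.
have [b [g [Wn Sn rf]]] := normal_form WL.
pose z0 : config R m := fun p => if p.1.2 then scale m (L p.2).2 else scale m (L p.2).1.
pose z := renorm z0 b g.
have N : ctight z (height s) by [].
exists z, s; split; last first.
  congr (cls (_, _)); apply/funext => i; rewrite /lpair /= !scaleK //.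
  by case: (L i).
split=> // z' cl; exists T, s, (lpair z'); split=> //.
  exact: (lpair_valid m0 _ (closed_laminar N cl)).
exact: (transport m0 TT W (z := z)).
Qed.

(** Heights are recorded only for overlaps within a frame; by [tight_order] they determine those on
    all other overlaps. *)
Definition okey z s : {set test m} * {set test m} * {set 'I_m * 'I_m} :=
  (ckey z, [set p | [&& cconn z p.1 p.2, cX z p.1 < cY z p.2, cX z p.2 < cY z p.1 &
     (height s p.1 < height s p.2)%N]]%SET).

Lemma tight_heights z s s' : ctight z (height s) -> ctight z (height s') ->
  (okey z s).2 = (okey z s').2 -> cls (lpair z, s) = cls (lpair z, s').
Proof.
move=> N N' /setP K; apply: cls_eq; split=> // i j /= /(lpair_meet m0)[l1 l2].
suff -> : (height s i < height s j)%N = (height s' i < height s' j)%N by [].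
apply: (tight_order N N') l1 l2 => {}i {}j c l1 l2.
by have := K (i, j); rewrite !inE /= /cconn c l1 l2.
Qed.

Lemma cls_tight_unique z z' s s' : ctight z (height s) -> ctight z' (height s') ->
  cls (lpair z, s) = cls (lpair z', s') ->
  z = z' /\ forall i j, cX z i < cY z j -> cX z j < cY z i ->
    (height s i < height s j)%N = (height s' i < height s' j)%N.
Proof.
move=> N N' /(cls_rel (lpair_valid m0 s' N'.1)) r.
have [/= eX eY] := lpair_inj m0 r.1.
have H i j : cX z i < cY z j -> cX z j < cY z i ->
    (height s i < height s j)%N = (height s' i < height s' j)%N.
  by move=> l1 l2; apply: (ov_rel_heights r); apply/(lpair_meet m0).
split=> //.
have X' : cX z' = cX z by apply/funext.
have Y' : cY z' = cY z by apply/funext.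
move: N'; rewrite /ctight X' Y' => N'.
have [eb eg] := tight_unique N N' H.
apply/funext => [[[[] []] i]].
- exact: (congr1 (fun f => f i) eg).
- exact: (congr1 (fun f => f i) eb).
- exact: eY.
- exact: eX.
Qed.

Lemma okey_eq z s s' : ctight z (height s) -> ctight z (height s') ->
  (forall i j, cX z i < cY z j -> cX z j < cY z i ->
    (height s i < height s j)%N = (height s' i < height s' j)%N) ->
  okey z s = okey z s'.
Proof.
move=> N N' H; rewrite /okey; congr (_, _); apply/setP => -[i j]; rewrite !inE /=.
by case: (cconn z i j) => //=; case: ltP => //= l1; case: ltP => //= l2; rewrite H.
Qed.

Lemma open_okey z z' s : open_type z z' -> okey z s = okey z' s.
Proof.
move=> o; rewrite /okey (open_ckey o); congr (_, _); apply/setP => -[i j]; rewrite !inE /=.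
rewrite -(open_conn o); case: (boolP (cconn z i j)) => //= c.
have lt i' j' : cconn z i' j' -> (cX z i' < cY z j') = (cX z' i' < cY z' j').
  move=> c'; rewrite !ltNge; congr negb.
  have r : relevant z (Some (false, true, j')) (Some (false, false, i')) 0.
    have cs : cconn z j' i' by rewrite /cconn conn_sym.
    by rewrite /= cs.
  by have [_] := o _ _ _ (leq0n m) r; rewrite /delta /= !subr_le0.
have cs : cconn z j i by rewrite /cconn conn_sym.
by rewrite !lt.
Qed.

Definition is_key (k : {set test m} * {set test m} * {set 'I_m * 'I_m}) : bool :=
  `[< exists p : config R m * 'S_m, normal_point p.1 p.2 /\ okey p.1 p.2 = k >].

Definition cell_index := {k | is_key k}.

Lemma index_rep (k : cell_index) : exists p : config R m * 'S_m,
  normal_point p.1 p.2 /\ okey p.1 p.2 = val k.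
Proof. by have /asboolP := valP k. Qed.

Definition rep k : config R m * 'S_m := projT1 (cid (index_rep k)).

Lemma rep_normal k : normal_point (rep k).1 (rep k).2.
Proof. by case: (projT2 (cid (index_rep k))). Qed.

Lemma rep_key k : okey (rep k).1 (rep k).2 = val k.
Proof. by case: (projT2 (cid (index_rep k))). Qed.

Definition ov_cell k : cell R m := cell_of (rep k).1 (rep k).2.

(** The representative may carry another permutation than [s], but with equal keys both define the
    same class on the intervals of [z]. *)
Lemma point_index z s : normal_point z s -> exists k,
  open_type (rep k).1 z /\ cls (lpair z, s) = cls (lpair z, (rep k).2).
Proof.
move=> N; have ik : is_key (okey z s) by apply/asboolP; exists (z, s).
exists (Sub (okey z s) ik); set k : cell_index := Sub _ _.
have e : okey (rep k).1 (rep k).2 = okey z s by rewrite rep_key.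
have o : open_type (rep k).1 z by apply: ckey_open; have := congr1 fst e.
split=> //; apply: tight_heights; first exact: N.1.
  exact: (open_tight (rep_normal k).1 o).
by rewrite -e (open_okey _ o).
Qed.

Lemma ov_cell_cover x : Ov1 x <-> exists k, open_cell (ov_cell k) x.
Proof.
split=> [/normal_point_ex[z [s [N ->]]]|[k]].
  have [k [op e]] := point_index N; exists k.
  by apply/(open_cellE (rep_normal k).1); exists z.
move=> /(open_cellE (rep_normal k).1)[z o ->].
by apply: (rep_normal k).2; apply: open_closed.
Qed.

Lemma ov_cell_disj k l x : open_cell (ov_cell k) x -> open_cell (ov_cell l) x -> k = l.
Proof.
move=> /(open_cellE (rep_normal k).1)[z o ->] /(open_cellE (rep_normal l).1)[z' o'].
have N := open_tight (rep_normal k).1 o; have N' := open_tight (rep_normal l).1 o'.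
move=> /(cls_tight_unique N N')[e H]; rewrite -e in N' o'.
apply: val_inj; rewrite -!rep_key (open_okey _ o) (open_okey _ o').
exact: okey_eq.
Qed.

Lemma tdim_open z z' : open_type z z' -> tdim z = tdim z'.
Proof.
move=> o; apply: eqmx_rank; apply/andP; split; apply/rV_subP => v;
  rewrite -[v]cfgK => /tangentP T; apply/tangentP.
  exact: tangent_open T.
exact: (tangent_open (open_sym o)).
Qed.

Lemma tdim_lt z z' : (forall w, tangent z' w -> tangent z w) ->
  (exists2 w, tangent z w & ~ tangent z' w) -> (tdim z' < tdim z)%N.
Proof.
move=> H [w T nT]; have : (tspace z' < tspace z)%MS.
  rewrite ltmxE; apply/andP; split; last by apply/negP => le; apply: nT; apply/tangentP;
    apply: submx_trans le; apply/tangentP.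
  by apply/rV_subP => v; rewrite -[v]cfgK => /tangentP T'; apply/tangentP/H.
by rewrite ltmxErank => /andP[].
Qed.

(** The cell [l] comes from the covering property alone. Uniqueness of tight cores identifies its
    point with the normal form of [z'], whose tangent space is strictly smaller. *)
Lemma ov_cell_boundary k p : sphere (R:=R) (d:=cdim (ov_cell k)) p -> exists l,
  (cdim (ov_cell l) < cdim (ov_cell k))%N /\ open_cell (ov_cell l) (cmap (c:=ov_cell k) p).
Proof.
have [N O] := rep_normal k.
move=> /(sphere_cell N)[z' [cl no ->]].
have /ov_cell_cover[l Hl] := O _ cl; exists l; split=> //.
have [z1 o1 e1] := iffLR (open_cellE (rep_normal l).1 _) Hl.
have N1 := open_tight (rep_normal l).1 o1.
have [b [g [Wn Sn rf]]] := normal_form (closed_laminar N cl).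
have N2 : ctight (renorm z' b g) (height (rep k).2) by [].
have [e _] := cls_tight_unique N2 N1 e1.
rewrite /= (tdim_open o1) -e; apply: tdim_lt.
  by move=> w; apply: (tangent_boundary cl N2 rf).
exact: (tangent_boundary_lt cl N2 rf).
Qed.

Lemma ov_regular_cw : regular_cw (@Ov1 R m) ov_cell.
Proof.
split.
- apply: hausdorff_valid => x /normal_point_ex[z [s [N ->]]].
  by exists (lpair z, s) => //; apply: (lpair_valid m0 _ N.1.1).
- move=> k; exact: (cell_char m0 (rep_normal k).1).
- exact: ov_cell_cover.
- move=> k l nkl; apply/seteqP; split=> // x [h1 h2]; apply: nkl; exact: ov_cell_disj h1 h2.
- exact: ov_cell_boundary.
Qed.

End Structure.

(** * Cacti and Kaufmann's dimension *)

Section Heights.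
Variables (R : realType) (m : nat).
Implicit Types (b g X Y : 'I_m -> R) (h : 'I_m -> nat).

(** Cellularity speaks of every representative of a class; heights enter [tight] only through
    overlapping intervals, on which representatives agree. *)
Lemma tight_change b g X Y h h' : tight b g X Y h ->
  (forall i j, X i < Y j -> X j < Y i -> (h i < h j)%N = (h' i < h' j)%N) ->
  tight b g X Y h'.
Proof.
move=> [W S] H; split=> //.
have [w1 w2 w3 w4 w5 w6 w7 w8] := W; split=> //.
- move=> i j nij s; rewrite -H; first exact: w5.
    by move: s => /andP[]; have := w6 i; have := w7 j; have := lam_lt W j; lra.
  by move: s => /andP[]; have := w6 j; have := w7 i; have := lam_lt W j; lra.
- move=> i t t1 t2 nt; have [k [tk dk hk]] := w8 _ _ t1 t2 nt.
  exists k; split=> //; rewrite -H //; move: tk => /andP[]; have := w6 k; have := w7 k; lra.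
Qed.

(** Covers non-generic positions as well. If [u] were outside the core of [i], a test point between
    them would lie under a higher core, and its position is chosen so that this core reaches back to
    [u]. *)
Lemma highest_core b g X Y h i u : laminar b g X Y h -> X i <= u <= Y i ->
  (forall j, X j <= u <= Y j -> (h j <= h i)%N) ->
  b i <= u <= g i /\ forall k, k != i -> inside b g k i -> ~ b k < u < g k.
Proof.
move=> W /andP[u1 u2] high.
have K k : b k <= u <= g k -> (h i < h k)%N -> False.
  move=> /andP[k1 k2]; rewrite ltnNge => /negP; apply; apply: high.
  by have := lam_left W k; have := lam_right W k; move=> ? ?; apply/andP; split; lra.
split.
  apply/andP; split; rewrite leNgt; apply/negP => lt.
    have [t [t1 t2 t3]] := gap_above b lt; have gi := lam_lt W i; have Yi := lam_right W i.
    have [|||k [/andP[k1 k2] _ hk]] := lam_cover W (i := i) (t := t); try lra.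
    apply: K hk; apply/andP; split; last lra.
    by rewrite leNgt; apply/negP => /t3; lra.
  have [t [t1 t2 t3]] := gap_below g lt; have gi := lam_lt W i; have Xi := lam_left W i.
  have [|||k [/andP[k1 k2] _ hk]] := lam_cover W (i := i) (t := t); try lra.
  apply: K hk; apply/andP; split; first lra.
  by rewrite leNgt; apply/negP => /t3; lra.
move=> k nki s /andP[k1 k2]; apply: (K k); first by apply/andP; split; lra.
by apply: (lam_height W) s; rewrite eq_sym.
Qed.

End Heights.

(** * Lobes of the cactus in terms of cores *)

Section Cactus.
Variables (R : realType) (m : nat).
Hypothesis m0 : (0 < m)%N.
Variables (z : config R m) (y : ovraw R m).
Hypothesis N : ctight z (height y.2).
Hypothesis yz : y.1 = lpair z.
Local Notation b := (cb z).
Local Notation g := (cg z).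
Local Notation X := (cX z).
Local Notation Y := (cY z).
Local Notation h := (height y.2).
Local Notation ins := (inside b g).

(** Closed counterpart of [core]: only the open interiors of nested cores are removed, so the
    closure in the definition of [pm] stays inside. *)
Definition ccore (i : 'I_m) (u : R) :=
  b i <= u <= g i /\ forall k, k != i -> ins k i -> ~ b k < u < g k.

Let S (i : 'I_m) : set R := [set s : R | -1 <= s <= 1 /\ (y.1 i).1 <= s <= (y.1 i).2 /\
     forall j, (y.1 j).1 <= s <= (y.1 j).2 -> (h j <= h i)%N].

Lemma SE i s : S i s <-> X i <= scale m s <= Y i /\ forall j, X j <= scale m s <= Y j -> (h
    j <= h i)%N.
Proof.
have E j : ((y.1 j).1 <= s <= (y.1 j).2) = (X j <= scale m s <= Y j).
  by rewrite yz /lpair /= -{1 2}(scaleK m0 s) !(unscale_le m0).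
split=> [[_ [H1 H2]]|[H1 H2]]; first by rewrite -E; split=> // j; rewrite -E; apply: H2.
split; last by rewrite E; split=> // j; rewrite E; apply: H2.
have := lam_X0 N.1 i; have := lam_Ym N.1 i; move: H1 => /andP[] ? ? ? ?.
by rewrite -{1 2}(scaleK m0 s) -(unscale0 R m) -(unscalem R m0) !(unscale_le m0);
    apply/andP; split; lra.
Qed.

Lemma scale_cts : continuous (scale m : R -> R).
Proof.
move=> x; apply: (@continuousM _ _ (fun x : R => x + 1) (fun=> m%:R / 2));
    last exact: cst_continuous.
by apply: continuousD; [exact: cvg_id|exact: cst_continuous].
Qed.

Lemma closed_ccore i : closed [set s | ccore i (scale m s)].
Proof.
have -> : [set s | ccore i (scale m s)] = scale m @^-1` [set` `[b i, g i]] `&`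
    \bigcap_(k in [set k | k != i /\ ins k i]) (scale m @^-1` (~` [set` `]b k, g k[])).
  apply/seteqP; split=> s /=; rewrite /ccore in_itv /=.
    by move=> [-> H]; split=> // k [nki ki]; rewrite /= in_itv /=; apply: H.
  by move=> [-> H]; split=> // k nki ki; have := H k (conj nki ki); rewrite /= in_itv.
apply: closedI.
  by apply: preimage_closed => [x _|]; [exact: scale_cts|exact: interval_closed].
apply: closed_bigI => k _; apply: preimage_closed => [x _|]; first exact: scale_cts.
by apply: open_closedC; exact: interval_open.
Qed.

Lemma S_ccore i s : closure (S i) s -> ccore i (scale m s).
Proof.
suff H : closure (S i) `<=` [set s | ccore i (scale m s)] by move/H.
rewrite (closure_id [set s | ccore i (scale m s)]).1; last exact: closed_ccore.
by apply: closureS => {}s /SE[H1 H2]; exact: highest_core N.1 H1 H2.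
Qed.

Lemma to_circleE u : to_circle (unscale m u) = if u == m%:R then 0 else u / m%:R :> R.
Proof.
have E : (unscale m u == 1 :> R) = (u == m%:R).
  by rewrite -{1}(unscalem R m0) (inj_eq (can_inj (unscaleK m0))).
rewrite /to_circle E; case: eqP => // _.
rewrite /unscale /tm; have : m%:R != 0 :> R by rewrite pnatr_eq0 -lt0n.
by move=> ?; field.
Qed.

Lemma pm_ccore i c : pm y i c -> exists2 u, ccore i u & c = if u == m%:R then 0 else u /
    m%:R.
Proof.
move=> [s cs <-]; exists (scale m s); first exact: S_ccore.
by rewrite -to_circleE scaleK.
Qed.

Lemma pm_generic i c : c != 0 -> generic b g X Y (m%:R * c) -> pm y i c <-> core b g i
    (m%:R * c).
Proof.
move=> c0 gc; have mz : m%:R != 0 :> R by rewrite pnatr_eq0 -lt0n.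
split=> [/pm_ccore[u [u1 u2]]|cc].
  case: eqP => [_ e|_ e]; first by rewrite e eqxx in c0.
  have eu : u = m%:R * c by rewrite e; field.
  rewrite eu in u1 u2; split; first exact: generic_icc gc u1.
  by move=> k ki tk; apply/eqP/negPn/negP => nki; apply: (u2 k).
have /(core_highest i N.1 gc)[/andP[x1 x2] high] := cc.
have [[/andP[b1 b2] _]] := cc.
have um : m%:R * c < m%:R by have := lam_hi N.1 i; lra.
exists (unscale m (m%:R * c)); last by rewrite to_circleE lt_eqF // mulrAC mulfV // mul1r.
apply: subset_closure; apply/SE; rewrite unscaleK //; split; first by rewrite !ltW.
move=> j /andP[j1 j2]; apply: high; have [_ _ n3 n4] := gc j.
by rewrite !lt_neqAle n3 j1 j2 (eq_sym _ (Y j)) n4.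
Qed.

End Cactus.

(** * Arc lengths of the lobes *)

Section CactusMeasure.
Variables (R : realType) (m : nat).
Local Notation mu := (@lebesgue_measure R).

(** [A] is not assumed measurable: it consists of [B] without [F] and a finite set. *)
Lemma mu_mod_finite (A B F : set R) : finite_set F -> measurable B ->
  (forall x, ~ F x -> A x <-> B x) -> mu A = mu B.
Proof.
move=> fF mB H.
have mfin C : finite_set C -> measurable C /\ mu C = 0%E.
  move=> fC; have cC := finite_set_countable fC.
  by split; [exact: countable_measurable|exact: countable_lebesgue_measure0].
have K C : (forall x, ~ F x -> C x <-> B x) -> mu C = mu (B `\` F).
  move=> HC; have -> : C = (B `\` F) `|` (C `&` F).
    apply/seteqP; split=> x.
      by have [Fx|nF] := pselect (F x); [right|left; split=> //; apply/HC].
    by case=> [[Bx nF]|[]//]; apply/HC.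
  have fCF : finite_set (C `&` F) by apply: sub_finite_set fF => x [].
  have [m1 m2] := mfin _ fCF; have [m3 _] := mfin _ fF.
  rewrite measureU //; first by rewrite -[RHS]adde0; congr (_ + _)%E; exact: m2.
    exact: measurableD.
  by apply/seteqP; split=> // x [[_ nF] [_ Fx]].
by rewrite (K A H) (K B).
Qed.

Hypothesis m0 : (0 < m)%N.
Variables (b g X Y : 'I_m -> R) (h : 'I_m -> nat).
Hypothesis N : tight b g X Y h.
Local Notation ins := (inside b g).
Let mp : 0 < m%:R :> R. Proof. by rewrite ltr0n. Qed.

Definition coreset (i : 'I_m) : set R := [set c | core b g i (m%:R * c)].

Lemma coresetE i : coreset i = `]b i / m%:R, g i / m%:R[%classic `\`
  \bigcup_(k in [set k | k != i /\ ins k i]) `]b k / m%:R, g k / m%:R[%classic.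
Proof.
have E k c : (c \in `]b k / m%:R, g k / m%:R[%R) = (b k < m%:R * c < g k).
  by rewrite in_itv /= ltr_pdivrMr // ltr_pdivlMr // mulrC.
apply/seteqP; split=> c /=; rewrite E.
  move=> [ci H]; split=> // -[k [nki ki]] /=; rewrite E => /(H _ ki) e.
  by rewrite e eqxx in nki.
move=> [ci H]; split=> // k ki kc; apply/eqP/negPn/negP => nki; apply: H.
by exists k => //=; rewrite E.
Qed.

Lemma measurable_coreset i : measurable (coreset i).
Proof.
rewrite coresetE; apply: measurableD => //.
by apply: fin_bigcup_measurable => //; exact: finite_finset.
Qed.

Let ends_set : set R := [set b k / m%:R | k in setT] `|` [set g k / m%:R | k in setT].

Let finite_ends : finite_set ends_set.
Proof. by rewrite finite_setU; split; apply: finite_image; exact: finite_finset. Qed.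

Let ends_generic c k : ~ ends_set c -> b k <= m%:R * c <= g k -> b k < m%:R * c < g k.
Proof.
move=> nc /andP[l1 l2]; rewrite !lt_neqAle l1 l2 !andbT.
by apply/andP; split; apply/eqP => e; apply: nc; [left|right]; exists k => //;
    [rewrite e|rewrite -e];
  field; rewrite gt_eqF.
Qed.

Lemma trivIset_coreset : trivIset setT coreset.
Proof.
move=> i j _ _ [c [[/andP[i1 i2] ci] [/andP[j1 j2] cj]]]; apply/eqP/negPn/negP => nij.
have /or3P[/orP[]|s|s] := lam_tri N.1 nij; try lra.
  by move: nij; rewrite (cj _ s) ?eqxx ?i1.
by move: nij; rewrite (ci _ s) ?eqxx ?j1.
Qed.

Lemma core_exists i u : b i < u < g i -> exists2 j, ins j i & core b g j u.
Proof.
move=> ui; pose P j := ins j i && (b j < u < g j).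
have Pi : P i by rewrite /P inside_refl ui.
have [j /andP[ji uj] jmin] := arg_minnP (fun j => #|[set k | ins k j]%SET|) Pi.
exists j => //; split=> // k kj uk; apply/eqP/negPn/negP => nkj.
have := jmin k; rewrite /P (inside_trans kj ji) uk => /(_ isT); rewrite leqNgt => /negP;
    apply.
apply: proper_card; apply/properP; split.
  by apply/fintype.subsetP => l; rewrite !inE => /inside_trans; apply.
exists j; rewrite !inE ?inside_refl //; apply/negP => jk; move: nkj.
by rewrite (inside_anti N.1 kj jk) eqxx.
Qed.

Lemma core_total i : ((g i - b i) / m%:R)%:E = (\sum_(j < m | ins j i) mu (coreset j))%E.
Proof.
rewrite -measure_bigsetU_ord; last 2 first.
- exact: measurable_coreset.
- exact: trivIset_coreset.
have -> : ((g i - b i) / m%:R)%:E = mu `]b i / m%:R, g i / m%:R[%classic.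
  rewrite lebesgue_measure_itv /= lte_fin ltr_pM2r ?invr_gt0 // (lam_lt N.1).
  by rewrite -EFinB mulrBl.
apply/esym/(mu_mod_finite finite_ends) => // c nc.
rewrite -bigcup_seq_cond /=; split=> [[j /= /andP[_ /andP[l1 l2]] [/andP[j1 j2] _]]|].
  rewrite in_itv /= ltr_pdivrMr // ltr_pdivlMr // mulrC.
  by apply: (ends_generic nc); apply/andP; split; lra.
rewrite /= in_itv /= ltr_pdivrMr // ltr_pdivlMr // mulrC => /core_exists[j ji cj].
by exists j => //=; rewrite mem_index_enum ji.
Qed.

(** Induction on the number of nested cores. That number is also the length of [K_i], and every
    other nested core takes up [1/m] of the circle, which leaves [1/m] for [i]. *)
Lemma mu_coreset i : mu (coreset i) = (m%:R^-1)%:E.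
Proof.
have [n] := ubnP #|[set j | ins j i]%SET|; elim: n i => // n IH i; rewrite ltnS => le.
have lt j : ins j i -> j != i -> mu (coreset j) = (m%:R^-1)%:E.
  move=> ji nji; apply: IH; apply: leq_trans le; apply: proper_card; apply/properP; split.
    by apply/fintype.subsetP => l; rewrite !inE => /inside_trans; apply.
  exists i; rewrite !inE ?inside_refl //; apply/negP => ij; move: nji.
  by rewrite (inside_anti N.1 ji ij) eqxx.
have := core_total i; rewrite (bigD1 i) ?inside_refl //=.
rewrite (eq_bigr (fun=> (m%:R^-1)%:E)); last by move=> j /andP[ji nji]; exact: lt.
rewrite (eq_bigl (fun j => j \in ([set j | ins j i] :\ i)%SET)); last first.
  by move=> j; rewrite !inE andbC.
rewrite sumEFin sumr_const.
have := lam_len N.1 i; rewrite (cardsD1 i) inE inside_refl => ->.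
case: (mu (coreset i)) => [r| |] //=.
rewrite -EFinD => -[] e; congr (_%:E).
move: e; rewrite natrD -[_^-1 *+ _]mulr_natr => e.
set k : R := #|_|%:R in e.
have -> : r = (b i + (1 + k) - b i) / m%:R - m%:R^-1 * k by rewrite e; lra.
by field; rewrite gt_eqF.
Qed.

(* The length of the lobe [k] met between 0 and [u], in units where the circle
   has length 1. *)
Definition swept (k : 'I_m) (u : R) : R := fine (mu (coreset k `&` `[0, u / m%:R]%classic)).

Lemma swept_full k u : g k <= u -> m%:R * swept k u = 1.
Proof.
move=> gu; rewrite /swept; have -> : coreset k `&` `[0, u / m%:R]%classic = coreset k.
  apply/seteqP; split=> [c []//|c ck]; split=> //=; rewrite in_itv /=.
  have [/andP[c1 c2] _] := ck; have bk := lam_lo N.1 k.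
  rewrite ler_pdivlMr // mulrC; apply/andP; split; last lra.
  by rewrite -(pmulr_rge0 _ mp); lra.
by rewrite mu_coreset /= mulfV // gt_eqF.
Qed.

Lemma swept_empty k u : u <= b k -> swept k u = 0.
Proof.
move=> ub; rewrite /swept; have -> : coreset k `&` `[0, u / m%:R]%classic = set0.
  apply/seteqP; split=> // c [[/andP[c1 c2] _]] /=; rewrite in_itv /= => /andP[_].
  by rewrite ler_pdivlMr // mulrC; lra.
by rewrite measure0.
Qed.

(** The lobe of [k] avoids the interior of [K_i]; between [u] and [u'] only [u'] itself may escape
    this argument, and it is discarded as a null set. *)
Lemma swept_const k i u u' : i != k -> ins i k -> b i <= u -> u <= u' -> u' <= g i ->
  swept k u = swept k u'.
Proof.
move=> nik sik l1 l2 l3; rewrite /swept; congr fine.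
apply: (@mu_mod_finite _ _ [set u' / m%:R]); first exact: finite_set1.
  by apply: measurableI => //; exact: measurable_coreset.
move=> c /= nc; split=> -[ck]; rewrite /= !in_itv /= => /andP[c0 cu]; split=> //;
    rewrite ?in_itv /= c0 /=.
  by apply: le_trans cu _; rewrite ler_pM2r ?invr_gt0.
rewrite ler_pdivlMr // mulrC leNgt; apply/negP => lt.
have [_ H] := ck; move: nik; rewrite (H i) ?eqxx //; apply/andP; split; first lra.
move: cu; rewrite ler_pdivlMr // mulrC le_eqVlt => /orP[/eqP e|]; last lra.
by case: nc; rewrite -e; field; rewrite gt_eqF.
Qed.

End CactusMeasure.

Lemma has_size_le (R : eqType) (T : Type) (B : set T) (phi : T -> R) (l : seq R) :
  (forall q, B q -> phi q \in l) -> (forall q q', B q -> B q' -> phi q = phi q' -> q = q')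
      ->
  exists n, (n <= size l)%N /\ has_size B n.
Proof.
move=> Bl Binj; pose l' := undup [seq x <- l | `[< exists2 q, B q & phi q = x >]].
exists (size l'); split; first by apply: leq_trans (size_undup _) _;
    rewrite size_filter count_size.
have ex (k : 'I_(size l')) : exists q, B q /\ phi q = tnth (in_tuple l') k.
  have : tnth (in_tuple l') k \in l' by rewrite mem_tnth.
  by rewrite mem_undup mem_filter => /andP[/asboolP[q Bq e] _]; exists q.
have [f fP] := choice ex; exists f; split.
  move=> i j e; have [_ e1] := fP i; have [_ e2] := fP j; move: e1; rewrite e e2.
  have [x0 _] : exists x0 : R, True by exists (tnth (in_tuple l') i).
  rewrite !(tnth_nth x0) /= => /eqP; rewrite nth_uniq ?undup_uniq //.
  by move=> /eqP/val_inj.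
apply/seteqP; split=> q; first by move=> [k _ <-]; have [] := fP k.
move=> Bq; have ql : phi q \in l' by rewrite mem_undup mem_filter Bl // andbT;
    apply/asboolP; exists q.
have lt : (index (phi q) l' < size l')%N by rewrite index_mem.
exists (Ordinal lt) => //; have [Bf ef] := fP (Ordinal lt); apply: Binj => //.
by rewrite ef (tnth_nth (phi q)) /= nth_index.
Qed.

(** * Counting the black vertices on a lobe *)

Section Count.
Variables (R : realType) (m : nat).
Hypothesis m0 : (0 < m)%N.
Variables (z : config R m) (y : ovraw R m).
Hypothesis N : ctight z (height y.2).
Hypothesis yz : y.1 = lpair z.
Local Notation b := (cb z).
Local Notation g := (cg z).
Local Notation X := (cX z).
Local Notation Y := (cY z).
Local Notation ins := (inside b g).
Local Notation mu := (@lebesgue_measure R).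
Local Notation sw k u := (m%:R * swept b g k u).
Local Notation P := (pm y).
Let mp : 0 < m%:R :> R. Proof. by rewrite ltr0n. Qed.
Let mz : m%:R != 0 :> R. Proof. by rewrite gt_eqF. Qed.

Lemma frac0 : Defs.frac (0 : R) = 0. Proof. by rewrite /Defs.frac floor0 subrr. Qed.
Lemma frac1 : Defs.frac (1 : R) = 0. Proof. by rewrite /Defs.frac floor1 subrr. Qed.

(** Off 0 and the finitely many endpoints, the lobe of [k] is [coreset], and [gmap] sees only
    lengths. *)
Lemma gmap_swept u k : gmap P (u / m%:R) k = Defs.frac (sw k u).
Proof.
rewrite /gmap /swept; congr (Defs.frac (_ * fine _)).
pose F : set R := [set 0] `|` [set c | exists j, [\/ b j = m%:R * c, g j = m%:R * c, X j =
    m%:R * c | Y j = m%:R * c]].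
have fF : finite_set F.
  rewrite finite_setU; split; first exact: finite_set1.
  apply: (@sub_finite_set _ _ ([set b k / m%:R | k in setT] `|` [set g k / m%:R | k in
      setT] `|`
     [set X k / m%:R | k in setT] `|` [set Y k / m%:R | k in setT])).
    by move=> c [j] [] e; [left; left; left|left; left; right|left; right|right];
        exists j => //;
      rewrite e; field.
  by rewrite !finite_setU; do !split; apply: finite_image; exact: finite_finset.
apply: (mu_mod_finite fF); first by apply: measurableI => //; exact: measurable_coreset.
move=> c nc; have c0 : c != 0 by apply/eqP => e; apply: nc; left.
have gc : generic b g X Y (m%:R * c).
  by move=> j; split; apply/eqP => e; apply: nc; right; exists j;
    [constructor 1|constructor 2|constructor 3|constructor 4].
by split=> -[h1 h2]; split=> //; apply/(pm_generic m0 N yz k c0 gc).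
Qed.

Lemma gmap0 k : gmap P 0 k = 0.
Proof.
have := gmap_swept 0 k; rewrite mul0r => ->.
by rewrite swept_empty ?(lam_lo N.1) // mulr0 frac0.
Qed.

(** The circle identifies [u = m] with 0; there every lobe has been swept exactly once, and the
    fractional part 0 agrees with [gmap] at 0. *)
Lemma pm_point j c : P j c -> exists2 u, ccore z j u & forall k, gmap P c k = Defs.frac (sw
    k u).
Proof.
move=> /(pm_ccore m0 N yz)[u cu ->]; exists u => // k; case: eqP => [->|_];
    last exact: gmap_swept.
by rewrite gmap0 (swept_full m0 N) ?(lam_hi N.1) // frac1.
Qed.

(* Along the lobe [i] only the [i]-th coordinate of the cactus map moves. *)
Lemma swept_rigid i k u u' : k != i -> ccore z i u -> ccore z i u' -> Defs.frac (sw k u) =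
    Defs.frac (sw k u').
Proof.
move=> nki; wlog le : u u' / u <= u'.
  by move=> H c c'; have [l|/ltW l] := leP u u'; [exact: H|apply/esym/H].
move=> [/andP[u1 u2] cu] [/andP[u3 u4] cu'].
have /or3P[/orP[d|d]|s|s] := lam_tri N.1 nki.
- by rewrite !(swept_full m0 N) //; lra.
- by rewrite !swept_empty //; lra.
- have V v : ~ b k < v < g k -> Defs.frac (sw k v) = 0.
    move=> nv; have [l|l] := leP v (b k); first by rewrite swept_empty // mulr0 frac0.
    have [l'|l'] := leP (g k) v; first by rewrite (swept_full m0 N) // frac1.
    by case: nv; rewrite l l'.
  by rewrite !V //; [apply: cu'|apply: cu].
- by rewrite eq_sym in nki; rewrite (swept_const m0 nki s u1 le u4).
Qed.

Definition child (r i : 'I_m) := [/\ r != i, ins r i & forall p, p != r -> ins r p -> ins i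
    p].

Definition frames_above (i : 'I_m) : {set 'I_m} :=
  [set r | (fingraph.root (touch b g) r == r) && `[< child r i >]]%SET.

Lemma swept_conn i j r : cconn z j r -> j != i -> ins j i -> swept b g i (b j) = swept b g
    i (b r).
Proof.
apply: (@conn_ind _ _ b g (fun j r => j != i -> ins j i -> swept b g i (b j) = swept b g i
    (b r))) => {j r}.
  by [].
move=> j k r t _ IH nji ji; have [ki nki] := conn_inside N (connect1 t) nji ji.
rewrite -IH // {IH}.
have K a : a != i -> ins a i -> swept b g i (b a) = swept b g i (g a).
  move=> na ia; apply: (swept_const m0 na ia) => //.
  exact: (ltW (lam_lt N.1 a)).
by case/orP: t => /eqP e; [rewrite K // e|rewrite -e -K].
Qed.

(** Passing from [K_j] to a maximal core between it and [K_i], and then along the frame of that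
    core, the lobe of [i] makes no progress. *)
Lemma swept_frame i j : ins j i -> j != i -> exists2 r, r \in frames_above i &
  swept b g i (b j) = swept b g i (b r).
Proof.
move=> ji nji; pose Q k := [&& ins j k, ins k i & k != i].
have Qj : Q j by rewrite /Q inside_refl ji nji.
have [k /and3P[jk ki nki] kmax] := arg_maxnP (fun k => #|[set l | ins l k]%SET|) Qj.
have ck : child k i.
  split=> // p npk kp; have nip : i != p \/ i = p by case: (eqVneq i p); [right|left].
  case: nip => [nip|<-]; last exact: inside_refl.
  have /or3P[d|//|pi] := lam_tri N.1 nip.
    by case/orP: d; move: kp ki (lam_lt N.1 k) => /andP[? ?] /andP[? ?]; lra.
  have := kmax p; rewrite /Q (inside_trans jk kp) pi eq_sym nip => /(_ isT).
  rewrite /geq /= leqNgt => /negP; case; apply: proper_card; apply/properP; split.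
    by apply/fintype.subsetP => l; rewrite !inE => /inside_trans; apply.
  exists p; rewrite !inE ?inside_refl //; apply/negP => pk; move: npk.
  by rewrite (inside_anti N.1 pk kp) eqxx.
pose r := fingraph.root (touch b g) k.
have sym : connect_sym (touch b g) by move=> ? ?; exact: conn_sym.
have ckr : cconn z k r by apply: connect_root.
have [ri nri] := conn_inside N ckr nki ki.
exists r; last first.
  rewrite -(swept_conn ckr nki ki).
  have [e|njk] := eqVneq j k; first by rewrite e.
  apply/esym; have /andP[l1 l2] := jk.
  by apply: (swept_const m0 nki ki) => //; have := lam_lt N.1 j; lra.
rewrite inE root_root // eqxx /=; apply/asboolP; split=> // p npr rp.
have crk : cconn z r k by rewrite /cconn conn_sym.
rewrite eq_sym in npr; have [kp nkp] := conn_inside N crk npr rp.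
by have [_ _ H] := ck; apply: H => //; rewrite eq_sym.
Qed.

(** A black point other than the root lies on a lobe [j] different from [i], along which coordinate
    [i] is constant and can be read off at [b j]. It is 0 unless [K_j] is nested in [K_i], and then
    it depends only on the frame around [K_j]. *)
Lemma black_value i q : (blackpts P `&` lobe P i) q ->
  q i \in 0 :: [seq Defs.frac (sw i (b r)) | r <- enum (frames_above i)].
Proof.
have key j u : j != i -> ccore z j u ->
    Defs.frac (sw i u) \in 0 :: [seq Defs.frac (sw i (b r)) | r <- enum (frames_above i)].
  move=> nji cu; have bj : ccore z j (b j).
    split; first by rewrite lexx (ltW (lam_lt N.1 j)).
    by move=> k nkj s /andP[+ _]; have [l _] := N.2 _ _ nkj s; lra.
  rewrite (@swept_rigid j i u (b j)) 1?eq_sym //.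
  have Z v : (sw i v = 0 \/ sw i v = 1) -> Defs.frac (sw i v) \in 0 :: [seq Defs.frac (sw i
      (b r)) | r <- enum (frames_above i)].
    by move=> [->|->]; rewrite ?frac0 ?frac1 inE eqxx.
  have /or3P[/orP[d|d]|s|/andP[s1 s2]] := lam_tri N.1 nji.
  - by apply: Z; left; rewrite swept_empty ?mulr0 //; have := lam_lt N.1 j; lra.
  - by apply: Z; right; rewrite (swept_full m0 N).
  - have [r rF ->] := swept_frame s nji.
    by rewrite inE; apply/orP; right; apply/mapP; exists r; rewrite ?mem_enum.
  - by apply: Z; left; rewrite swept_empty ?mulr0.
move=> [[->|[j [k [njk [lj lk]]]]] _].
  by rewrite gmap0 inE eqxx.
have K l : lobe P l q -> l != i -> q i \in 0 :: [seq Defs.frac (sw i (b r)) | r <- enum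
    (frames_above i)].
  by move=> [c /pm_point[u cu e] <-] nli; rewrite e; exact: key nli cu.
have [ej|] := eqVneq j i; last exact: K.
by apply: (K k) => //; apply/eqP => ek; apply: njk; rewrite ej ek.
Qed.

Lemma lobe_rigid i q q' : lobe P i q -> lobe P i q' -> q i = q' i -> q = q'.
Proof.
move=> [c /pm_point[u cu e] <-] [c' /pm_point[u' cu' e'] <-] ei.
apply/funext => k; have [->//|nki] := eqVneq k i.
by rewrite e e'; exact: swept_rigid nki cu cu'.
Qed.

Lemma black_count i : exists n, (n <= #|frames_above i|.+1)%N /\ has_size (blackpts P `&`
    lobe P i) n.
Proof.
have [n [le hn]] := @has_size_le _ _ _ (fun q => q i) _ (@black_value i)
  (fun q q' h h' => lobe_rigid h.2 h'.2).
by exists n; split=> //; apply: leq_trans le _; rewrite /= size_map -cardE.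
Qed.

(* Translating a frame together with its intervals is a tangent direction unless
   the frame is the root frame, and these directions have disjoint supports. *)
Lemma frames_rank : (\sum_(i < m) #|frames_above i| <= tdim z)%N.
Proof.
pose Q : {set 'I_m} := [set r | (fingraph.root (touch b g) r == r) && `[< exists2 p, r != p
    & ins r p >]]%SET.
apply: (@leq_trans #|Q|).
  have -> : (\sum_(i < m) #|frames_above i| = \sum_(i < m) \sum_r if r \in frames_above i
      then 1 else 0)%N.
    by apply: eq_bigr => i _; rewrite -sum1_card big_mkcond.
  rewrite -[leqRHS]sum1_card exchange_big /= [leqRHS]big_mkcond /=; apply: leq_sum => r _.
  have [[i ri]|none] := pselect (exists i, r \in frames_above i); last first.
    by rewrite big1 // => i _; case: ifP => // ri; case: none; exists i.
  have rQ : r \in Q.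
    by move: ri; rewrite !inE => /andP[-> /asboolP[n s _]] /=; apply/asboolP; exists i.
  rewrite rQ (bigD1 i) //= ri big1 // => j nji; case: ifP => // rj.
  (* Two cores with the same child would be nested in each other, so each frame is counted once. *)
  move: ri rj; rewrite !inE => /andP[_ /asboolP[n s H]] /andP[_ /asboolP[n' s' H']].
  have ij : ins i j by apply: H => //; rewrite eq_sym.
  have ji : ins j i by apply: H' => //; rewrite eq_sym.
  by move: nji; rewrite (inside_anti N.1 ij ji) eqxx.
pose D : 'M[R]_(#|Q|, #|{: slot m}|) := \matrix_(i < #|Q|) vec (frame_ind z (enum_val i)).
have sD : (D <= tspace z)%MS.
  apply/row_subP => i; rewrite rowK; apply/tangentP.
  have : enum_val i \in Q by exact: enum_valP.
  rewrite inE => /andP[_ /asboolP[p np s]]; exact: (tangent_frame N np s).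
have fD : row_free D.
  (* The inverse evaluates at the left endpoint of the interval of each representative. *)
  apply/row_freeP; exists (\matrix_(v, j) (v == enum_rank ((false, false, enum_val j) :
      slot m))%:R).
  apply/matrixP => i j;
      rewrite mxE (bigD1 (enum_rank ((false, false, enum_val j) : slot m))) //= big1 => [|v
      nv].
    rewrite addr0 !mxE eqxx mulr1 enum_rankK /frame_ind /=; congr (nat_of_bool _)%:R.
    have sym : connect_sym (touch b g) by move=> ? ?; exact: conn_sym.
    have rt k : fingraph.root (touch b g) (enum_val (A := Q) k) = enum_val k.
      by have : enum_val k \in Q; [exact: enum_valP|rewrite inE => /andP[/eqP]].
    apply/idP/eqP => [/(fingraph.rootP sym)|->]; last exact: conn_refl.
    by rewrite !rt => /enum_val_inj.
  by rewrite !mxE (negbTE nv) mulr0.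
by rewrite /tdim -(eqP fD); exact: mxrankS.
Qed.

(** The predecessor of the number of black points absorbs the extra 1 of [black_count], which stands
    for the value 0 of the local root. *)
Lemma kaufmann_tdim n : (tdim z <= n)%N -> kaufmann_skel P n.
Proof.
move=> le; have [ns H] := choice black_count; exists ns; split; first by move=> i;
    case: (H i).
apply: leq_trans le; apply: leq_trans frames_rank; apply: leq_sum => i _.
by have [+ _] := H i; case: (ns i).
Qed.

End Count.

Section Cellular.
Variables (R : realType) (m : nat).
Hypothesis m0 : (0 < m)%N.

(** A point of a closed cell lies in an open cell of no larger dimension, and on an open cell [tdim]
    is constant and bounds Kaufmann's dimension. *)
Lemma ov_pm_cellular : pm_cellular (@ov_cell R m).
Proof.
move=> n x [k [le cx]] y vy ey.
have [l [ln lx]] : exists l, (cdim (@ov_cell R m l) <= n)%N /\ open_cell (ov_cell l) x.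
  have [ox|[p sp ->]] := closed_cellE cx; first by exists k.
  have [l [lt ol]] := ov_cell_boundary m0 sp; exists l; split=> //.
  exact: leq_trans (ltnW lt) le.
have [z op ex] := iffLR (open_cellE (rep_normal l).1 _) lx.
have N := open_tight (rep_normal l).1 op.
have r := cls_rel (lpair_valid m0 (rep l).2 N.1) (etrans ey ex).
apply: (kaufmann_tdim m0 (z := z)); last by rewrite -(tdim_open op).
  apply: (tight_change N) => i j l1 l2; apply/esym/(ov_rel_heights r).
  by rewrite r.1; apply/(lpair_meet m0).
exact: r.1.
Qed.

End Cellular.

Theorem theorem5p6 (R : realType) (m : nat) (hm : (1 <= m)%N) :
  exists (I : finType) (cs : I -> cell R m),
    regular_cw (@Ov1 R m) cs /\ pm_cellular cs.
Proof.
exists (cell_index R m), (@ov_cell R m); split.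
  exact: ov_regular_cw.
exact: ov_pm_cellular.
Qed.
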